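(* Let $u$ be the solution of the problem $(\mathcal N)$ described in the context, and let $(U_h^n)_{n=0}^N\subset S_h$ be the Crank–Nicolson fully discrete approximations, i.e. $U_h^0=R_hu_0$ and, for $n=1,\dots,N$ and all $\chi\in S_h$, $$\Big(\tfrac{U_h^n-U_h^{n-1}}{k_n},\chi\Big)=\mathrm{i}\,a^{n-\frac12}\mu^{n-\frac12}\Big[S^{n-\frac12}\,\tfrac{U_h^n(1)-U_h^{n-1}(1)}{k_n}+G^{n-\frac12}\,\mathcal AU_h^n(1)\Big]\overline{\chi(1)}-\mathrm{i}\,a^{n-\frac12}\mathcal B(\mathcal AU_h^n,\chi)+\mathrm{i}\,(\beta^{n-\frac12}\mathcal AU_h^n,\chi)+(f^{n-\frac12},\chi).$$ Assume that $\mu(t)\le0$ and $S(t)>0$ for $t\in[0,T]$, and let $C_\star\ge0$. Then there exist a constant $C_1\ge 0$ and a constant $C>0$, independent of $h$ and of the partition of $[0,T]$, such that: if the partition satisfies $$|k_{n+1}-k_n|\le C_\star\max\{k_n^2,k_{n+1}^2\},\quad n=1,\dots,N-1,\qquad\text{and}\qquad \max_{1\le n\le N}(C_1k_n)\le\tfrac13,$$ then for $\ell=0,1$ $$\max_{0\le n\le N}\|U_h^n-u(t^n,\cdot)\|_\ell\le C\,(k^2+h^{r+1-\ell})\,\Xi_{\mathcal N}(u)\qquad\forall\,h\in(0,h_\star],$$ where $$\Xi_{\mathcal N}(u):=\sum_{\ell=0}^2\max_{[0,T]}\|\partial_t^\ell u\|_{r+1}+\max_{[0,T]}\|\partial_t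^3u\|_1+\max_{[0,T]}\|\partial_t^4u\|+\max_{t\in[0,T]}|\partial_t^3u(t,1)|.$$
   Context: Function spaces: $D=(0,1)$; functions are complex-valued; $(f_1,f_2)=\int_D f_1\overline{f_2}\,dx$ and $\|\cdot\|=\|\cdot\|_0$ is the $L^2(D)$ norm; $\|f\|_s=\big(\sum_{\ell=0}^s\|\partial_x^\ell f\|^2\big)^{1/2}$ is the norm of $H^s(D)$; $|v|_1=\|v'\|$; $\mathbb H^1(D)=\{v\in H^1(D):v(0)=0\}$, $\mathbb H^s(D)=H^s(D)\cap\mathbb H^1(D)$ for $s\ge2$; $\mathcal B(v,w)=(v',w')$. Finite elements: $r\in\mathbb N$, $h_\star>0$ are fixed. For each $h\in(0,h_\star]$, $S_h$ is a finite-dimensional subspace of $\mathbb H^1(D)$ consisting of complex-valued functions that are polynomials of degree at most $r$ on each interval of a (non-uniform) partition of $D$ with maximum length $h$ (in particular the function $x\mapsto x$ is in $S_h$). With constants independent of $h$, one has the approximation property $\inf_{\chi\in S_h}\{\|v-\chi\|+h\|v-\chi\|_1\}\le C h^{s+1}\|v\|_{s+1}$ for $v\in\mathbb H^{s+1}(D)$, $s=0,\dots,r$, and it is assumed that the inverse inequality $|\phi|_1\le C h^{-1}\|\phi\|$ holds for all $\phi\in S_h$. The elliptic projection $R_h:H^1(D)\to S_h$ is defined by $\mathcal B(R_hv,\phi)=\mathcal B(v,\phi)$ for all $\phi\in S_h$. Time partition: $0=t^0<t^1<\dots<t^N=T$, $k_n=t^n-t^{n-1}$, $k=\max_{1\le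 n\le N}k_n$, $t^{n-\frac12}=\frac12(t^{n-1}+t^n)$; $\mathcal AV^n=\frac12(V^n+V^{n-1})$; a superscript $n-\frac12$ on $a,\mu,S,G,\beta,f$ denotes evaluation at $t=t^{n-\frac12}$. Problem $(\mathcal N)$: given $T>0$, $a:[0,T]\to\mathbb R\setminus\{0\}$, $\beta,f:[0,T]\times\overline D\to\mathbb C$, $u_0:\overline D\to\mathbb C$, $\mu,S:[0,T]\to\mathbb R$, $G:[0,T]\to\mathbb C$, find $u:[0,T]\times\overline D\to\mathbb C$ with $u_t=\mathrm{i}\,a(t)u_{xx}+\mathrm{i}\,\beta(t,x)u+f(t,x)$ on $[0,T]\times\overline D$; $u(t,0)=0$ and $u_x(t,1)=\mu(t)\,[S(t)u_t(t,1)+G(t)u(t,1)]$ for $t\in[0,T]$; $u(0,x)=u_0(x)$ for $x\in\overline D$. It is assumed that $u$ exists uniquely and that the data and $u$ are sufficiently smooth for the stated estimate. *)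

(* Defs.v *)
From mathcomp Require Import all_boot all_order all_algebra.
From mathcomp Require Import complex.
From mathcomp Require Import all_classical all_reals all_analysis.
Set Implicit Arguments.
Unset Strict Implicit.
Unset Printing Implicit Defensive.
Import Order.TTheory GRing.Theory Num.Theory.
Import numFieldNormedType.Exports.
Local Open Scope classical_set_scope.
Local Open Scope ring_scope.

(* A function on [0, 1] (resp. on [0, T] x [0, 1]) is represented by a total
   function R -> R[i] (resp. R -> R -> R[i], time variable first); only its
   values on the domain are ever used. *)

Section ComplexFunctions.
Context {R : realType}.
Implicit Types (A : set R) (f g v w : R -> R[i]).

Definition cabs (z : R[i]) : R := complex.Re `|z|.

Definition ccontinuous_on (X : topologicalType) (A : set X) (F : X -> R[i]) :=
  {within A, continuous (fun x => complex.Re (F x))} /\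
  {within A, continuous (fun x => complex.Im (F x))}.

(* Derivative relative to the set A, hence one-sided at the end points of a
   closed interval. *)
Definition is_deriv_in A f (x : R) (l : R[i]) :=
  ((y - x)^-1 * (complex.Re (f y) - complex.Re (f x)))
     @[y --> within A x^'] --> complex.Re l /\
  ((y - x)^-1 * (complex.Im (f y) - complex.Im (f x)))
     @[y --> within A x^'] --> complex.Im l.

Definition deriv_in A f (x : R) : R[i] := xget 0 [set l | is_deriv_in A f x l].

Definition C1_on A f :=
  (forall x, A x -> is_deriv_in A f x (deriv_in A f x)) /\
  ccontinuous_on (A : set R) (deriv_in A f).

End ComplexFunctions.

Section Sobolev.
Context {R : realType}.
Implicit Types (f g v w : R -> R[i]).

Let D : set R := `]0, 1[.
Let mu := @lebesgue_measure R.

Definition cint f : R[i] :=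
  Complex (Rintegral mu D (fun x => complex.Re (f x)))
          (Rintegral mu D (fun x => complex.Im (f x))).

Definition ip f g : R[i] := cint (fun x => f x * (g x)^*%C).

Definition L2norm f : R := Num.sqrt (complex.Re (ip f f)).

Definition L2 f :=
  [/\ measurable_fun D (fun x => complex.Re (f x)),
      measurable_fun D (fun x => complex.Im (f x)) &
      mu.-integrable D (fun x => (cabs (f x) ^+ 2)%:E)].

Definition test_fun (phi : R -> R) :=
  [/\ forall x, derivable phi x 1, continuous (derive1 phi) &
      exists a b, [/\ 0 < a, b < 1 & forall x, x \notin `[a, b] -> phi x = 0]].

Definition weak_deriv v w :=
  [/\ L2 v, L2 w &
      forall phi, test_fun phi ->
        cint (fun x => v x * (derive1 phi x)%:C%C) =
        - cint (fun x => w x * (phi x)%:C%C)].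

(* The weak derivative, which is unique almost everywhere in D. *)
Definition wD v : R -> R[i] := xget (fun=> 0) [set w | weak_deriv v w].

Fixpoint sobolev (s : nat) v : Prop :=
  if s is s'.+1 then exists2 w, weak_deriv v w & sobolev s' w else L2 v.

Definition Hnorm (s : nat) v : R :=
  Num.sqrt (\sum_(l < s.+1) L2norm (iter l wD v) ^+ 2).

Definition H1semi v : R := L2norm (wD v).

Definition Bform v w : R[i] := ip (wD v) (wD w).

(* H^s(D) with the condition v(0) = 0, for s >= 1. Elements of H^1(D) are
   identified with their continuous representatives on [0, 1]. *)
Definition sobolev0 (s : nat) v :=
  [/\ sobolev s v, ccontinuous_on (`[0, 1] : set R) v & v 0 = 0].

End Sobolev.

Section FiniteElements.
Context {R : realType}.
Implicit Types (S : set (R -> R[i])).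

Definition subspace S :=
  S (fun=> 0) /\
  forall (c : R[i]) v w, S v -> S w -> S (fun x => c * v x + w x).

Definition finite_dim S :=
  exists (m : nat) (e : 'I_m -> R -> R[i]), (forall i, S (e i)) /\
    forall v, S v -> exists c : 'I_m -> R[i],
      forall x, x \in `[0, 1] -> v x = \sum_i c i * e i x.

Definition piecewise_poly (r M : nat) (p : nat -> R) (v : R -> R[i]) :=
  forall j, (j < M)%N -> exists q : {poly R[i]}, (size q <= r.+1)%N /\
    forall x, x \in `[p j, p j.+1] -> v x = q.[x%:C%C].

Definition is_partition (b : R) (M : nat) (p : nat -> R) :=
  [/\ p 0%N = 0, p M = b & forall j, (j < M)%N -> p j < p j.+1].

Definition fe_space (r : nat) (h : R) S :=
  [/\ subspace S, finite_dim S, S `<=` sobolev0 1,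
      exists2 v, S v & forall x, x \in `[0, 1] -> v x = x%:C%C &
      exists (M : nat) (p : nat -> R),
        [/\ is_partition 1 M p,
            \big[Num.max/0]_(j < M) (p j.+1 - p j) = h &
            S `<=` piecewise_poly r M p]].

Definition approximation_property (r : nat) (hstar : R)
    (Sh : R -> set (R -> R[i])) :=
  exists c : R, forall h, 0 < h <= hstar ->
    forall (s : nat), (s <= r)%N -> forall v, sobolev0 s.+1 v ->
      inf [set L2norm (v \- chi) + h * Hnorm 1 (v \- chi) | chi in Sh h]
        <= c * h ^+ s.+1 * Hnorm s.+1 v.

Definition inverse_inequality (hstar : R) (Sh : R -> set (R -> R[i])) :=
  exists c : R, forall h, 0 < h <= hstar ->
    forall phi, Sh h phi -> H1semi phi <= c * h^-1 * L2norm phi.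

Definition fe_family (r : nat) (hstar : R) (Sh : R -> set (R -> R[i])) :=
  [/\ forall h, 0 < h <= hstar -> fe_space r h (Sh h),
      approximation_property r hstar Sh & inverse_inequality hstar Sh].

(* w = R_h v; this determines w on [0, 1]. *)
Definition is_elliptic_projection S (v w : R -> R[i]) :=
  S w /\ forall phi, S phi -> Bform w phi = Bform v phi.

End FiniteElements.

Section Problem.
Context {R : realType}.
Variable T : R.
Implicit Types (u beta f : R -> R -> R[i]).

Definition dt u : R -> R -> R[i] :=
  fun t x => deriv_in `[0, T] (fun s => u s x) t.

Definition dx u : R -> R -> R[i] :=
  fun t x => deriv_in `[0, 1] (u t) x.

Definition pd (i j : nat) u : R -> R -> R[i] := iter j dx (iter i dt u).

(* All derivatives d_x^j d_t^i u with (i, j) in the (downward closed) set I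
   exist classically and are continuous on [0, T] x [0, 1], and the order of
   differentiation is immaterial. *)
Definition smooth (I : nat -> nat -> bool) u :=
  forall i j, I i j ->
  [/\ ccontinuous_on (`[0, T] `*` `[0, 1] : set (R * R))
        (fun p => pd i j u p.1 p.2),
      I i.+1 j -> forall t x, t \in `[0, T] -> x \in `[0, 1] ->
        is_deriv_in `[0, T] (fun s => pd i j u s x) t (pd i.+1 j u t x) &
      I i j.+1 -> forall t x, t \in `[0, T] -> x \in `[0, 1] ->
        is_deriv_in `[0, 1] (pd i j u t) x (pd i j.+1 u t x)].

(* The derivatives of u that occur in the error bound. *)
Definition solution_orders (r i j : nat) : bool :=
  [|| (i <= 2)%N && (j <= r.+1)%N, (i == 3%N) && (j <= 1)%N
    | (i == 4%N) && (j == 0%N)].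

Definition smooth_coefficients (a : R -> R) beta (mu S : R -> R)
    (G : R -> R[i]) :=
  [/\ C1_on `[0, T] (fun t => (a t)%:C%C), smooth (fun i j => i + j <= 1)%N beta,
      C1_on `[0, T] (fun t => (mu t)%:C%C),
      C1_on `[0, T] (fun t => (S t)%:C%C) & C1_on `[0, T] G].

Definition solves (r : nat) (a : R -> R) beta f (u0 : R -> R[i])
    (mu S : R -> R) (G : R -> R[i]) u :=
  [/\ smooth (solution_orders r) u,
      forall t x, t \in `[0, T] -> x \in `[0, 1] ->
        dt u t x = 'i%C * (a t)%:C%C * dx (dx u) t x
                   + 'i%C * beta t x * u t x + f t x,
      forall t, t \in `[0, T] -> u t 0 = 0,
      forall t, t \in `[0, T] ->
        dx u t 1 = (mu t)%:C%C * ((S t)%:C%C * dt u t 1 + G t * u t 1) &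
      forall x, x \in `[0, 1] -> u 0 x = u0 x].

Definition is_unique_solution (r : nat) (a : R -> R) beta f (u0 : R -> R[i])
    (mu S : R -> R) (G : R -> R[i]) u :=
  solves r a beta f u0 mu S G u /\
  forall v, solves r a beta f u0 mu S G v ->
    forall t x, t \in `[0, T] -> x \in `[0, 1] -> v t x = u t x.

(* Under [smooth] the functions of t below are continuous, so that [sup] is
   a maximum. *)
Definition max_time (g : R -> R) : R := sup (g @` `[0, T]).

Definition Xi (r : nat) u : R :=
  \sum_(l < 3) max_time (fun t => Hnorm r.+1 (iter l dt u t))
  + max_time (fun t => Hnorm 1 (iter 3 dt u t))
  + max_time (fun t => L2norm (iter 4 dt u t))
  + max_time (fun t => cabs (iter 3 dt u t 1)).

End Problem.

Section CrankNicolson.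
Context {R : realType}.
Variable t : nat -> R.

Definition step (n : nat) : R := t n - t n.-1.

Definition max_step (N : nat) : R := \big[Num.max/0]_(1 <= n < N.+1) step n.

Definition midpoint (n : nat) : R := (t n.-1 + t n) / 2.

Definition average (U : nat -> R -> R[i]) (n : nat) : R -> R[i] :=
  fun x => (U n x + U n.-1 x) / 2.

Definition quotient (U : nat -> R -> R[i]) (n : nat) : R -> R[i] :=
  fun x => (U n x - U n.-1 x) / (step n)%:C%C.

Definition crank_nicolson (a : R -> R) (beta f : R -> R -> R[i])
    (u0 : R -> R[i]) (mu S : R -> R) (G : R -> R[i])
    (Sh : set (R -> R[i])) (N : nat) (U : nat -> R -> R[i]) :=
  [/\ is_elliptic_projection Sh u0 (U 0%N),
      forall n, (n <= N)%N -> Sh (U n) &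
      forall n, (1 <= n <= N)%N -> forall chi, Sh chi ->
        let m := midpoint n in
        ip (quotient U n) chi =
          'i%C * (a m)%:C%C * (mu m)%:C%C
            * ((S m)%:C%C * quotient U n 1 + G m * average U n 1)
            * (chi 1)^*%C
          - 'i%C * (a m)%:C%C * Bform (average U n) chi
          + 'i%C * ip (fun x => beta m x * average U n x) chi
          + ip (f m) chi].

End CrankNicolson.

(* Main.v *)
From HB Require Import structures.
Require Import Defs.
From mathcomp Require Import all_boot all_order all_algebra.
From mathcomp Require Import complex.
From mathcomp Require Import all_classical all_reals all_analysis.
From mathcomp Require Import measurable_realfun ring lra.
Import Order.TTheory GRing.Theory Num.Theory.
Import numFieldNormedType.Exports.
Local Open Scope classical_set_scope.
Local Open Scope ring_scope.
Set Implicit Arguments.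
Unset Strict Implicit.
Unset Printing Implicit Defensive.

(** Let W^n be the elliptic projection of u(t^n), theta^n = U^n - W^n and
    rho^n = u(t^n) - W^n. Best approximation and Aubin-Nitsche duality give
    |rho|_1 = O(h^r) and |rho|_0 = O(h^(r+1)), for u as well as for its
    difference quotients and increments in time
    ([elliptic_projection_bounds]). Because x |-> x is a finite element
    function, rho vanishes at x = 1 ([elliptic_error_at_1]), so the dynamical
    boundary condition only sees theta and the time discretization. It
    remains to bound |theta|_1 by O(k^2 + h^(r+1)); as theta vanishes at
    x = 0, this bounds theta in L^2 too.

    The scheme minus the weak form of the equation at the midpoint is a scheme
    for theta with a consistency error on the right. Complex function spaces
    are regarded as real vector spaces: the real parts of the sesquilinear
    forms are semi-inner products, and multiplication by the imaginary unit is
    a rotation J for each of them. Let d theta be the difference quotient of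
    theta and A theta its average, both over one step.

    The test function J (d theta) turns the Schroedinger term into
    (A theta, d theta)_1, which is half of the increment of |theta|_1^2
    divided by k_n, and the boundary term into mu S |d theta (1)|^2. The
    latter is nonpositive, as mu <= 0 < S, and pays for all other boundary
    terms. The term (beta A theta, d theta) is dangerous, because d theta is
    not controlled in L^2. Its first factor can be replaced by the L^2
    projection q of beta A theta to the finite element space, and then the
    scheme itself, tested with q, expresses (d theta, q) by harmless terms.
    This needs |q|_1 <= C |A theta|_1, the stability of the L^2 projection
    in H^1, and is where the inverse inequality enters
    ([l2_projection_stable]). The result is [energy_step].

    What is left is the consistency error F_n (d theta), with F_n a linear
    functional bounded by C (k^2 + h^(r+1)) in the H^1 seminorm. It is summed
    by parts in time, which moves the difference quotient to F_n. The increment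
    of F_n over one step is O((k^2 + h^(r+1)) (k_n + k_(n+1))) only if that
    holds for the leading terms k_n^2 / 24 u_ttt and k_n^2 / 8 u_tt of the
    midpoint errors, and this is what the restriction on k_(n+1) - k_n is for
    ([curve_midpoint_diff_le], [curve_average_diff_le]). The boundary terms of
    the summation by parts are absorbed in the modified energy
    |theta|_1^2 - 2 F_n (theta), to which a discrete Gronwall argument applies
    ([modified_energy_gronwall]).

    Finite element functions, and the values of u and of its derivatives at
    one time, are represented by pairs (v, v') of bounded measurable functions
    that satisfy integration by parts. Weak derivatives are unique almost
    everywhere ([weak_deriv_unique]), so norms and forms defined by a chosen
    weak derivative can be computed with the second component. *)

(** * A discrete Gronwall inequality *)

Section Gronwall.
Context {R : realType}.

Lemma expR_2x_ge (x : R) : 0 <= x <= 1 / 2 -> 1 <= (1 - x) * expR (2 * x).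
Proof.
move=> /andP[x0 x1]; have h := expR_ge1Dx (2 * x).
have h2 : (1 - x) * (1 + 2 * x) <= (1 - x) * expR (2 * x).
  by rewrite ler_wpM2l // subr_ge0; lra.
apply: le_trans h2; nra.
Qed.

(** Here y n is the H^1 seminorm of the error at t n, F1 n.+1 and F0 n.+1 are the
    consistency functional of step n.+1 at its new and at its old end.
    Summation by parts is hidden in the modified energy
    E n = y n ^ 2 - 2 * F1 n + const * eps ^ 2, which is comparable to y n ^ 2:
    its increment contains F1 n - F0 n.+1, the change of the functional at a
    fixed argument, which is as small as a step. As t n.+1 - t n.-1 appears on
    the right, E is compared with the exponential of 3 * t n + t n.-1. *)
Lemma modified_energy_gronwall (N : nat) (t y F0 F1 : nat -> R) (K L eps : R) :
  0 <= K -> 0 <= L -> 0 <= eps -> t 0%N = 0 -> y 0%N = 0 ->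
  F1 0%N = 0 -> F0 1%N = 0 ->
  (forall n, (n < N)%N -> t n <= t n.+1) ->
  (forall n, (n < N)%N ->
    y n.+1 ^+ 2 - y n ^+ 2
      <= K * (t n.+1 - t n) * (y n.+1 ^+ 2 + y n ^+ 2 + eps ^+ 2)
         + 2 * (F1 n.+1 - F0 n.+1)) ->
  (forall n, (n <= N)%N -> `|F1 n| <= L * eps * y n) ->
  (forall n, (0 < n < N)%N ->
    `|F0 n.+1 - F1 n| <= L * eps * (t n.+1 - t n.-1) * y n) ->
  (forall n, (n < N)%N ->
    (4 * K + L ^+ 2 + 2) * (t n.+1 - t n) <= 1 / 3) ->
  forall n, (n <= N)%N ->
    y n ^+ 2 <= 2 * (4 * L ^+ 2 + 1) * eps ^+ 2
      * expR ((4 * K + L ^+ 2 + 2) * (3 * t n + t n.-1)).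
Proof.
move=> K0 L0 e0 t0 y0 F10 F01 tm Hen HF1 HF01 Hk.
set c := 4 * K + L ^+ 2 + 2.
pose E n := y n ^+ 2 - 2 * F1 n + (4 * L ^+ 2 + 1) * eps ^+ 2.
have c0 : 0 <= c by rewrite /c; nra.
have E_ge n : (n <= N)%N -> y n ^+ 2 <= 2 * E n /\ eps ^+ 2 <= E n.
  move=> nN; have := HF1 _ nN; rewrite ler_norml => /andP[_ h].
  by rewrite /E; split; nra.
suff H n : (n <= N)%N ->
    E n <= (4 * L ^+ 2 + 1) * eps ^+ 2 * expR (c * (3 * t n + t n.-1)).
  move=> n nN; have [h _] := E_ge _ nN.
  by apply: (le_trans h); have := H _ nN; rewrite -!(mulrA 2); lra.
elim: n => [_|n IH nN].
  by rewrite /E F10 y0 /= t0 !mulr0 addr0 mulr0 expR0 expr0n /=; lra.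
have nN' : (n <= N)%N by exact: ltnW.
have {}IH := IH nN'.
have [y1 e1] := E_ge _ nN.
have [y2 e2] := E_ge _ nN'.
have kn : 0 <= t n.+1 - t n by rewrite subr_ge0 tm.
have kp : 0 <= t n - t n.-1.
  by case: n nN {nN' IH y1 e1 y2 e2 kn} => [|n] nN //=; rewrite subr_ge0 // tm // ltnW.
have Fd : 2 * (F1 n - F0 n.+1) <= (t n.+1 - t n.-1) * (L ^+ 2 * eps ^+ 2 + y n ^+ 2).
  case: (posnP n) => [n0|n_gt0].
    rewrite n0 F10 F01 subr0 mulr0; apply: mulr_ge0; first by rewrite /= -n0.
    have := sqr_ge0 (L * eps); have := sqr_ge0 (y 0%N). nra.
  have := HF01 n; rewrite n_gt0 nN => /(_ isT); rewrite ler_norml => /andP[h _].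
  have : 0 <= (t n.+1 - t n.-1) * (L * eps - y n) ^+ 2.
    by rewrite mulr_ge0 ?sqr_ge0 //; lra.
  nra.
have step : E n.+1 * (1 - c * (t n.+1 - t n))
    <= E n * (1 + c * (t n.+1 - t n.-1)).
  have := Hen _ nN.
  have En0 : 0 <= E n by apply: le_trans e2; exact: sqr_ge0.
  have En1 : 0 <= E n.+1 by apply: le_trans e1; exact: sqr_ge0.
  (* Both y n ^ 2 <= 2 * E n and eps ^ 2 <= E n, so y and eps are eliminated. *)
  have h1 : K * (t n.+1 - t n) * (y n.+1 ^+ 2 + y n ^+ 2 + eps ^+ 2) <=
     K * (t n.+1 - t n) * (2 * E n.+1 + 3 * E n).
    by apply: ler_wpM2l; [exact: mulr_ge0 | lra].
  have h2 : (t n.+1 - t n.-1) * (L ^+ 2 * eps ^+ 2 + y n ^+ 2) <=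
      (t n.+1 - t n.-1) * ((L ^+ 2 + 2) * E n).
    apply: ler_wpM2l; first by lra.
    have : L ^+ 2 * eps ^+ 2 <= L ^+ 2 * E n by rewrite ler_wpM2l ?sqr_ge0.
    lra.
  have EE : E n.+1 - E n = (y n.+1 ^+ 2 - y n ^+ 2) - 2 * (F1 n.+1 - F0 n.+1)
     + 2 * (F1 n - F0 n.+1) by rewrite /E; ring.
  move=> h3.
  have h4 : E n.+1 - E n <= K * (t n.+1 - t n) * (2 * E n.+1 + 3 * E n) +
     (t n.+1 - t n.-1) * ((L ^+ 2 + 2) * E n) by lra.
  have h5 : 0 <= (t n.+1 - t n) * E n.+1 * (2 * K + L ^+ 2 + 2).
    by rewrite !mulr_ge0 // ?addr_ge0 ?mulr_ge0 ?sqr_ge0.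
  have h6 : 0 <= (t n.+1 - t n) * E n * K by rewrite !mulr_ge0.
  have h7 : 0 <= (t n - t n.-1) * E n * K by rewrite !mulr_ge0.
  rewrite /c; nra.
have hc : 0 <= c * (t n.+1 - t n) <= 1 / 2.
  rewrite mulr_ge0 //= (le_trans (Hk _ nN)) //; lra.
have hx := expR_2x_ge hc.
have En1 : 0 <= E n.+1 by apply: le_trans e1; exact: sqr_ge0.
have En0 : 0 <= E n by apply: le_trans e2; exact: sqr_ge0.
have s1 : E n.+1 <= E n.+1 * (1 - c * (t n.+1 - t n)) * expR (2 * (c * (t n.+1 - t n))).
  by rewrite -mulrA ler_peMr.
apply: (le_trans s1).
apply: le_trans (_ : E n * (1 + c * (t n.+1 - t n.-1)) * expR (2 * (c * (t n.+1 - t n))) <= _).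
  by rewrite ler_wpM2r // expR_ge0.
apply: le_trans (_ : E n * expR (c * (t n.+1 - t n.-1)) * expR (2 * (c * (t n.+1 - t n))) <= _).
  rewrite ler_wpM2r ?expR_ge0 // ler_wpM2l //; exact: expR_ge1Dx.
apply: le_trans (_ : (4 * L ^+ 2 + 1) * eps ^+ 2 * expR (c * (3 * t n + t n.-1)) * expR (c * (t n.+1 - t n.-1)) * expR (2 * (c * (t n.+1 - t n))) <= _).
  by rewrite !ler_wpM2r ?expR_ge0.
have -> : c * (3 * t n.+1 + t n.+1.-1) = c * (3 * t n + t n.-1)
    + c * (t n.+1 - t n.-1) + 2 * (c * (t n.+1 - t n)) by rewrite /=; ring.
by rewrite !expRD !mulrA.
Qed.

End Gronwall.

(** * Semi-inner products and weakly differentiable curves *)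

Section SemiInner.
Context {R : realType} {V : lmodType R}.
Implicit Types (m : V -> V -> R) (u v w : V).

(** The instances are the H^1 seminorm, the modulus at an end point and the
    L^2 norm of functions, none of which is definite. *)
Definition semi_inner m :=
  [/\ forall u v, m u v = m v u,
      forall a u v w, m (a *: u + v) w = a * m u w + m v w &
      forall u, 0 <= m u u].

Definition nrm m v : R := Num.sqrt (m v v).

Lemma nrm_ge0 m v : 0 <= nrm m v. Proof. exact: sqrtr_ge0. Qed.

Variable m : V -> V -> R.
Hypothesis Hm : semi_inner m.

Lemma sipC u v : m u v = m v u. Proof. by case: Hm. Qed.
Lemma sip_ge0 u : 0 <= m u u. Proof. by case: Hm. Qed.
Lemma sip0l w : m 0 w = 0.
Proof.
case: Hm => _ /(_ (-1) 0 0 w) + _; rewrite scaler0 addr0 mulN1r addNr.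
by move=> ->.
Qed.
Lemma sipDl u v w : m (u + v) w = m u w + m v w.
Proof. by case: Hm => _ /(_ 1 u v w) + _; rewrite scale1r mul1r. Qed.
Lemma sipZl a u w : m (a *: u) w = a * m u w.
Proof. by case: Hm => _ /(_ a u 0 w) + _; rewrite addr0 sip0l addr0. Qed.
Lemma sipNl u w : m (- u) w = - m u w.
Proof. by rewrite -scaleN1r sipZl mulN1r. Qed.
Lemma sipBl u v w : m (u - v) w = m u w - m v w.
Proof. by rewrite sipDl sipNl. Qed.
Lemma sip0r w : m w 0 = 0. Proof. by rewrite sipC sip0l. Qed.
Lemma sipDr u v w : m w (u + v) = m w u + m w v.
Proof. by rewrite sipC sipDl !(sipC w). Qed.
Lemma sipZr a u w : m w (a *: u) = a * m w u.
Proof. by rewrite sipC sipZl (sipC w). Qed.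
Lemma sipNr u w : m w (- u) = - m w u.
Proof. by rewrite sipC sipNl (sipC w). Qed.
Lemma sipBr u v w : m w (u - v) = m w u - m w v.
Proof. by rewrite sipDr sipNr. Qed.

Lemma sqr_nrm u : nrm m u ^+ 2 = m u u.
Proof. by rewrite sqr_sqrtr // sip_ge0. Qed.

(** The quadratic polynomial c |-> m (u + c v, u + c v) is nonnegative; if
    m v v = 0 it is affine, hence constant. *)
Lemma cauchy_schwarz u v : `|m u v| <= nrm m u * nrm m v.
Proof.
have key c : 0 <= m u u + 2 * c * m u v + c ^+ 2 * m v v.
  have := sip_ge0 (u + c *: v).
  by rewrite !(sipDl, sipDr, sipZl, sipZr) (sipC v u); congr (_ <= _); ring.
rewrite -sqrtrM ?sip_ge0 // -sqrtr_sqr ler_sqrt ?sqr_ge0 ?mulr_ge0 ?sip_ge0 //.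
have := sip_ge0 v; rewrite le_eqVlt => /predU1P[v0|v0].
  rewrite -v0 mulr0; have [->|uv0] := eqVneq (m u v) 0; first by rewrite expr0n.
  have := key (- (m u u + 1) / m u v).
  have -> : 2 * (- (m u u + 1) / m u v) * m u v = - 2 * (m u u + 1) by field.
  by rewrite -v0 mulr0 addr0; have := sip_ge0 u; lra.
have := key (- m u v / m v v).
rewrite -(pmulr_lge0 _ v0) => h.
suff -> : m u u * m v v = (m u u + 2 * (- m u v / m v v) * m u v
    + (- m u v / m v v) ^+ 2 * m v v) * m v v + m u v ^+ 2 by rewrite lerDr.
by field; exact: lt0r_neq0.
Qed.

Lemma sip_le u v : m u v <= nrm m u * nrm m v.
Proof. by apply: le_trans (cauchy_schwarz u v); rewrite ler_norm. Qed.

Lemma nrmD u v : nrm m (u + v) <= nrm m u + nrm m v.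
Proof.
rewrite -(ler_pXn2r (n:=2)) // ?nnegrE ?addr_ge0 ?nrm_ge0 //.
rewrite sqr_nrm sqrrD !sqr_nrm !(sipDl, sipDr) (sipC v u).
by have := sip_le u v; lra.
Qed.

Lemma nrmZ a u : nrm m (a *: u) = `|a| * nrm m u.
Proof.
by rewrite /nrm sipZl sipZr mulrA -expr2 sqrtrM ?sqr_ge0 // sqrtr_sqr.
Qed.

Lemma nrmN u : nrm m (- u) = nrm m u.
Proof. by rewrite -scaleN1r nrmZ normrN1 mul1r. Qed.

Lemma nrmB u v : nrm m (u - v) <= nrm m u + nrm m v.
Proof. by rewrite -(nrmN v); exact: nrmD. Qed.

(** Estimates for vectors are reduced to scalar ones by pairing. *)
Lemma nrm_dual v M : 0 <= M -> (forall w, m v w <= M * nrm m w) -> nrm m v <= M.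
Proof.
move=> M0 /(_ v); rewrite -sqr_nrm expr2.
by have := nrm_ge0 m v; rewrite le_eqVlt => /predU1P[<- //|v0]; rewrite ler_pM2r.
Qed.

Lemma nrm_eq0_sip u v : nrm m u = 0 -> m u v = 0.
Proof.
move=> u0; have := cauchy_schwarz u v; rewrite u0 mul0r normr_le0.
by move=> /eqP.
Qed.

(** The span is given by its universal property, so that membership transfers
    to any set closed under linear combinations. *)
Definition lspan (e : seq V) (p : V) :=
  forall S : V -> Prop, S 0 -> (forall a u v, S u -> S v -> S (a *: u + v)) ->
    (forall x, x \in e -> S x) -> S p.

(** Gram-Schmidt for a degenerate form: when the part z of the next vector that
    is orthogonal to the previous ones has norm zero, z is orthogonal to
    everything and the vector can be ignored. *)
Lemma orthogonal_projection_span (e : seq V) u :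
  exists2 p, lspan e p & forall x, x \in e -> m (u - p) x = 0.
Proof.
elim: e u => [|x e IH] u; first by exists 0 => // S S0.
have lsub p : lspan e p -> lspan (x :: e) p.
  move=> ep S S0 Sl Se; apply: ep => // y ye; apply: Se.
  by rewrite inE ye orbT.
have [p ep up] := IH u; have [q eq xq] := IH x.
pose z := x - q.
have zE y : y \in e -> m z y = 0 by exact: xq.
have span0 w y : lspan e y -> (forall x, x \in e -> m w x = 0) -> m w y = 0.
  move=> ey we; apply: (ey (fun y => m w y = 0)) => //; first exact: sip0r.
  by move=> a s t s0 t0; rewrite sipDr sipZr s0 t0 mulr0 addr0.
have [z0|z0] := eqVneq (m z z) 0.
  exists p; first exact: lsub.
  move=> y; rewrite inE => /predU1P[->|]; last exact: up.
  have -> : x = z + q by rewrite /z subrK.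
  rewrite sipDr (span0 _ q) // addr0 sipC; apply: nrm_eq0_sip.
  by rewrite /nrm z0 sqrtr0.
exists (m u z / m z z *: z + p).
  move=> S S0 Sl Se; apply: (Sl); last exact: (lsub p ep S S0 Sl Se).
  have -> : z = -1 *: q + x by rewrite scaleN1r /z addrC.
  by apply: (Sl); [exact: (lsub q eq S S0 Sl Se)|by apply: Se; rewrite inE eqxx].
have E w : m (u - (m u z / m z z *: z + p)) w = m (u - p) w - m u z / m z z * m z w.
  by rewrite !(sipBl, sipDl, sipZl); ring.
move=> y; rewrite inE E => /predU1P[->|ye]; last first.
  by rewrite (up _ ye) (zE _ ye) mulr0 subr0.
have -> : x = z + q by rewrite /z subrK.
have pz : m p z = 0 by rewrite sipC; exact: span0.
rewrite !(sipDr z q) (span0 (u - p) q) // (span0 z q) // !addr0.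
by rewrite sipBl pz subr0 divfK // subrr.
Qed.

(** The finite element space is spanned by finitely many elements only up to
    pairs of norm zero, whence the last hypothesis. *)
Lemma orthogonal_projection_exists (S : V -> Prop) (e : seq V) u :
  S 0 -> (forall a u v, S u -> S v -> S (a *: u + v)) ->
  (forall x, x \in e -> S x) ->
  (forall x, S x -> exists2 p, lspan e p & nrm m (x - p) = 0) ->
  exists2 p, S p & forall x, S x -> m (u - p) x = 0.
Proof.
move=> S0 Sl Se Sspan; have [p ep up] := orthogonal_projection_span e u.
exists p; first exact: ep.
move=> x /Sspan[q eq xq].
rewrite -(subrK q x) sipDr sipC (nrm_eq0_sip _ xq) add0r.
apply: (eq (fun y => m (u - p) y = 0)) => //; first exact: sip0r.
by move=> a s t s0 t0; rewrite sipDr sipZr s0 t0 mulr0 addr0.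
Qed.

End SemiInner.

Section Taylor.
Context {R : realType}.

Lemma taylor_poly_deriv (g : nat -> R) (q : R) n :
  (\sum_(i < n.+1) (g i / i`!%:R) *: ('X - q%:P) ^+ i)^`() =
  \sum_(i < n) (g i.+1 / i`!%:R) *: ('X - q%:P) ^+ i.
Proof.
rewrite raddf_sum big_ord_recl /= expr0 derivZ derivC scaler0 add0r.
apply: eq_bigr => i _; rewrite derivZ deriv_exp derivXsubC mul1r /=.
rewrite -scalerMnr scalerMnl /bump /= add1n /=; congr (_ *: _); rewrite -mulr_natr.
by rewrite factS natrM -mulrA invfM mulrAC mulVf ?mul1r // pnatr_eq0.
Qed.

(** Induction on n: the derivative of g minus its Taylor polynomial is the same
    difference for the shifted sequence, and the mean value theorem
    integrates the bound, at the price of the factor 1 / n!. *)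
Lemma taylor_remainder (T : R) (n : nat) (g : nat -> R -> R) (M q x : R) :
  (forall i y, (i < n)%N -> y \in `]0, T[ -> is_derive y 1 (g i) (g i.+1 y)) ->
  (forall i, (i < n)%N -> {within `[0, T], continuous (g i)}) ->
  (forall y, y \in `[0, T] -> `|g n y| <= M) ->
  q \in `[0, T] -> x \in `[0, T] ->
  `|g 0%N x - (\sum_(i < n) (g i q / i`!%:R) *: ('X - q%:P) ^+ i).[x]|
    <= `|x - q| ^+ n * M.
Proof.
elim: n g x => [|n IH] g x gd gc gM qT xT.
  by rewrite big_ord0 horner0 subr0 expr0 mul1r; exact: gM.
pose P := \sum_(i < n.+1) (g i q / i`!%:R) *: ('X - q%:P) ^+ i : {poly R}.
pose H y := g 0%N y - P.[y].
pose dH y := g 1%N y - P^`().[y].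
have Hd y : y \in `]0, T[ -> is_derive y 1 H (dH y).
  by move=> yT; apply: is_deriveB; exact: gd.
have Hc : {within `[0, T], continuous H}.
  move=> y; apply: continuousB; first exact: gc.
  by apply: continuous_subspaceT => z; exact: continuous_horner.
have Hq : H q = 0.
  rewrite /H /P horner_sum big_ord_recl /= hornerZ expr0 hornerC fact0 divr1 mulr1.
  rewrite big1 ?addr0 ?subrr // => i _.
  by rewrite hornerZ horner_exp hornerXsubC subrr expr0n /= mulr0.
have M0 : 0 <= M by apply: le_trans (gM _ qT).
have dHb y : y \in `[0, T] -> `|dH y| <= `|y - q| ^+ n * M.
  move=> yT; rewrite /dH /P (taylor_poly_deriv (fun i => g i q)).
  apply: (IH (fun i => g i.+1)) => // [i z iz zT|i iz]; first exact: gd.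
  exact: gc.
have mvt a b : a \in `[0, T] -> b \in `[0, T] -> a <= b ->
    exists2 c, c \in `[a, b] & H b - H a = dH c * (b - a).
  move=> aT bT ab.
  have sub z : z \in `[a, b] -> z \in `[0, T].
    move: aT bT; rewrite !in_itv /= => /andP[a0 _] /andP[_ bT] /andP[az zb].
    by rewrite (le_trans a0 az) (le_trans zb bT).
  have Hd' z : z \in `]a, b[ -> is_derive z 1 H (dH z).
    move=> zab; apply: Hd.
    move: aT bT zab; rewrite !in_itv /= => /andP[a0 _] /andP[_ bT] /andP[az zb].
    by rewrite (le_lt_trans a0 az) (lt_le_trans zb bT).
  have Hc' : {within `[a, b], continuous H}.
    by apply: continuous_subspaceW Hc => z /sub.
  by have [c cab e] := MVT_segment ab Hd' Hc'; exists c.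
rewrite -/(H x) -[H x]subr0 -Hq exprSr.
have [qx|xq] := leP q x.
  have [c cqx ->] := mvt _ _ qT xT qx.
  rewrite normrM mulrAC ler_wpM2r //.
  apply: le_trans (dHb c _) _.
    move: qT xT cqx; rewrite !in_itv /= => /andP[a0 _] /andP[_ bT].
    by move=> /andP[ay yb]; rewrite (le_trans a0 ay) (le_trans yb bT).
  rewrite ler_wpM2r // lerXn2r ?nnegrE // !ger0_norm ?subr_ge0 // ?lerD2r;
    by move: cqx; rewrite in_itv /= => /andP[].
have [c cqx] := mvt _ _ xT qT (ltW xq).
rewrite distrC => ->.
rewrite normrM (distrC q x) mulrAC ler_wpM2r //.
apply: le_trans (dHb c _) _.
  move: qT xT cqx; rewrite !in_itv /= => /andP[_ bT] /andP[a0 _].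
  by move=> /andP[ay yb]; rewrite (le_trans a0 ay) (le_trans yb bT).
rewrite ler_wpM2r // lerXn2r ?nnegrE // !ler0_norm ?subr_le0 ?(ltW xq) //;
  move: cqx; rewrite in_itv /= => /andP[]; lra.
Qed.

End Taylor.

Section WeakCurve.
Context {R : realType} {V : lmodType R}.
Implicit Types (m : V -> V -> R) (c : nat -> R -> V).

(** A curve in V need not be differentiable in any norm: its pairings with
    fixed vectors are, which by duality is enough for Taylor estimates in the
    seminorm of m. *)
Definition weak_curve (T : R) (n : nat) m c :=
  forall i phi, (i < n)%N ->
   {within `[0, T], continuous (fun t => m (c i t) phi)} /\
   forall t, t \in `]0, T[ ->
     is_derive t 1 (fun t => m (c i t) phi) (m (c i.+1 t) phi).

Lemma weak_curveW (T : R) n k m c : (k <= n)%N ->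
  weak_curve T n m c -> weak_curve T k m c.
Proof. by move=> kn cc i phi ik; apply: cc; exact: leq_trans kn. Qed.

End WeakCurve.

(** * Taylor estimates for scalar functions of time *)

Section ScalarConsistency.
Context {R : realType}.
Variable T : R.
Implicit Types (g : nat -> R -> R).

Definition scalar_curve (n : nat) g :=
  forall i, (i < n)%N ->
   {within `[0, T], continuous (g i)} /\
   forall t, t \in `]0, T[ -> is_derive t 1 (g i) (g i.+1 t).

Lemma scalar_curve_shift n g : scalar_curve n.+1 g ->
  scalar_curve n (fun i => g i.+1).
Proof. by move=> gc i iN; exact: gc. Qed.

Lemma taylorS n g M q x : scalar_curve n g ->
  (forall y, y \in `[0, T] -> `|g n y| <= M) ->
  q \in `[0, T] -> x \in `[0, T] ->
  `|g 0%N x - \sum_(i < n) g i q / i`!%:R * (x - q) ^+ i| <= `|x - q| ^+ n * M.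
Proof.
move=> gc gM qT xT.
have := @taylor_remainder R T n g M q x; rewrite horner_sum.
under eq_bigr do rewrite hornerZ horner_exp hornerXsubC.
apply => // [i y iN|i iN]; first by have [_] := gc _ iN; exact.
by have [] := gc _ iN.
Qed.

Lemma mid_in q x : q \in `[0, T] -> x \in `[0, T] -> (q + x) / 2 \in `[0, T].
Proof.
rewrite !in_itv /= => /andP[a b] /andP[c d]; apply/andP; split; lra.
Qed.

Section bounds.
Variables (g : nat -> R -> R) (M q x : R).
Hypotheses (qT : q \in `[0, T]) (xT : x \in `[0, T]).
Let s := x - q.
Let mid : (q + x) / 2 - q = s / 2. Proof. by rewrite /s; field. Qed.
Let mids : `|s / 2| = `|s| / 2.
Proof. by rewrite normrM [`|2^-1|]ger0_norm. Qed.

Let MM n : (forall y, y \in `[0, T] -> `|g n y| <= M) -> 0 <= M.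
Proof. by move=> /(_ _ qT); apply: le_trans. Qed.

Lemma scalar_lipschitz : scalar_curve 1 g ->
  (forall y, y \in `[0, T] -> `|g 1 y| <= M) ->
  `|g 0%N x - g 0%N q| <= `|s| * M.
Proof.
move=> gc gM; have := taylorS gc gM qT xT.
by rewrite !big_ord_recr big_ord0 /= add0r expr0 expr1 fact0 divr1 mulr1.
Qed.

Lemma scalar_quotient : scalar_curve 2 g -> s != 0 ->
  (forall y, y \in `[0, T] -> `|g 2 y| <= M) ->
  `|s^-1 * (g 0%N x - g 0%N q) - g 1%N q| <= `|s| * M.
Proof.
move=> gc s0 gM; have := taylorS gc gM qT xT; rewrite -/s.
rewrite !big_ord_recr big_ord0 /= add0r expr0 expr1 !factS fact0 divr1 mulr1.
move=> h.
have -> : s^-1 * (g 0%N x - g 0%N q) - g 1%N q =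
  s^-1 * (g 0%N x - (g 0%N q + g 1%N q / (1 * 1)%N%:R * s)).
  by rewrite ?muln1; field.
rewrite normrM normrV ?unitfE // ler_pdivrMl ?normr_gt0 //.
by rewrite mulrA -expr2.
Qed.

Lemma scalar_average : scalar_curve 2 g ->
  (forall y, y \in `[0, T] -> `|g 2 y| <= M) ->
  `|(g 0%N x + g 0%N q) / 2 - g 0%N ((q + x) / 2)| <= s ^+ 2 * M.
Proof.
move=> gc gM; have := taylorS gc gM qT xT.
have := taylorS gc gM qT (mid_in qT xT); rewrite mid -/s.
rewrite !big_ord_recr !big_ord0 /= !add0r !expr0 !expr1 !factS fact0 !divr1 !mulr1.
rewrite ?muln1 ?divr1 mids exprMn !real_normK ?num_real //.
have M0 := MM gM; have : 0 <= s ^+ 2 * M by rewrite mulr_ge0 ?sqr_ge0.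
rewrite !ler_norml => p0 /andP[h1 h2] /andP[h3 h4]; apply/andP; split; lra.
Qed.

(** The remainder after the leading term of the error is of third order: the
    leading term s ^ 2 / 8 is what changes slowly from step to step. *)
Lemma scalar_average2 : scalar_curve 3 g ->
  (forall y, y \in `[0, T] -> `|g 3 y| <= M) ->
  `|(g 0%N x + g 0%N q) / 2 - g 0%N ((q + x) / 2) - s ^+ 2 / 8 * g 2%N q|
    <= `|s| ^+ 3 * M.
Proof.
move=> gc gM; have := taylorS gc gM qT xT.
have := taylorS gc gM qT (mid_in qT xT); rewrite mid -/s.
rewrite !big_ord_recr !big_ord0 /= !add0r !expr0 !expr1 !factS fact0 !divr1 !mulr1.
rewrite ?muln1 ?divr1 mids !exprMn.
have M0 := MM gM; have : 0 <= `|s| ^+ 3 * M by rewrite mulr_ge0 ?exprn_ge0.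
rewrite !ler_norml => p0 /andP[h1 h2] /andP[h3 h4]; apply/andP; split; lra.
Qed.

Lemma scalar_midpoint : scalar_curve 3 g -> s != 0 ->
  (forall y, y \in `[0, T] -> `|g 3 y| <= M) ->
  `|s^-1 * (g 0%N x - g 0%N q) - g 1%N ((q + x) / 2)| <= 2 * (s ^+ 2 * M).
Proof.
move=> gc s0 gM; have := taylorS gc gM qT xT.
have := taylorS (scalar_curve_shift gc) gM qT (mid_in qT xT); rewrite mid -/s.
rewrite !big_ord_recr !big_ord0 /= !add0r !expr0 !expr1 !factS fact0 !divr1 !mulr1.
rewrite ?muln1 ?divr1 mids !exprMn.
have M0 := MM gM; have : 0 <= s ^+ 2 * M by rewrite mulr_ge0 ?sqr_ge0.
move=> p0 h1 h2.
have {h2} : `|s^-1 * (g 0%N x - (g 0%N q + g 1 q * s + g 2 q / 2%:R * s ^+ 2))|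
    <= s ^+ 2 * M.
  rewrite normrM normrV ?unitfE // ler_pdivrMl ?normr_gt0 //.
  by apply: le_trans h2 _; rewrite -(real_normK (num_real s)) mulrA -exprS.
have -> : s^-1 * (g 0%N x - (g 0%N q + g 1 q * s + g 2 q / 2%:R * s ^+ 2)) =
   s^-1 * (g 0%N x - g 0%N q) - g 1 q - g 2 q / 2 * s by field.
move: h1; rewrite real_normK ?num_real //.
rewrite !ler_norml => /andP[h1 h2] /andP[h3 h4]; apply/andP; split; lra.
Qed.

Lemma scalar_midpoint2 : scalar_curve 4 g -> s != 0 ->
  (forall y, y \in `[0, T] -> `|g 4 y| <= M) ->
  `|s^-1 * (g 0%N x - g 0%N q) - g 1%N ((q + x) / 2) - s ^+ 2 / 24 * g 3%N q|
    <= 2 * (`|s| ^+ 3 * M).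
Proof.
move=> gc s0 gM; have := taylorS gc gM qT xT.
have := taylorS (scalar_curve_shift gc) gM qT (mid_in qT xT); rewrite mid -/s.
rewrite !big_ord_recr !big_ord0 /= !add0r !expr0 !expr1 !factS fact0 !divr1 !mulr1.
rewrite ?muln1 ?divr1 mids !exprMn.
have M0 := MM gM; have : 0 <= `|s| ^+ 3 * M by rewrite mulr_ge0 ?exprn_ge0 ?sqr_ge0.
move=> p0 h1 h2.
have {h2} : `|s^-1 * (g 0%N x - (g 0%N q + g 1 q * s + g 2 q / 2%:R * s ^+ 2
     + g 3 q / (3 * 2)%N%:R * s ^+ 3))| <= `|s| ^+ 3 * M.
  rewrite normrM normrV ?unitfE // ler_pdivrMl ?normr_gt0 //.
  by apply: le_trans h2 _; rewrite mulrA -exprS.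
have -> : s^-1 * (g 0%N x - (g 0%N q + g 1 q * s + g 2 q / 2%:R * s ^+ 2
     + g 3 q / (3 * 2)%N%:R * s ^+ 3)) =
   s^-1 * (g 0%N x - g 0%N q) - g 1 q - g 2 q / 2 * s - g 3 q / 6 * s ^+ 2 by field.
move: h1.
rewrite !ler_norml => /andP[h1 h2] /andP[h3 h4]; apply/andP; split; lra.
Qed.

End bounds.
End ScalarConsistency.

(** * Consistency of difference quotients and averages *)

Section CurveConsistency.
Context {R : realType} {V : lmodType R}.
Variables (T : R) (m : V -> V -> R).
Hypothesis Hm : semi_inner m.
Implicit Types (c : nat -> R -> V).

Lemma weak_curveP n c : weak_curve T n m c <->
  forall w, scalar_curve T n (fun i t => m (c i t) w).
Proof. by split => [cc w i iN|cc i w iN]; [exact: cc|exact: (cc w)]. Qed.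

Lemma weak_curve_pair n c M w : (forall t, t \in `[0, T] -> nrm m (c n t) <= M) ->
  forall t, t \in `[0, T] -> `|m (c n t) w| <= M * nrm m w.
Proof.
move=> cM t tT; apply: le_trans (cauchy_schwarz Hm _ _) _.
by rewrite ler_wpM2r ?nrm_ge0 // cM.
Qed.

Definition diff_quotient (c : R -> V) t0 t1 := (t1 - t0)^-1 *: (c t1 - c t0).
Definition time_average (c : R -> V) t0 t1 := 2^-1 *: (c t1 + c t0).

Lemma diff_quotientC d t0 t1 : diff_quotient d t0 t1 = diff_quotient d t1 t0.
Proof.
by rewrite /diff_quotient -(opprB t0) -(opprB (d t0)) invrN scalerN scaleNr opprK.
Qed.

Lemma time_averageC d t0 t1 : time_average d t0 t1 = time_average d t1 t0.
Proof. by rewrite /time_average addrC. Qed.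

Lemma nrm_triangle x y z : nrm m (x - y) <= nrm m (x - z) + nrm m (y - z).
Proof. by rewrite -(subrKA z) -(opprB y) nrmB. Qed.

(** Two errors with leading terms a z and b z, for the same vector z, differ by
    their remainders and by |a - b| |z|. *)
Lemma nrm_triangle_scaled x y a b z :
  nrm m (x - y) <= nrm m (x - a *: z) + nrm m (y - b *: z) + `|a - b| * nrm m z.
Proof.
have -> : x - y = (x - a *: z - (y - b *: z)) + (a - b) *: z.
  by rewrite scalerBl opprB -[RHS]addrA [X in _ = _ + X]addrC !subrKA.
apply: le_trans (nrmD Hm _ _) _; rewrite (nrmZ Hm) lerD2r.
exact: nrmB.
Qed.

Variable c : nat -> R -> V.

Let M_ge0 n M q : q \in `[0, T] -> (forall t, t \in `[0, T] -> nrm m (c n t) <= M) ->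
  0 <= M.
Proof. by move=> qT /(_ _ qT); apply: le_trans; exact: nrm_ge0. Qed.

Lemma curve_quotient_le M q x : weak_curve T 1 m c -> q != x ->
  (forall t, t \in `[0, T] -> nrm m (c 1%N t) <= M) ->
  q \in `[0, T] -> x \in `[0, T] -> nrm m (diff_quotient (c 0%N) q x) <= M.
Proof.
move=> /weak_curveP cc qx cM qT xT; apply: (nrm_dual Hm) (M_ge0 qT cM) _ => w.
have := scalar_lipschitz qT xT (cc w) (weak_curve_pair w cM).
rewrite (sipZl Hm) (sipBl Hm) => h; apply: le_trans (ler_norm _) _.
rewrite normrM normrV ?unitfE ?subr_eq0 1?eq_sym //.
by rewrite ler_pdivrMl // normr_gt0 subr_eq0 eq_sym.
Qed.

Lemma curve_lipschitz M q x : weak_curve T 1 m c ->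
  (forall t, t \in `[0, T] -> nrm m (c 1%N t) <= M) ->
  q \in `[0, T] -> x \in `[0, T] -> nrm m (c 0%N x - c 0%N q) <= `|x - q| * M.
Proof.
move=> /weak_curveP cc cM qT xT.
apply: (nrm_dual Hm) => [|w]; first by rewrite mulr_ge0 ?(M_ge0 qT cM).
have := scalar_lipschitz qT xT (cc w) (weak_curve_pair w cM).
by rewrite (sipBl Hm) mulrA; apply: le_trans (ler_norm _).
Qed.

Let quotient_at M q x : weak_curve T 2 m c -> q != x ->
  (forall t, t \in `[0, T] -> nrm m (c 2%N t) <= M) ->
  q \in `[0, T] -> x \in `[0, T] ->
  nrm m (diff_quotient (c 0%N) q x - c 1%N q) <= `|x - q| * M.
Proof.
move=> /weak_curveP cc qx cM qT xT.
apply: (nrm_dual Hm) => [|w]; first by rewrite mulr_ge0 ?(M_ge0 qT cM).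
have := scalar_quotient qT xT (cc w) _ (weak_curve_pair w cM).
rewrite subr_eq0 eq_sym => /(_ qx); rewrite mulrA; apply: le_trans.
by rewrite !(sipZl Hm, sipBl Hm) ler_norm.
Qed.

Lemma curve_average_le M q x : weak_curve T 2 m c ->
  (forall t, t \in `[0, T] -> nrm m (c 2%N t) <= M) ->
  q \in `[0, T] -> x \in `[0, T] ->
  nrm m (time_average (c 0%N) q x - c 0%N ((q + x) / 2)) <= (x - q) ^+ 2 * M.
Proof.
move=> /weak_curveP cc cM qT xT.
apply: (nrm_dual Hm) => [|w]; first by rewrite mulr_ge0 ?(M_ge0 qT cM) ?sqr_ge0.
have := scalar_average qT xT (cc w) (weak_curve_pair w cM).
rewrite mulrA; apply: le_trans.
by rewrite !(sipZl Hm, sipBl Hm, sipDl Hm) mulrC ler_norm.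
Qed.

Let average_at M q x : weak_curve T 3 m c ->
  (forall t, t \in `[0, T] -> nrm m (c 3%N t) <= M) ->
  q \in `[0, T] -> x \in `[0, T] ->
  nrm m (time_average (c 0%N) q x - c 0%N ((q + x) / 2)
     - ((x - q) ^+ 2 / 8) *: c 2%N q) <= `|x - q| ^+ 3 * M.
Proof.
move=> /weak_curveP cc cM qT xT.
apply: (nrm_dual Hm) => [|w]; first by rewrite mulr_ge0 ?(M_ge0 qT cM) ?exprn_ge0.
have := scalar_average2 qT xT (cc w) (weak_curve_pair w cM).
rewrite mulrA; apply: le_trans.
by rewrite !(sipZl Hm, sipBl Hm, sipDl Hm) (mulrC 2^-1) ler_norm.
Qed.

Lemma curve_midpoint_le M q x : weak_curve T 3 m c -> q != x ->
  (forall t, t \in `[0, T] -> nrm m (c 3%N t) <= M) ->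
  q \in `[0, T] -> x \in `[0, T] ->
  nrm m (diff_quotient (c 0%N) q x - c 1%N ((q + x) / 2)) <= 2 * (x - q) ^+ 2 * M.
Proof.
move=> /weak_curveP cc qx cM qT xT.
apply: (nrm_dual Hm) => [|w].
  by rewrite mulr_ge0 ?(M_ge0 qT cM) // mulr_ge0 ?sqr_ge0.
have := scalar_midpoint qT xT (cc w) _ (weak_curve_pair w cM).
rewrite subr_eq0 eq_sym => /(_ qx); rewrite !mulrA; apply: le_trans.
by rewrite !(sipZl Hm, sipBl Hm) ler_norm.
Qed.

Let midpoint_at M q x : weak_curve T 4 m c -> q != x ->
  (forall t, t \in `[0, T] -> nrm m (c 4%N t) <= M) ->
  q \in `[0, T] -> x \in `[0, T] ->
  nrm m (diff_quotient (c 0%N) q x - c 1%N ((q + x) / 2)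
    - ((x - q) ^+ 2 / 24) *: c 3%N q) <= 2 * `|x - q| ^+ 3 * M.
Proof.
move=> /weak_curveP cc qx cM qT xT.
apply: (nrm_dual Hm) => [|w].
  by rewrite mulr_ge0 ?(M_ge0 qT cM) // mulr_ge0 ?exprn_ge0.
have := scalar_midpoint2 qT xT (cc w) _ (weak_curve_pair w cM).
rewrite subr_eq0 eq_sym => /(_ qx); rewrite !mulrA; apply: le_trans.
by rewrite !(sipZl Hm, sipBl Hm) ler_norm.
Qed.

(** Errors of two successive steps are compared by expanding both around the
    common node q. The leading terms have the coefficients (t1 - q) ^ 2 and
    (t0 - q) ^ 2, whose difference is (k1 - k0) (k1 + k0) for the step sizes k0
    and k1: this is of order K ^ 2 (k0 + k1) by the assumption kk. *)
Section TwoSteps.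
Variables (t0 q t1 K Cs : R).
Hypotheses (t0T : t0 \in `[0, T]) (qT : q \in `[0, T]) (t1T : t1 \in `[0, T]).
Hypotheses (t0q : t0 < q) (qt1 : q < t1) (k0K : q - t0 <= K) (k1K : t1 - q <= K).

Let k0n : `|t0 - q| = q - t0.
Proof. by rewrite ltr0_norm ?subr_lt0 // opprB. Qed.
Let k1n : `|t1 - q| = t1 - q.
Proof. by rewrite gtr0_norm // subr_gt0. Qed.

Lemma curve_quotient_diff_le M : weak_curve T 2 m c ->
  (forall t, t \in `[0, T] -> nrm m (c 2%N t) <= M) ->
  nrm m (diff_quotient (c 0%N) q t1 - diff_quotient (c 0%N) t0 q)
    <= (t1 - t0) * M.
Proof.
move=> cc cM; rewrite (diff_quotientC _ t0).
apply: le_trans (nrm_triangle _ _ (c 1%N q)) _.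
have qt1' : q != t1 by rewrite lt_eqF.
have qt0' : q != t0 by rewrite gt_eqF.
have := quotient_at cc qt0' cM qT t0T; rewrite k0n => h0.
have := quotient_at cc qt1' cM qT t1T; rewrite k1n => h1.
by apply: le_trans (lerD h1 h0) _; rewrite -mulrDl addrA subrK.
Qed.

Hypotheses (K0 : 0 <= K) (Cs0 : 0 <= Cs).
Hypothesis kk : `|(t1 - q) - (q - t0)| <= Cs * K * (t1 - t0).

Let sq_diff : `|(t1 - q) ^+ 2 - (t0 - q) ^+ 2| <= 2 * Cs * K ^+ 2 * (t1 - t0).
Proof.
have -> : (t1 - q) ^+ 2 - (t0 - q) ^+ 2 = ((t1 - q) - (q - t0)) * (t1 - t0).
  by ring.
rewrite normrM (gtr0_norm (_ : 0 < t1 - t0)) ?subr_gt0 ?(lt_trans t0q) //.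
have -> : 2 * Cs * K ^+ 2 * (t1 - t0) = Cs * K * (t1 - t0) * (2 * K) by ring.
have [h0 h1 h2 h3] := And4 t0q qt1 k0K k1K.
by apply: ler_pM => //; lra.
Qed.

Let cubes : `|t1 - q| ^+ 3 + `|t0 - q| ^+ 3 <= K ^+ 2 * (t1 - t0).
Proof.
rewrite k0n k1n !exprSr; move: k0K k1K t0q qt1; rewrite expr0 mul1r => a b c0 d.
have h0 : (q - t0) * (q - t0) <= K ^+ 2 by rewrite expr2 ler_pM //; lra.
have h1 : (t1 - q) * (t1 - q) <= K ^+ 2 by rewrite expr2 ler_pM //; lra.
have : (q - t0) * (q - t0) * (q - t0) <= K ^+ 2 * (q - t0).
  by rewrite ler_wpM2r //; lra.
have : (t1 - q) * (t1 - q) * (t1 - q) <= K ^+ 2 * (t1 - q).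
  by rewrite ler_wpM2r //; lra.
lra.
Qed.

Lemma curve_average_diff_le M2 M3 : weak_curve T 3 m c ->
  (forall t, t \in `[0, T] -> nrm m (c 2%N t) <= M2) ->
  (forall t, t \in `[0, T] -> nrm m (c 3%N t) <= M3) ->
  nrm m ((time_average (c 0%N) q t1 - c 0%N ((q + t1) / 2))
         - (time_average (c 0%N) t0 q - c 0%N ((t0 + q) / 2)))
    <= K ^+ 2 * (t1 - t0) * (Cs * M2 + M3).
Proof.
move=> cc c2M c3M; rewrite (time_averageC _ t0) (addrC t0).
have := average_at cc c3M qT t0T.
have := average_at cc c3M qT t1T.
set d1 := _ - c 0%N ((q + t1) / 2); set d0 := _ - c 0%N ((q + t0) / 2) => h1 h0.
apply: le_trans (nrm_triangle_scaled _ _ ((t1 - q) ^+ 2 / 8) ((t0 - q) ^+ 2 / 8) (c 2%N q)) _.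
have h2 := c2M _ qT.
have M30 : 0 <= M3 := M_ge0 qT c3M.
apply: le_trans (lerD (lerD h1 h0) (ler_pM (normr_ge0 _) (nrm_ge0 _ _) (lexx _) h2)) _.
have h3 : (`|t1 - q| ^+ 3 + `|t0 - q| ^+ 3) * M3 <= K ^+ 2 * (t1 - t0) * M3.
  by rewrite ler_wpM2r.
have h4 : `|(t1 - q) ^+ 2 / 8 - (t0 - q) ^+ 2 / 8| * M2 <= Cs * K ^+ 2 * (t1 - t0) * M2.
  rewrite ler_wpM2r ?(M_ge0 qT c2M) // -mulrBl normrM (ger0_norm (_ : 0 <= 8^-1)) //.
  have : 0 <= Cs * K ^+ 2 * (t1 - t0) by rewrite !mulr_ge0 ?sqr_ge0 // subr_ge0 (le_trans (ltW t0q)) // ltW.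
  by have := sq_diff; lra.
lra.
Qed.

Lemma curve_midpoint_diff_le M3 M4 : weak_curve T 4 m c ->
  (forall t, t \in `[0, T] -> nrm m (c 3%N t) <= M3) ->
  (forall t, t \in `[0, T] -> nrm m (c 4%N t) <= M4) ->
  nrm m ((diff_quotient (c 0%N) q t1 - c 1%N ((q + t1) / 2))
         - (diff_quotient (c 0%N) t0 q - c 1%N ((t0 + q) / 2)))
    <= K ^+ 2 * (t1 - t0) * (Cs * M3 + 2 * M4).
Proof.
move=> cc c3M c4M; rewrite (diff_quotientC _ t0) (addrC t0).
have qt1' : q != t1 by rewrite lt_eqF.
have qt0' : q != t0 by rewrite gt_eqF.
have := midpoint_at cc qt0' c4M qT t0T.
have := midpoint_at cc qt1' c4M qT t1T.
set d1 := _ - c 1%N ((q + t1) / 2); set d0 := _ - c 1%N ((q + t0) / 2) => h1 h0.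
apply: le_trans (nrm_triangle_scaled _ _ ((t1 - q) ^+ 2 / 24) ((t0 - q) ^+ 2 / 24) (c 3%N q)) _.
have h2 := c3M _ qT.
have M40 : 0 <= M4 := M_ge0 qT c4M.
apply: le_trans (lerD (lerD h1 h0) (ler_pM (normr_ge0 _) (nrm_ge0 _ _) (lexx _) h2)) _.
have h3 : (`|t1 - q| ^+ 3 + `|t0 - q| ^+ 3) * M4 <= K ^+ 2 * (t1 - t0) * M4.
  by rewrite ler_wpM2r.
have h4 : `|(t1 - q) ^+ 2 / 24 - (t0 - q) ^+ 2 / 24| * M3 <= Cs * K ^+ 2 * (t1 - t0) * M3.
  rewrite ler_wpM2r ?(M_ge0 qT c3M) // -mulrBl normrM (ger0_norm (_ : 0 <= 24^-1)) //.
  have : 0 <= Cs * K ^+ 2 * (t1 - t0) by rewrite !mulr_ge0 ?sqr_ge0 // subr_ge0 (le_trans (ltW t0q)) // ltW.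
  by have := sq_diff; lra.
lra.
Qed.

End TwoSteps.
End CurveConsistency.

(** * The energy step in an abstract vector space *)

Section Energy.
Context {R : realType} {V : lmodType R}.
Variables (m b e : V -> V -> R) (J : V -> V) (S : V -> Prop).
Hypotheses (Hm : semi_inner m) (Hb : semi_inner b) (He : semi_inner e).

(** Multiplication by the imaginary unit, seen by the real part of a
    sesquilinear form. *)
Definition rotation (f : V -> V -> R) :=
  (forall u v, f (J u) (J v) = f u v) /\ (forall u, f u (J u) = 0).

Hypotheses (mJ : rotation m) (bJ : rotation b) (eJ : rotation e).
Hypothesis JD : forall u v, J (u + v) = J u + J v.
Hypothesis JZ : forall a u, J (a *: u) = a *: J u.
Hypothesis SD : forall a u v, S u -> S v -> S (a *: u + v).
Hypothesis SJ : forall u, S u -> S (J u).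
Hypothesis e_le_b : forall u, S u -> nrm e u <= nrm b u.
Hypothesis m_le_b : forall u, S u -> nrm m u <= 2 * nrm b u.

Let S0 u : S u -> S 0.
Proof. by move=> Su; have := SD (-1) Su Su; rewrite scaleN1r addNr. Qed.

Lemma nrm_rotation f u : rotation f -> nrm f (J u) = nrm f u.
Proof. by case=> fJ _; rewrite /nrm fJ. Qed.

Variables (A mu1 s0 s1 g1 B1 CP : R).
Hypotheses (A0 : 0 <= A) (mu10 : 0 <= mu1) (s00 : 0 < s0) (g10 : 0 <= g1).
Hypotheses (B10 : 0 <= B1) (CP0 : 0 <= CP) (s10 : 0 <= s1).

Definition energy_constant : R :=
  mu1 * (g1 + s1 * CP + 1) ^+ 2 / (4 * s0) + mu1 * ((g1 + 1) * CP) + 2 * CP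
  + A * (2 * CP * (2 * B1 + 1)).

(** The right-hand side of the energy identity. Z is the size of the difference
    quotient at the boundary: it is bounded only through its square, which has
    the nonpositive coefficient mu * s, and Young's inequality spends that
    square on the products of Z with Y and eps. *)
Lemma energy_real (mu s Z Y eps : R) : - mu1 <= mu <= 0 -> s0 <= s <= s1 ->
  0 <= Z -> 0 <= Y -> 0 <= eps ->
  mu * s * Z ^+ 2 + `|mu| * (Z * (g1 * Y + eps))
   + `|mu| * ((s * Z + (g1 * Y + eps)) * (CP * Y)) + (Y + eps) * (CP * Y)
   + A * ((2 * B1 * Y + eps) * (2 * (CP * Y)))
  <= energy_constant * (Y ^+ 2 + eps ^+ 2).
Proof.
move=> /andP[mu_ge mu_le] /andP[ss0 ss1] Z0 Y0 e0.
have W0 : 0 <= Y ^+ 2 + eps ^+ 2 by rewrite addr_ge0 ?sqr_ge0.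
have Yp a : 0 <= a -> (a * Y + eps) * Y <= (a + 1) * (Y ^+ 2 + eps ^+ 2).
  move=> a0; have := sqr_ge0 (Y - eps); have := sqr_ge0 eps; have := sqr_ge0 Y.
  have : 0 <= a * eps ^+ 2 by rewrite mulr_ge0 ?sqr_ge0.
  nra.
have Yp2 a : 0 <= a -> (a * Y + eps) ^+ 2 <= (a + 1) ^+ 2 * (Y ^+ 2 + eps ^+ 2).
  move=> a0; have := sqr_ge0 (Y - a * eps); have := sqr_ge0 eps; have := sqr_ge0 Y.
  have : 0 <= a * (Y ^+ 2 + eps ^+ 2) by rewrite mulr_ge0.
  nra.
pose X := (g1 + s1 * CP) * Y + eps.
have sCP : 0 <= s1 * CP by rewrite mulr_ge0.
have h1 : mu * s * Z ^+ 2 + `|mu| * (Z * (g1 * Y + eps)) + `|mu| * (s * Z * (CP * Y))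
    <= mu1 * (X ^+ 2 / (4 * s0)).
  rewrite ler0_norm //.
  have -> : mu * s * Z ^+ 2 + - mu * (Z * (g1 * Y + eps)) + - mu * (s * Z * (CP * Y))
    = - mu * (Z * (g1 * Y + eps) + s * (Z * (CP * Y)) - s * Z ^+ 2) by ring.
  have ZY : 0 <= Z * (CP * Y) by rewrite !mulr_ge0.
  have p1 : s * (Z * (CP * Y)) <= s1 * (Z * (CP * Y)) by rewrite ler_wpM2r.
  have p2 : s0 * Z ^+ 2 <= s * Z ^+ 2 by rewrite ler_wpM2r ?sqr_ge0.
  have p3 : Z * X - s0 * Z ^+ 2 <= X ^+ 2 / (4 * s0).
    rewrite ler_pdivlMr ?mulr_gt0 //.
    by have := sqr_ge0 (X - 2 * s0 * Z); nra.
  have p4 : 0 <= X ^+ 2 / (4 * s0) by rewrite divr_ge0 ?sqr_ge0 // mulr_ge0 // ltW.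
  have nmu : 0 <= - mu by lra.
  apply: le_trans (_ : - mu * (X ^+ 2 / (4 * s0)) <= _); last first.
    by rewrite ler_wpM2r //; lra.
  rewrite ler_wpM2l //; apply: le_trans p3; rewrite /X; lra.
have h2 : mu1 * (X ^+ 2 / (4 * s0)) <=
    mu1 * (g1 + s1 * CP + 1) ^+ 2 / (4 * s0) * (Y ^+ 2 + eps ^+ 2).
  have := Yp2 (g1 + s1 * CP); rewrite addr_ge0 // => /(_ isT).
  have w0 : 0 <= mu1 / (4 * s0) by rewrite divr_ge0 // mulr_ge0 // ltW.
  move=> /(ler_wpM2l w0); rewrite -/X.
  set w := (4 * s0)^-1; lra.
have h3 : `|mu| * ((g1 * Y + eps) * (CP * Y)) <=
    mu1 * ((g1 + 1) * CP) * (Y ^+ 2 + eps ^+ 2).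
  rewrite ler0_norm // -mulrA.
  have q : (g1 * Y + eps) * (CP * Y) <= (g1 + 1) * CP * (Y ^+ 2 + eps ^+ 2).
    have := ler_wpM2l CP0 (Yp _ g10); lra.
  have q0 : 0 <= (g1 * Y + eps) * (CP * Y) by rewrite !mulr_ge0 // addr_ge0 // mulr_ge0.
  by apply: ler_pM => //; lra.
have h4 : (Y + eps) * (CP * Y) <= 2 * CP * (Y ^+ 2 + eps ^+ 2).
  have := ler_wpM2l CP0 (Yp _ (@ler01 R)); lra.
have h5 : A * ((2 * B1 * Y + eps) * (2 * (CP * Y)))
    <= A * (2 * CP * (2 * B1 + 1)) * (Y ^+ 2 + eps ^+ 2).
  have B2 : 0 <= 2 * B1 by rewrite mulr_ge0.
  have := ler_wpM2l (mulr_ge0 A0 CP0) (Yp _ B2); lra.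
rewrite /energy_constant; lra.
Qed.

Section Step.
Variables (bop g : V -> V) (a mu s k eps : R) (th0 th1 xr yr dl q : V).
Let dth := k^-1 *: (th1 - th0).
Let ath := 2^-1 *: (th1 + th0).
Hypothesis bopD : forall u v, bop (u + v) = bop u + bop v.
Hypothesis gD : forall u v, g (u + v) = g u + g v.
Hypotheses (a0 : a != 0) (aA : `|a^-1| <= A) (Hmu : - mu1 <= mu <= 0).
Hypotheses (Hs : s0 <= s <= s1) (k0 : 0 < k) (eps0 : 0 <= eps).
Hypotheses (S0_ : S th0) (S1_ : S th1) (Sq : S q).
Hypothesis g_le : forall v, nrm e (g v) <= g1 * nrm e v.
Hypothesis bop_le : forall v, nrm m (bop v) <= B1 * nrm m v.
Hypothesis qE : forall chi, S chi -> m (bop ath - q) chi = 0.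
Hypothesis q_le : nrm b q <= CP * nrm b ath.

Definition residual := J (bop yr) - xr.
(** The consistency error as a functional of the test function. The part dl of
    the error in b comes from the average of u in place of its midpoint value;
    the remaining part of yr is b-orthogonal to the test functions. *)
Definition defect chi := a^-1 * m residual (J chi) - b dl chi.

Hypothesis d_le : nrm e (s *: xr + g yr) <= eps.
Hypothesis r_le : nrm m residual <= eps.
Hypothesis dl_le : nrm b dl <= eps.
Hypothesis dlE : forall chi, S chi -> b (J yr) chi = b (J dl) chi.
Hypothesis error_eq : forall chi, S chi ->
  m (dth + xr) chi = a * mu * e (J (s *: (dth + xr) + g (ath + yr))) chi
    - a * b (J (ath + yr)) chi + m (J (bop (ath + yr))) chi.

Let Sath : S ath.
Proof.
rewrite /ath scalerDr; apply: SD => //.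
by rewrite -[X in S X]addr0; apply: SD => //; exact: S0 S0_.
Qed.

Let Sdth : S dth.
Proof.
rewrite /dth -[X in S X]addr0; apply: SD; last exact: S0 S0_.
by rewrite addrC -scaleN1r; apply: SD.
Qed.

Let main_eq chi : S chi ->
  m dth chi = a * mu * e (J (s *: dth + (g ath + (s *: xr + g yr)))) chi
    - a * b (J (ath + dl)) chi + m (J (bop ath)) chi + m residual chi.
Proof.
move=> Sc; have := error_eq Sc.
rewrite /residual !(JD, bopD, gD, scalerDr, sipDl Hm, sipDl Hb, sipDl He) (sipNl Hm).
rewrite (dlE Sc); lra.
Qed.

(** The error equation is tested with J (dth), and m (bop ath) dth is replaced
    by m q dth, which is computed by testing with q. Both identities are solved
    for b ath dth, half of the increment of b th th divided by the step. *)
Lemma energy_step :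
  b th1 th1 - b th0 th0 <= 2 * energy_constant * k * (b th1 th1 + b th0 th0 + eps ^+ 2)
     + 2 * (defect th1 - defect th0).
Proof.
pose Y := nrm b ath; pose Z := nrm e dth.
pose d := s *: xr + g yr.
have Y0 : 0 <= Y := nrm_ge0 _ _.
have Z0 : 0 <= Z := nrm_ge0 _ _.
have dY : nrm e ath <= Y := e_le_b Sath.
have kN0 : k != 0 by exact: lt0r_neq0.
have defectE : defect th1 - defect th0 = k * (a^-1 * m residual (J dth) - b dl dth).
  have -> : th1 = k *: dth + th0 by rewrite /dth scalerA divff // scale1r subrK.
  rewrite /defect JD (sipDr Hm) (sipDr Hb) (sipZr Hb).
  by rewrite JZ (sipZr Hm); ring.
have key : b ath dth = mu * s * Z ^+ 2 + mu * e (g ath + d) dth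
     + a^-1 * m dth q + (a^-1 * m residual (J dth) - b dl dth).
  (* The pairing of dth with J dth vanishes in m, and J drops out of the other
     forms, where it occurs on both sides. *)
  have := main_eq (SJ Sdth).
  rewrite (proj2 mJ) (proj1 eJ) (proj1 bJ) (proj1 mJ).
  rewrite (sipDl He (s *: dth)) (sipZl He) -(sqr_nrm He) (sipDl Hb).
  have := qE Sdth; rewrite (sipBl Hm) (sipC Hm dth) -/Z => /subr0_eq -> h.
  have -> : m q dth = a * (- mu * s * Z ^+ 2 - mu * e (g ath + d) dth
     + b ath dth + b dl dth) - m residual (J dth) by lra.
  by field.
have mdq : a^-1 * m dth q = mu * e (J (s *: dth + (g ath + d))) q
   - b (J (ath + dl)) q + a^-1 * (m (J (bop ath)) q + m residual q).
  by rewrite (main_eq Sq); field.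
have gd_le : nrm e (g ath + d) <= g1 * Y + eps.
  apply: le_trans (nrmD He _ _) _; apply: lerD => //.
  by apply: le_trans (g_le _) _; rewrite ler_wpM2l.
have qb : nrm b q <= CP * Y by [].
have qe : nrm e q <= CP * Y by apply: le_trans (e_le_b Sq) _.
have qm : nrm m q <= 2 * (CP * Y).
  by apply: le_trans (m_le_b Sq) _; rewrite ler_wpM2l.
have [s_ge s_le] := andP Hs.
have sp : 0 <= s by rewrite (le_trans (ltW s00)).
have E1 : mu * e (g ath + d) dth <= `|mu| * (Z * (g1 * Y + eps)).
  apply: le_trans (ler_norm _) _; rewrite normrM ler_wpM2l //.
  apply: le_trans (cauchy_schwarz He _ _) _.
  by rewrite mulrC ler_wpM2l.
have E2 : mu * e (J (s *: dth + (g ath + d))) q <=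
    `|mu| * ((s * Z + (g1 * Y + eps)) * (CP * Y)).
  apply: le_trans (ler_norm _) _; rewrite normrM ler_wpM2l //.
  apply: le_trans (cauchy_schwarz He _ _) _.
  rewrite (nrm_rotation _ eJ); apply: ler_pM; rewrite ?nrm_ge0 //.
  apply: le_trans (nrmD He _ _) _; apply: lerD => //.
  by rewrite (nrmZ He) ger0_norm.
have E3 : - b (J (ath + dl)) q <= (Y + eps) * (CP * Y).
  apply: le_trans (ler_norm _) _; rewrite normrN.
  apply: le_trans (cauchy_schwarz Hb _ _) _.
  rewrite (nrm_rotation _ bJ); apply: ler_pM; rewrite ?nrm_ge0 //.
  by apply: le_trans (nrmD Hb _ _) _; apply: lerD.
have E4 : a^-1 * (m (J (bop ath)) q + m residual q) <=
    A * ((2 * B1 * Y + eps) * (2 * (CP * Y))).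
  apply: le_trans (ler_norm _) _; rewrite normrM ler_pM //.
  rewrite -(sipDl Hm); apply: le_trans (cauchy_schwarz Hm _ _) _.
  apply: ler_pM; rewrite ?nrm_ge0 //.
  apply: le_trans (nrmD Hm _ _) _; apply: lerD => //.
  rewrite (nrm_rotation _ mJ); apply: le_trans (bop_le _) _.
  have := ler_wpM2l B10 (m_le_b Sath); rewrite -/Y; lra.
have := energy_real Hmu Hs Z0 Y0 eps0.
have K0 : 0 <= energy_constant.
  have sCP : 0 <= s1 * CP by rewrite mulr_ge0.
  rewrite /energy_constant !addr_ge0 ?divr_ge0 ?mulr_ge0 ?sqr_ge0 ?addr_ge0 ?mulr_ge0 //.
  exact: ltW.
have Y2 : 2 * Y ^+ 2 <= b th1 th1 + b th0 th0.
  rewrite /Y (sqr_nrm Hb) /ath (sipZl Hb) (sipZr Hb) !(sipDl Hb, sipDr Hb).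
  have := sip_ge0 Hb (th1 - th0).
  rewrite !(sipBl Hb, sipBr Hb) (sipC Hb th0 th1); lra.
have bk : 2 * k * b ath dth = b th1 th1 - b th0 th0.
  rewrite /ath /dth (sipZl Hb) (sipZr Hb) !(sipDl Hb, sipBr Hb) (sipC Hb th0 th1).
  by field.
move=> er.
have fin : b ath dth <= energy_constant * (Y ^+ 2 + eps ^+ 2)
   + (a^-1 * m residual (J dth) - b dl dth).
  rewrite key mdq; lra.
rewrite -bk defectE.
have k2 : 0 <= 2 * k by rewrite mulr_ge0 // ltW.
apply: le_trans (ler_wpM2l k2 fin) _.
have kK : 0 <= k * energy_constant by rewrite mulr_ge0 // ltW.
have := ler_wpM2l kK Y2.
have := mulr_ge0 kK (addr_ge0 (sip_ge0 Hb th1) (sip_ge0 Hb th0)); lra.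
Qed.
End Step.

Lemma defect_le a xr yr dl bop eps chi : `|a^-1| <= A -> 0 <= eps ->
  nrm m (residual bop xr yr) <= eps -> nrm b dl <= eps -> S chi ->
  `|defect bop a xr yr dl chi| <= (2 * A + 1) * eps * nrm b chi.
Proof.
move=> aA e0 re de Sc; rewrite /defect.
apply: le_trans (ler_normB _ _) _; rewrite normrM.
have := cauchy_schwarz Hb dl chi.
have := cauchy_schwarz Hm (residual bop xr yr) (J chi); rewrite (nrm_rotation _ mJ).
have bc := nrm_ge0 b chi.
have h1 : nrm m (residual bop xr yr) * nrm m chi <= eps * (2 * nrm b chi).
  by apply: ler_pM; rewrite ?nrm_ge0 ?m_le_b.
move=> /le_trans/(_ h1) h2 /le_trans/(_ (ler_wpM2r bc de)) h3.
have := ler_pM (normr_ge0 _) (normr_ge0 _) aA h2; lra.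
Qed.

Lemma defect_diff_le a a' xr xr' yr yr' dl dl' bop bop' A1 E1 eps kap chi :
  `|a^-1| <= A -> `|a'^-1 - a^-1| <= A1 * kap -> 0 <= eps -> 0 <= kap -> 0 <= A1 ->
  0 <= E1 ->
  nrm m (residual bop xr yr) <= eps ->
  nrm m (residual bop' xr' yr' - residual bop xr yr) <= E1 * eps * kap ->
  `|a'^-1| <= A ->
  nrm b (dl' - dl) <= eps * kap -> S chi ->
  `|defect bop' a' xr' yr' dl' chi - defect bop a xr yr dl chi|
     <= (2 * A1 + 2 * A * E1 + 1) * eps * kap * nrm b chi.
Proof.
move=> aA aA1 e0 k0 A10 E10 re dre aA' dde Sc; rewrite /defect.
set r := residual bop xr yr in re dre *; set r' := residual bop' xr' yr' in dre *.
have -> : a'^-1 * m r' (J chi) - b dl' chi - (a^-1 * m r (J chi) - b dl chi) =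
  a'^-1 * m (r' - r) (J chi) + (a'^-1 - a^-1) * m r (J chi) - b (dl' - dl) chi.
  by rewrite (sipBl Hm) (sipBl Hb); ring.
apply: le_trans (ler_normB _ _) _.
have bc := nrm_ge0 b chi.
have h0 : `|b (dl' - dl) chi| <= eps * kap * nrm b chi.
  by apply: le_trans (cauchy_schwarz Hb _ _) _; rewrite ler_wpM2r.
have mc v D : 0 <= D -> nrm m v <= D -> `|m v (J chi)| <= D * (2 * nrm b chi).
  move=> D0 vD; apply: le_trans (cauchy_schwarz Hm _ _) _.
  by rewrite (nrm_rotation _ mJ) ler_pM ?nrm_ge0 ?m_le_b.
have h1 : `|a'^-1 * m (r' - r) (J chi)| <= A * (E1 * eps * kap * (2 * nrm b chi)).
  by rewrite normrM ler_pM // mc // !mulr_ge0.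
have h2 : `|(a'^-1 - a^-1) * m r (J chi)| <= A1 * kap * (eps * (2 * nrm b chi)).
  by rewrite normrM ler_pM // mc.
have := ler_normD (a'^-1 * m (r' - r) (J chi)) ((a'^-1 - a^-1) * m r (J chi)); lra.
Qed.

End Energy.

(** * Bounded measurable functions on the interval *)

Notation ReC := complex.Re.
Notation ImC := complex.Im.

Section ComplexParts.
Context {R : realType}.
Implicit Types (z w : R[i]).
Lemma ReCD z w : ReC (z + w) = ReC z + ReC w. Proof. by case: z w => [? ?] []. Qed.
Lemma ImCD z w : ImC (z + w) = ImC z + ImC w. Proof. by case: z w => [? ?] []. Qed.
Lemma ReCN z : ReC (- z) = - ReC z. Proof. by case: z. Qed.
Lemma ImCN z : ImC (- z) = - ImC z. Proof. by case: z. Qed.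
Lemma ReCM z w : ReC (z * w) = ReC z * ReC w - ImC z * ImC w.
Proof. by case: z w => [? ?] []. Qed.
Lemma ImCM z w : ImC (z * w) = ReC z * ImC w + ImC z * ReC w.
Proof. by case: z w => [? ?] []. Qed.
Lemma ReCR (x : R) : ReC x%:C%C = x. Proof. by []. Qed.
Lemma ImCR (x : R) : ImC x%:C%C = 0 :> R. Proof. by []. Qed.
Lemma ReCi : ReC ('i%C : R[i]) = 0 :> R. Proof. by []. Qed.
Lemma ImCi : ImC ('i%C : R[i]) = 1 :> R. Proof. by []. Qed.
Lemma ReCconj z : ReC (z^*)%C = ReC z. Proof. by case: z. Qed.
Lemma ImCconj z : ImC (z^*)%C = - ImC z. Proof. by case: z. Qed.
Lemma ReC0 : ReC (0 : R[i]) = 0 :> R. Proof. by []. Qed.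
Lemma ImC0 : ImC (0 : R[i]) = 0 :> R. Proof. by []. Qed.
Lemma ReC1 : ReC (1 : R[i]) = 1 :> R. Proof. by []. Qed.
Lemma ImC1 : ImC (1 : R[i]) = 0 :> R. Proof. by []. Qed.
Definition ReImE := (ReCi, ImCi, ReCR, ImCR, ReCD, ImCD, ReCN, ImCN, ReCM, ImCM,
  ReCconj, ImCconj, ReC0, ImC0, ReC1, ImC1).
Lemma complexP z w : ReC z = ReC w -> ImC z = ImC w -> z = w.
Proof. by case: z w => [? ?] [? ?] /= -> ->. Qed.
Lemma cabsE z : cabs z ^+ 2 = ReC z ^+ 2 + ImC z ^+ 2.
Proof.
case: z => x y; rewrite /cabs normc_def /=. by rewrite sqr_sqrtr ?addr_ge0 ?sqr_ge0.
Qed.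
Lemma cabs_ge0 z : 0 <= cabs z.
Proof. by case: z => x y; rewrite /cabs normc_def /= sqrtr_ge0. Qed.
End ComplexParts.

Section BoundedMeasurable.
Context {R : realType}.
Notation D := (`]0%R, 1%R[%classic : set R).
Notation mu := (@lebesgue_measure R).
Implicit Types (f g : R -> R).

Definition bmr f := measurable_fun D f /\ exists M : R, forall x, D x -> `|f x| <= M.

Lemma bmr_integrable f : bmr f -> mu.-integrable D (EFin \o f).
Proof.
move=> [mf [M fM]]; apply: measurable_bounded_integrable => //.
  by rewrite /= lebesgue_measure_itv /= lte_fin ltr01 -EFinD ltry.
exists M; split; first exact: num_real.
by move=> M' MM' x Dx; apply: le_trans (fM x Dx) (ltW MM').
Qed.

Lemma bmrD f g : bmr f -> bmr g -> bmr (fun x => f x + g x).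
Proof.
move=> [mf [M fM]] [mg [N gN]]; split; first exact: measurable_funD.
by exists (M + N) => x Dx; apply: le_trans (ler_normD _ _) _; apply: lerD; auto.
Qed.

Lemma bmrM f g : bmr f -> bmr g -> bmr (fun x => f x * g x).
Proof.
move=> [mf [M fM]] [mg [N gN]]; split; first exact: measurable_funM.
by exists (M * N) => x Dx; rewrite normrM ler_pM //; auto.
Qed.

Lemma bmr_cst (c : R) : bmr (fun=> c).
Proof. by split; [exact: measurable_cst|exists `|c|]. Qed.

Lemma bmrN f : bmr f -> bmr (fun x => - f x).
Proof.
move=> bf; have := bmrM (bmr_cst (-1)) bf.
by congr bmr; apply/funext => x; rewrite mulN1r.
Qed.

Lemma bmrB f g : bmr f -> bmr g -> bmr (fun x => f x - g x).
Proof. by move=> bf bg; apply: bmrD => //; exact: bmrN. Qed.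

Lemma bmr_eq f g : (forall x, D x -> f x = g x) -> bmr f -> bmr g.
Proof.
move=> fg [mf [M fM]]; split.
  by apply: (eq_measurable_fun f) => // x /set_mem; exact: fg.
by exists M => x Dx; rewrite -fg // fM.
Qed.

Lemma bmr_continuous f : {within `[0, 1], continuous f} -> bmr f.
Proof.
move=> cf; have c01 : compact (`[0, 1] : set R) by exact: segment_compact.
split.
  apply: (@measurable_funS _ _ _ _ (`[0, 1] : set R)) => //.
    exact: subset_itv_oo_cc.
  exact: subspace_continuous_measurable_fun.
have /compact_bounded[M [_ /(_ (M + 1))]] := continuous_compact cf c01.
rewrite ltrDl ltr01 => /(_ isT) fM; exists (M + 1) => x Dx.
by apply: fM; exists x => //; exact: subset_itv_oo_cc Dx.
Qed.

Definition Iint f : R := Rintegral mu D f.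

Lemma IintD f g : bmr f -> bmr g -> Iint (fun x => f x + g x) = Iint f + Iint g.
Proof. by move=> bf bg; apply: RintegralD => //; exact: bmr_integrable. Qed.

Lemma IintB f g : bmr f -> bmr g -> Iint (fun x => f x - g x) = Iint f - Iint g.
Proof. by move=> bf bg; apply: RintegralB => //; exact: bmr_integrable. Qed.

Lemma IintZ c f : bmr f -> Iint (fun x => c * f x) = c * Iint f.
Proof. by move=> bf; apply: RintegralZl => //; exact: bmr_integrable. Qed.

Lemma Iint_ge0 f : (forall x, D x -> 0 <= f x) -> 0 <= Iint f.
Proof. by move=> f0; rewrite /Iint; apply: Rintegral_ge0. Qed.

Lemma eq_Iint f g : (forall x, D x -> f x = g x) -> Iint f = Iint g.
Proof. by move=> fg; apply: eq_Rintegral => x /set_mem; exact: fg. Qed.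

Lemma le_Iint f g : bmr f -> bmr g -> (forall x, D x -> f x <= g x) ->
  Iint f <= Iint g.
Proof. by move=> bf bg fg; rewrite /Iint; apply: le_Rintegral => //; exact: bmr_integrable. Qed.

Lemma Iint_cst c : Iint (fun=> c) = c.
Proof.
rewrite /Iint Rintegral_cst //= lebesgue_measure_itv /= lte_fin ltr01 /=.
by rewrite subr0 mulr1.
Qed.

Definition bm (f : R -> R[i]) := bmr (fun x => ReC (f x)) /\ bmr (fun x => ImC (f x)).

Implicit Types (u v w : R -> R[i]).

Lemma bm_cst (c : R[i]) : bm (fun=> c).
Proof. by split; exact: bmr_cst. Qed.

Lemma bmD u v : bm u -> bm v -> bm (fun x => u x + v x).
Proof.
move=> [ru iu] [rv iv]; split; [move: (bmrD ru rv)|move: (bmrD iu iv)];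
  by apply: bmr_eq => x _; rewrite ReImE.
Qed.

Lemma bmN u : bm u -> bm (fun x => - u x).
Proof.
move=> [ru iu]; split; [move: (bmrN ru)|move: (bmrN iu)];
  by apply: bmr_eq => x _; rewrite ReImE.
Qed.

Lemma bmM u v : bm u -> bm v -> bm (fun x => u x * v x).
Proof.
move=> [ru iu] [rv iv]; split.
  move: (bmrB (bmrM ru rv) (bmrM iu iv)).
  by apply: bmr_eq => x _; rewrite ReImE.
move: (bmrD (bmrM ru iv) (bmrM iu rv)).
by apply: bmr_eq => x _; rewrite ReImE.
Qed.

Lemma bm_conj u : bm u -> bm (fun x => (u x)^*%C).
Proof.
move=> [ru iu]; split; [move: ru|move: (bmrN iu)];
  by apply: bmr_eq => x _; rewrite ReImE.
Qed.

Lemma bm_continuous u : ccontinuous_on (`[0, 1] : set R) u -> bm u.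
Proof. by move=> [ru iu]; split; exact: bmr_continuous. Qed.

(** The real scalar product of the values, under the identification of the
    complex numbers with the plane. *)
Definition rdot u v x : R := ReC (u x) * ReC (v x) + ImC (u x) * ImC (v x).

Lemma bmr_rdot u v : bm u -> bm v -> bmr (rdot u v).
Proof. by move=> [ru iu] [rv iv]; apply: bmrD; apply: bmrM. Qed.

Definition rip u v : R := Iint (rdot u v).

Lemma Re_ip u v : ReC (ip u v) = rip u v.
Proof.
rewrite /ip /cint /= /rip /Iint; apply: eq_Iint => x _.
by rewrite /rdot !ReImE mulrN opprK.
Qed.

Lemma Im_ip u v : ImC (ip u v) = rip u (fun x => 'i%C * v x).
Proof.
rewrite /ip /cint /= /rip /Iint; apply: eq_Iint => x _.
by rewrite /rdot !ReImE; ring.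
Qed.

Lemma L2normE u : L2norm u = Num.sqrt (rip u u).
Proof. by rewrite /L2norm Re_ip. Qed.

End BoundedMeasurable.

Section BMType.
Context {R : realType}.

(** Bounded measurable functions form a space closed under products, on which
    all integrals below are finite without side conditions. *)
Record bmfun := BMFun { bmfun_fun :> R -> R[i]; bmfun_bm : bm bmfun_fun }.

Lemma bmfun_ext (f g : bmfun) : (forall x, f x = g x) -> f = g.
Proof.
case: f g => f bf [g bg] /= /funext fg; subst g; congr BMFun.
exact: Prop_irrelevance.
Qed.

HB.instance Definition _ := gen_eqMixin bmfun.
HB.instance Definition _ := gen_choiceMixin bmfun.

Definition bmfun_zero : bmfun := BMFun (bm_cst 0).
Definition bmfun_add (f g : bmfun) : bmfun := BMFun (bmD (bmfun_bm f) (bmfun_bm g)).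
Definition bmfun_opp (f : bmfun) : bmfun := BMFun (bmN (bmfun_bm f)).
Definition bmfun_mul (f g : bmfun) : bmfun := BMFun (bmM (bmfun_bm f) (bmfun_bm g)).
Definition bmfun_cst (c : R[i]) : bmfun := BMFun (bm_cst c).
Definition bmfun_scale (a : R) (f : bmfun) : bmfun := bmfun_mul (bmfun_cst a%:C%C) f.

Lemma bmfun_addA : associative bmfun_add.
Proof. by move=> f g h; apply: bmfun_ext => x /=; rewrite addrA. Qed.
Lemma bmfun_addC : commutative bmfun_add.
Proof. by move=> f g; apply: bmfun_ext => x /=; rewrite addrC. Qed.
Lemma bmfun_add0 : left_id bmfun_zero bmfun_add.
Proof. by move=> f; apply: bmfun_ext => x /=; rewrite add0r. Qed.
Lemma bmfun_addN : left_inverse bmfun_zero bmfun_opp bmfun_add.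
Proof. by move=> f; apply: bmfun_ext => x /=; rewrite addNr. Qed.

HB.instance Definition _ := GRing.isZmodule.Build bmfun
  bmfun_addA bmfun_addC bmfun_add0 bmfun_addN.

Lemma bmfun_scaleA a b (f : bmfun) :
  bmfun_scale a (bmfun_scale b f) = bmfun_scale (a * b) f.
Proof. by apply: bmfun_ext => x /=; rewrite mulrA -rmorphM. Qed.
Lemma bmfun_scale1 : left_id 1 bmfun_scale.
Proof. by move=> f; apply: bmfun_ext => x /=; rewrite mul1r. Qed.
Lemma bmfun_scaleDr : right_distributive bmfun_scale +%R.
Proof. by move=> a f g; apply: bmfun_ext => x /=; rewrite mulrDr. Qed.
Lemma bmfun_scaleDl (f : bmfun) : {morph bmfun_scale^~ f : a b / a + b}.
Proof. by move=> a b; apply: bmfun_ext => x /=; rewrite rmorphD mulrDl. Qed.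

HB.instance Definition _ := GRing.Zmodule_isLmodule.Build R bmfun
  bmfun_scaleA bmfun_scale1 bmfun_scaleDr bmfun_scaleDl.


Definition l2 (f g : bmfun) : R := rip f g.

Lemma l2_semi_inner : semi_inner l2.
Proof.
split.
- by move=> u v; apply: eq_Iint => x _; rewrite /rdot; ring.
- move=> a u v w; rewrite /l2 /rip.
  rewrite -IintZ; last exact: (bmr_rdot (bmfun_bm _) (bmfun_bm _)).
  rewrite -IintD; [|apply: bmrM; first exact: bmr_cst|]; last first.
  + exact: (bmr_rdot (bmfun_bm _) (bmfun_bm _)).
  + exact: (bmr_rdot (bmfun_bm _) (bmfun_bm _)).
  + by apply: eq_Iint => x _; rewrite /rdot /= !ReImE; ring.
- move=> u; apply: Iint_ge0 => x _.
  by rewrite /rdot -!expr2 addr_ge0 ?sqr_ge0.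
Qed.

(** Derivatives of u are bounded only at times in [0, T]; the default value
    makes them curves defined for all times. *)
Definition to_bm (f : R -> R[i]) : bmfun :=
  if pselect (bm f) is left H then BMFun H else 0.

Lemma to_bmE f : bm f -> (to_bm f : R -> R[i]) = f.
Proof. by rewrite /to_bm; case: pselect. Qed.

End BMType.
Arguments bmfun : clear implicits.

(** * Piecewise continuously differentiable functions *)

Section C1Interval.
Context {R : realType}.
Notation mu := (@lebesgue_measure R).
Implicit Types (v g w k : R -> R).

(** The derivative g is compared with a continuous G on the open interval only:
    at the nodes of a mesh a piecewise derivative has an arbitrary value. *)
Definition C1itv (a b : R) v g :=
  {within `[a, b], continuous v} /\
  exists G : R -> R, {within `[a, b], continuous G} /\
    forall x, x \in `]a, b[ -> is_derive x 1 v (g x) /\ g x = G x.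

Lemma C1itv_sub a b c d v g : a <= c -> d <= b -> C1itv a b v g -> C1itv c d v g.
Proof.
move=> ac db [cv [G [cG vG]]].
have sub x : x \in `[c, d] -> x \in `[a, b].
  rewrite !in_itv /= => /andP[cx xd].
  by rewrite (le_trans ac cx) (le_trans xd db).
split; first by apply: continuous_subspaceW cv => x; exact: sub.
exists G; split; first by apply: continuous_subspaceW cG => x; exact: sub.
move=> x; rewrite in_itv /= => /andP[cx xd]; apply: vG.
by rewrite in_itv /= (le_lt_trans ac cx) (lt_le_trans xd db).
Qed.

Lemma C1itvD a b v g w k : C1itv a b v g -> C1itv a b w k ->
  C1itv a b (fun x => v x + w x) (fun x => g x + k x).
Proof.
move=> [cv [G [cG vG]]] [cw [K [cK wK]]]; split.
  by move=> x; apply: continuousD; [exact: cv|exact: cw].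
exists (fun x => G x + K x); split.
  by move=> x; apply: continuousD; [exact: cG|exact: cK].
move=> x xab; have [dv ->] := vG x xab; have [dw ->] := wK x xab; split=> //.
by apply: is_deriveD; rewrite -?(proj2 (vG x xab)) -?(proj2 (wK x xab)).
Qed.

Lemma C1itvM a b v g w k : C1itv a b v g -> C1itv a b w k ->
  C1itv a b (fun x => v x * w x) (fun x => g x * w x + v x * k x).
Proof.
move=> [cv [G [cG vG]]] [cw [K [cK wK]]]; split.
  by move=> x; apply: continuousM; [exact: cv|exact: cw].
exists (fun x => G x * w x + v x * K x); split.
  move=> x.
  exact: (continuousD (continuousM (cG x) (cw x)) (continuousM (cv x) (cK x))).
move=> x xab; have [dv <-] := vG x xab; have [dw <-] := wK x xab; split=> //.
have := is_deriveM dv dw; rewrite addrC.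
by rewrite [X in is_derive _ _ _ X](_ : _ = g x * w x + v x * k x) // /GRing.scale /=; ring.
Qed.

Lemma C1itv_cst a b (c : R) : C1itv a b (fun=> c) (fun=> 0).
Proof.
split; first by move=> x; exact: cvg_cst.
exists (fun=> 0); split; first by move=> x; exact: cvg_cst.
by move=> x _; split=> //; exact: is_derive_cst.
Qed.

Definition bmi (a b : R) v :=
  measurable_fun (`[a, b] : set R) v /\ exists M : R, forall x, x \in `[a, b] -> `|v x| <= M.

Lemma bmi_continuous a b v : {within `[a, b], continuous v} -> bmi a b v.
Proof.
move=> cv; split; first exact: subspace_continuous_measurable_fun.
have /compact_bounded[M [_ /(_ (M + 1))]] :=
  continuous_compact cv (@segment_compact _ a b).
rewrite ltrDl ltr01 => /(_ isT) fM; exists (M + 1) => x xab.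
by apply: fM; exists x.
Qed.

Lemma bmi_integrable a b v : bmi a b v -> mu.-integrable (`[a, b] : set R) (EFin \o v).
Proof.
move=> [mf [M fM]]; apply: measurable_bounded_integrable => //.
  by rewrite /= lebesgue_measure_itv /=; case: ifP => _; rewrite -?EFinD ltry.
exists M; split; first exact: num_real.
by move=> M' MM' x Dx; apply: le_trans (fM x Dx) (ltW MM').
Qed.

Lemma bmi_oo a b v G : bmi a b G -> (forall x, x \in `]a, b[ -> v x = G x) ->
  bmi a b v.
Proof.
move=> [mG [M GM]] vG; split.
  have := @measurable_fun_itv_cc R a b false true v; apply.
  apply: (eq_measurable_fun G); first by move=> x /set_mem/vG.
  by apply: measurable_funS mG => //; exact: subset_itv_oo_cc.
exists (Num.max M (Num.max `|v a| `|v b|)) => x xab.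
have [->|xa] := eqVneq x a; first by rewrite !le_max lexx !orbT.
have [->|xb] := eqVneq x b; first by rewrite !le_max lexx !orbT.
rewrite le_max vG ?GM //; move: xab; rewrite !in_itv /= => /andP[ax xb'].
by rewrite !lt_neqAle ax xb' xb eq_sym xa.
Qed.

Lemma Rintegral_cc_oo a b v : mu.-integrable (`[a, b] : set R) (EFin \o v) ->
  \int[mu]_(x in `[a, b]) v x = \int[mu]_(x in `]a, b[) v x.
Proof.
move=> iv.
rewrite -Rintegral_itv_bndo_bndc; last first.
  by apply: integrableS iv => //; apply: subset_itvl; rewrite bnd_simp.
rewrite Rintegral_itv_obnd_cbnd // ; last first.
  by apply: integrableS iv => //; exact: subset_itv_oo_cc.
Qed.

Lemma C1itv_integral a b v g : a < b -> C1itv a b v g ->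
  [/\ bmi a b v, bmi a b g & \int[mu]_(x in `[a, b]) g x = v b - v a].
Proof.
move=> ab [cv [G [cG vG]]].
have bG : bmi a b G by exact: bmi_continuous.
have bg : bmi a b g by apply: bmi_oo bG _ => x /vG[].
split => //; first exact: bmi_continuous.
rewrite Rintegral_cc_oo ?(bmi_integrable bg) //.
transitivity (\int[mu]_(x in `]a, b[) G x).
  by apply: eq_Rintegral => x /set_mem/vG[].
rewrite -Rintegral_cc_oo ?(bmi_integrable bG) //.
rewrite /Rintegral (@continuous_FTC2 _ G v) //=.
  have [vab va vb] := (continuous_within_itvP v ab).1 cv.
  by split=> // x /vG[[]].
by move=> x /vG[[? <-] <-]; rewrite derive1E.
Qed.

Definition piecewise_C1 (M : nat) (p : nat -> R) v g :=
  forall j, (j < M)%N -> C1itv (p j) (p j.+1) v g.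

Lemma bmi_setU a b c v : a <= b -> b <= c -> bmi a b v -> bmi b c v -> bmi a c v.
Proof.
move=> ab bc [mv [M vM]] [mv' [M' vM']].
have E : [set` `[a, c]] = [set` `[a, b]] `|` [set` `]b, c]].
  by rewrite -itv_bndbnd_setU // bnd_simp.
split.
  rewrite E; apply/measurable_funU => //; split => //.
  by apply: measurable_funS mv' => //; apply: subset_itvr; rewrite bnd_simp.
exists (Num.max M M') => x; rewrite in_itv /= => /andP[ax xc]; rewrite le_max.
have [xb|bx] := leP x b; first by rewrite vM // in_itv /= ax xb.
by rewrite vM' ?orbT // in_itv /= (ltW bx) xc.
Qed.

Lemma Rintegral_split a b c v : a <= b -> b <= c -> bmi a c v ->
  \int[mu]_(x in `[a, c]) v x
   = \int[mu]_(x in `[a, b]) v x + \int[mu]_(x in `[b, c]) v x.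
Proof.
move=> ab bc bv; have iv := bmi_integrable bv.
have ibc : mu.-integrable (`[b, c] : set R) (EFin \o v).
  by apply: integrableS iv => //; apply: subset_itvr; rewrite bnd_simp.
rewrite -(Rintegral_itv_obnd_cbnd (r := b)); last first.
  by apply: integrableS ibc => //; apply: subset_itvr; rewrite bnd_simp.
by rewrite -(Rintegral_itvB iv) ?bnd_simp // subrKC.
Qed.

(** The one-interval formula telescopes over the mesh, because v is continuous
    at the nodes. *)
Lemma piecewise_C1_integral (M : nat) (p : nat -> R) v g :
  (forall j, (j < M)%N -> p j < p j.+1) -> piecewise_C1 M p v g ->
  [/\ bmi (p 0%N) (p M) v, bmi (p 0%N) (p M) g &
      \int[mu]_(x in `[p 0%N, p M]) g x = v (p M) - v (p 0%N)].
Proof.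
move=> plt pc.
have pmon n : (n <= M)%N -> p 0%N <= p n.
  elim: n => // n IH nM; apply: (le_trans (IH (ltnW nM))); exact/ltW/plt.
suff H n : (n <= M)%N -> [/\ bmi (p 0%N) (p n) v, bmi (p 0%N) (p n) g &
      \int[mu]_(x in `[p 0%N, p n]) g x = v (p n) - v (p 0%N)] by exact: H.
elim: n => [_|n IH nM].
  have b1 f : bmi (p 0%N) (p 0%N) f.
    split; first by rewrite set_itv1; exact: measurable_fun_set1.
    exists `|f (p 0%N)| => x; rewrite in_itv /= => h.
    by have /eqP -> : x == p 0%N by rewrite eq_le andbC.
  by split=> //; rewrite set_itv1 Rintegral_set1 subrr.
have [bv bg ig] := IH (ltnW nM).
have [bv' bg' ig'] := C1itv_integral (plt n nM) (pc n nM).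
have h0 := pmon n (ltnW nM); have h1 := ltW (plt n nM).
have bbg : bmi (p 0%N) (p n.+1) g by exact: bmi_setU bg bg'.
split=> //; first exact: bmi_setU bv bv'.
by rewrite (Rintegral_split h0 h1 bbg) ig ig' addrC addrA subrK.
Qed.

Lemma piecewise_C1_01 (M : nat) (p : nat -> R) v g :
  is_partition 1 M p -> piecewise_C1 M p v g ->
  [/\ bmr v, bmr g & Iint g = v 1 - v 0].
Proof.
move=> [p0 pM plt] pc; have := piecewise_C1_integral plt pc.
rewrite p0 pM => -[bv bg ig].
have bmr_bmi f : bmi 0 1 f -> bmr f.
  move=> [mf [K fK]]; split.
    by apply: measurable_funS mf => //; exact: subset_itv_oo_cc.
  by exists K => x Dx; apply: fK; exact: subset_itv_oo_cc Dx.
split; [exact: bmr_bmi|exact: bmr_bmi|].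
by rewrite /Iint -Rintegral_cc_oo //; exact: bmi_integrable.
Qed.

Lemma C1itv_piecewise (M : nat) (p : nat -> R) v g :
  is_partition 1 M p -> C1itv 0 1 v g -> piecewise_C1 M p v g.
Proof.
move=> [p0 pM plt] fg j jM.
have mon i (k : nat) : (i <= k)%N -> (k <= M)%N -> p i <= p k.
  elim: k => [|k IH]; first by rewrite leqn0 => /eqP ->.
  rewrite leq_eqVlt => /predU1P[->//|ik kM].
  by apply: le_trans (ltW (plt k kM)); apply: IH => //; exact: ltnW.
apply: C1itv_sub fg; first by rewrite -p0 mon // ltnW.
by rewrite -pM mon.
Qed.

End C1Interval.

(** * Test functions approximating indicators of intervals *)

Section TestFunctions.
Context {R : realType}.

Lemma is_derive_cvg (f : R -> R) x l :
  h^-1 * (f (h + x) - f x) @[h --> 0^'] --> l -> is_derive x 1 f l.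
Proof.
move=> fl.
have fl' : h^-1 *: ((f \o shift x) (h *: 1) - f x) @[h --> 0^'] --> l.
  by under eq_fun do rewrite /= scaler1.
by apply: DeriveDef; [apply/cvg_ex; exists l|exact: cvg_lim fl'].
Qed.

(** A quadratic remainder avoids case distinctions at the points where an
    absolute value is not smooth. *)
Lemma is_derive_quadratic (f : R -> R) x l :
  (forall h, `|f (h + x) - f x - h * l| <= h ^+ 2) -> is_derive x 1 f l.
Proof.
move=> fq; apply: is_derive_cvg; apply/cvgrPdist_le => /= e e0; near=> h.
have h0 : h != 0 by near: h; exact: nbhs_dnbhs_neq.
have he : `|h| <= e.
  near: h; apply: dnbhs0_le; exact: e0.
rewrite distrC.
have -> : h^-1 * (f (h + x) - f x) - l = h^-1 * (f (h + x) - f x - h * l) by field.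
rewrite normrM normrV ?unitfE // ler_pdivrMl ?normr_gt0 //.
apply: le_trans (fq h) _.
by rewrite -real_normK ?num_real // expr2 ler_wpM2l.
Unshelve. all: by end_near. Qed.

(** This is max(0, t) ^ 2. *)
Definition sqpos (t : R) : R := t * (t + `|t|) / 2.

Lemma sqpos_ge0 t : 0 <= sqpos t.
Proof.
by rewrite /sqpos; case: (lerP 0 t) => t0; [rewrite ger0_norm //|rewrite ltr0_norm //]; nra.
Qed.

Lemma sqpos_le0 t : t <= 0 -> sqpos t = 0.
Proof. by move=> t0; rewrite /sqpos ler0_norm // subrr mulr0 mul0r. Qed.

Lemma sqpos_gt0 t : 0 < t -> 0 < sqpos t.
Proof. by move=> t0; rewrite /sqpos gtr0_norm //; nra. Qed.

Lemma is_derive_sqpos (t : R) : is_derive t 1 sqpos (t + `|t|).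
Proof.
apply: is_derive_quadratic => h; rewrite /sqpos ler_norml.
apply/andP; case: (lerP 0 t) => t0; case: (lerP 0 (h + t)) => ht;
  rewrite ?(ger0_norm t0) ?(ltr0_norm t0) ?(ger0_norm ht) ?(ltr0_norm ht);
  split; nra.
Qed.

Variables (c x : R).
Definition bump_poly y : R := sqpos (y - c) * sqpos (x - y).
Definition bump_poly' y : R :=
  (y - c + `|y - c|) * sqpos (x - y) - sqpos (y - c) * (x - y + `|x - y|).

Lemma is_derive_bump_poly (y : R) : is_derive y 1 bump_poly (bump_poly' y).
Proof.
have d1 : is_derive y 1 (fun y => sqpos (y - c)) (y - c + `|y - c|).
  have h : is_derive y 1 (fun y : R => y - c) (1 - 0) by exact: is_deriveB.
  by have := @is_derive1_comp R sqpos (fun y => y - c) y _ _ (is_derive_sqpos (y - c)) h; rewrite subr0 mulr1.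
have d2 : is_derive y 1 (fun y => sqpos (x - y)) (- (x - y + `|x - y|)).
  have h : is_derive y 1 (fun y : R => x - y) (0 - 1) by exact: is_deriveB.
  by have := @is_derive1_comp R sqpos (fun y => x - y) y _ _ (is_derive_sqpos (x - y)) h; rewrite sub0r mulrN1.
have := is_deriveM d1 d2; rewrite addrC.
rewrite [X in is_derive _ _ _ X](_ : _ = bump_poly' y) //.
by rewrite /bump_poly' /GRing.scale /=; ring.
Qed.

Lemma bump_poly_ge0 y : 0 <= bump_poly y.
Proof. by rewrite mulr_ge0 ?sqpos_ge0. Qed.

(** Support in [c, x] is inherited from bump_poly. For n to infinity the values
    tend to 1 where bump_poly is positive, that is on ]c, x[, and they stay
    below 1, so that dominated convergence applies. *)
Definition bump (n : nat) y : R := n%:R * bump_poly y / (1 + n%:R * bump_poly y).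

Let den_gt0 n y : 0 < 1 + n%:R * bump_poly y.
Proof. by rewrite ltr_pwDl // mulr_ge0 ?bump_poly_ge0. Qed.

Lemma bumpE n y : bump n y = 1 - (1 + n%:R * bump_poly y)^-1.
Proof. by rewrite /bump; have := den_gt0 n y => h; field; rewrite gt_eqF. Qed.

Lemma is_derive_bump n (y : R) :
  is_derive y 1 (bump n) (n%:R * bump_poly' y * (1 + n%:R * bump_poly y) ^- 2).
Proof.
have -> : bump n = (fun y => 1 - (1 + n%:R * bump_poly y)^-1).
  by apply/funext => z; rewrite bumpE.
have d := is_derive_bump_poly y.
have dn : is_derive y 1 (fun y => 1 + n%:R * bump_poly y) (0 + (n%:R * bump_poly' y)).
  by apply: is_deriveD; exact: is_deriveZ.
have nz : 1 + n%:R * bump_poly y != 0 by rewrite gt_eqF.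
have dv := @is_deriveV R (fun y => 1 + n%:R * bump_poly y) y _ 1 nz dn.
have : is_derive y 1 (fun y => 1 - (1 + n%:R * bump_poly y)^-1)
   (0 - (- (1 + n%:R * bump_poly y) ^- 2 *: (0 + n%:R * bump_poly' y))).
  by apply: is_deriveB.
by rewrite sub0r scaleNr opprK add0r /GRing.scale /= mulrC.
Qed.

Lemma continuous_sqpos : continuous sqpos.
Proof.
by move=> t; apply/differentiable_continuous/derivable1_diffP; case: (is_derive_sqpos t).
Qed.

Lemma continuous_bump_deriv n :
  continuous (fun y => n%:R * bump_poly' y * (1 + n%:R * bump_poly y) ^- 2).
Proof.
move=> y.
have cb : {for y, continuous bump_poly}.
  by apply/differentiable_continuous/derivable1_diffP; case: (is_derive_bump_poly y).
have cyc : {for y, continuous (fun y : R => y - c)} by apply: cvgB => //; exact: cvg_cst.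
have cxy : {for y, continuous (fun y : R => x - y)} by apply: cvgB => //; exact: cvg_cst.
have c1 : {for y, continuous (fun y => sqpos (y - c))}.
  by apply: (continuous_comp cyc); exact: continuous_sqpos.
have c2 : {for y, continuous (fun y => sqpos (x - y))}.
  by apply: (continuous_comp cxy); exact: continuous_sqpos.
have cb' : {for y, continuous bump_poly'}.
  apply: cvgB; apply: cvgM => //; apply: cvgD => //; exact: cvg_norm.
apply: cvgM; first by apply: cvgM => //; exact: cvg_cst.
apply: cvgV; first by rewrite expf_neq0 // gt_eqF.
have c3 : {for y, continuous (fun y => 1 + n%:R * bump_poly y)}.
  by apply: cvgD; [exact: cvg_cst|apply: cvgM => //; exact: cvg_cst].
exact: (cvgM c3 c3).
Qed.

Lemma bump_test_fun n : 0 < c -> x < 1 -> test_fun (bump n).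
Proof.
move=> c0 x1; split.
- by move=> y; case: (is_derive_bump n y).
- have -> : derive1 (bump n) =
      (fun y => n%:R * bump_poly' y * (1 + n%:R * bump_poly y) ^- 2).
    by apply/funext => y; rewrite derive1E; case: (is_derive_bump n y).
  exact: continuous_bump_deriv.
- exists c, x; split=> // y yn; rewrite /bump.
  suff -> : bump_poly y = 0 by rewrite mulr0 mul0r.
  rewrite /bump_poly; case: (leP y c) => yc; first by rewrite sqpos_le0 ?mul0r // subr_le0.
  case: (leP x y) => xy; first by rewrite [X in _ * X]sqpos_le0 ?mulr0 // subr_le0.
  by move: yn; rewrite in_itv /= (ltW yc) (ltW xy).
Qed.

Lemma bump_bounded n y : `|bump n y| <= 1.
Proof.
have h := den_gt0 n y; have p := mulr_ge0 (ler0n R n) (bump_poly_ge0 y).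
by rewrite /bump ger0_norm ?divr_ge0 // ?(ltW h) // ler_pdivrMr // mul1r lerDr.
Qed.

Lemma bump_cvg y : bump n y @[n --> \oo] --> (\1_(`]c, x[%classic : set R) y : R).
Proof.
rewrite indicE; case: (boolP (y \in _)) => [/set_mem|/negP] /=.
  rewrite in_itv /= => /andP[cy yx].
  have P0 : 0 < bump_poly y by rewrite mulr_gt0 ?sqpos_gt0 ?subr_gt0.
  apply/cvgrPdist_le => /= e e0; near=> n.
  rewrite bumpE opprB addrC subrK normrV ?unitfE ?gt_eqF // gtr0_norm //.
  rewrite -[e]invrK lef_pV2 ?posrE ?invr_gt0 //.
  have : (e * bump_poly y)^-1 <= n%:R by near: n; exact: nbhs_infty_ger.
  rewrite invfM ler_pdivrMr // => h; apply: le_trans h _.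
  by rewrite lerDr.
rewrite in_setE /= in_itv /= => /negP nyx.
have P0 : bump_poly y = 0.
  rewrite /bump_poly; case: (leP y c) => yc; first by rewrite sqpos_le0 ?mul0r // subr_le0.
  case: (leP x y) => xy; first by rewrite [X in _ * X]sqpos_le0 ?mulr0 // subr_le0.
  by move: nyx; rewrite yc xy.
rewrite (_ : (fun n => bump n y) = fun=> 0); first exact: cvg_cst.
by apply/funext => n; rewrite /bump P0 mulr0 mul0r.
Unshelve. all: by end_near. Qed.

End TestFunctions.

(** * The fundamental lemma of the calculus of variations *)

Section FundamentalLemma.
Context {R : realType}.
Notation D := (`]0%R, 1%R[%classic : set R).
Notation mu := (@lebesgue_measure R).
Variable d : R -> R.
Hypothesis intd : mu.-integrable D (EFin \o d).
Hypothesis d0 : forall phi, test_fun phi -> \int[mu]_(y in D) (d y * phi y) = 0.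

Let md : measurable_fun D d.
Proof. by case/integrableP : intd => /measurable_EFinP. Qed.

Let bump_measurable c x n : measurable_fun D (bump c x n).
Proof.
apply: measurable_funTS; apply: continuous_measurable_fun => y.
by apply/differentiable_continuous/derivable1_diffP; case: (is_derive_bump c x n y).
Qed.

Let int_oo c x : 0 < c -> x < 1 -> \int[mu]_(y in `]c, x[) d y = 0.
Proof.
move=> c0 x1.
pose f n y : \bar R := (d y * bump c x n y)%:E.
pose f_ y : \bar R := (d y * \1_(`]c, x[%classic : set R) y)%:E.
have mf n : measurable_fun D (f n).
  by apply/measurable_EFinP; apply: measurable_funM.
have mf_ : measurable_fun D f_.
  by apply/measurable_EFinP; apply: measurable_funM => //; exact: measurable_indic.
have ff : {ae mu, forall y, D y -> f ^~ y @ \oo --> f_ y}.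
  apply: aeW => y _; apply: cvg_EFin; first exact: nearW.
  by apply: cvgMr; exact: bump_cvg.
have intg : mu.-integrable D (fun y => `|d y|%:E).
  exact: integrable_abse intd.
have fg : {ae mu, forall y n, D y -> (`|f n y| <= `|d y|%:E)%E}.
  apply: aeW => y n _; rewrite /f lee_fin normrM.
  by rewrite ler_piMr // bump_bounded.
have [if_ _ cv] := @dominated_convergence _ _ R mu D (measurable_itv _) f f_ _ mf mf_ ff intg fg.
have int0 n : (\int[mu]_(y in D) f n y)%E = 0%E.
  have ifn : mu.-integrable D (f n).
    apply: (@le_integrable _ _ R mu D (measurable_itv _) (f n) (fun y => `|d y|%:E)).
    - exact: mf.
    - move=> y _; rewrite /f /= normr_id lee_fin normrM.
      by rewrite ler_piMr // bump_bounded.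
    - exact: intg.
  have := d0 (bump_test_fun n c0 x1); rewrite /Rintegral => e.
  rewrite -[LHS]fineK; last exact: integrable_fin_num.
  by rewrite e.
have lim0 : (\int[mu]_(y in D) f_ y)%E = 0%E.
  have : (fun n => \int[mu]_(y in D) f n y)%E @ \oo --> (\int[mu]_(y in D) f_ y)%E.
    exact: cv.
  have -> : (fun n => \int[mu]_(y in D) f n y)%E = cst 0%E by exact/funext.
  move=> cv0; apply: (cvg_unique _ cv0 (cvg_cst _)).
  exact: ereal_hausdorff.
have -> : `]c, x[%classic = D `&` `]c, x[%classic :> set R.
  apply/seteqP; split=> y; last by case.
  move=> yc; split => //; move: yc; rewrite /= !in_itv /= => /andP[cy yx].
  by rewrite (lt_trans c0 cy) (lt_trans yx x1).
rewrite Rintegral_mkcondr /Rintegral -[RHS]/(fine 0%E) -lim0; congr fine.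
apply: eq_integral => y _; rewrite /f_ patchE indicE.
by case: ifP => _; rewrite ?mulr1 ?mulr0.
Qed.

Let d_ := d \_ D.

Let intd_ A : measurable A -> mu.-integrable A (EFin \o d_).
Proof.
move=> mA; apply: (integrableS measurableT) => //.
by rewrite /d_ -restrict_EFin; apply/integrable_restrict => //; rewrite setTI.
Qed.

(** All integrals of d over intervals inside D vanish, by dominated convergence
    along the functions bump. Hence the primitive of d is constant in D, and
    Lebesgue's differentiation theorem identifies its derivative with d. *)
Lemma fundamental_lemma : {ae mu, forall x, D x -> d x = 0}.
Proof.
pose F x := \int[mu]_(t in [set` Interval (BRight 0) (BRight x)]) d_ t.
have FD c x : 0 < c -> c <= x -> x < 1 -> F x = F c.
  move=> c0 cx x1; apply/eqP; rewrite -subr_eq0 /F Rintegral_itvB ?bnd_simp //; last 2 first.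
  - exact: intd_.
  - exact: ltW.
  rewrite -Rintegral_itv_bndo_bndc; last exact: intd_.
  rewrite -[X in _ == X](int_oo c0 x1); apply/eqP.
  apply: eq_Rintegral => y /set_mem; rewrite /= in_itv /= => /andP[cy yx].
  rewrite /d_ patchE mem_set //= in_itv /=.
  by rewrite (lt_trans c0 cy) (lt_trans yx x1).
have loc : locally_integrable [set: R] d_.
  by apply: open_integrable_locally => //; [exact: openT|exact: intd_].
have := @FTC1 R d_ (BRight 0) (fun y => intd_ (measurable_itv _)) loc.
apply: filterS; first exact: (ae_filter_ringOfSetsType mu).
move=> x FTC /= xD; move: (xD); rewrite in_itv /= => /andP[x0 x1].
have [|_ FE] := FTC; first by [].
have -> : d x = d_ x by rewrite /d_ patchE mem_set.
rewrite -FE derive1E.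
suff [_ ->] : is_derive x 1 F 0 by [].
apply: (@near_eq_is_derive _ _ _ (cst (F x))) => //.
near=> y.
have y0 : 0 < y by near: y; exact: lt_nbhsr.
have y1 : y < 1 by near: y; exact: lt_nbhsl.
by rewrite /=; case: (leP x y) => xy; [rewrite (FD x y)|rewrite (FD y x) // ltW].
Unshelve. all: by end_near. Qed.

End FundamentalLemma.

(** * Weak derivatives *)

Section WeakDerivative.
Context {R : realType}.
Notation D := (`]0%R, 1%R[%classic : set R).
Notation mu := (@lebesgue_measure R).
Implicit Types (u v w g k : R -> R[i]).

Definition cmeas u := measurable_fun D (fun x => ReC (u x)) /\
  measurable_fun D (fun x => ImC (u x)).

Definition aeqD u v := {ae mu, forall x, D x -> u x = v x}.

Lemma L2_cmeas v : L2 v -> cmeas v. Proof. by case. Qed.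
Lemma bm_cmeas v : bm v -> cmeas v. Proof. by case=> -[? _] [? _]. Qed.

Lemma bm_L2 v : bm v -> L2 v.
Proof.
move=> bv; have [m1 m2] := bm_cmeas bv; split=> //.
have := bmr_integrable (bmr_rdot bv bv).
by congr (mu.-integrable _ _); apply/funext => x /=; rewrite cabsE /rdot !expr2.
Qed.

Lemma L2_integrable_test v (phi : R -> R) (F : R[i] -> R) : (F = @complex.Re R \/ F = @complex.Im R) ->
  L2 v -> bmr phi -> mu.-integrable D (EFin \o (fun x => F (v x) * phi x)).
Proof.
move=> HF [m1 m2 i2] [mphi [M phiM]].
have mF : measurable_fun D (fun x => F (v x)) by case: HF => ->.
have F2 z : F z ^+ 2 <= cabs z ^+ 2.
  by rewrite cabsE; case: HF => ->; have := sqr_ge0 (ReC z); have := sqr_ge0 (ImC z); lra.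
have i1 : mu.-integrable D (EFin \o (fun x => 1 + cabs (v x) ^+ 2)).
  rewrite (_ : EFin \o _ = (EFin \o (fun=> 1%R)) \+ (fun x => (cabs (v x) ^+ 2)%:E))%E //.
  apply: integrableD => //; exact: bmr_integrable (bmr_cst _).
have i3 : mu.-integrable D (EFin \o (fun x => `|M| * (1 + cabs (v x) ^+ 2))).
  rewrite (_ : EFin \o _ = fun x => (`|M|%:E * (1 + cabs (v x) ^+ 2)%:E)%E) //.
  exact: integrableZl.
apply: (@le_integrable _ _ R mu D (measurable_itv _) _
   (EFin \o (fun x => `|M| * (1 + cabs (v x) ^+ 2)))) => //.
  by apply/measurable_EFinP; apply: measurable_funM.
move=> x Dx /=; rewrite lee_fin normrM mulrC.
have p : 0 <= 1 + cabs (v x) ^+ 2 by rewrite addr_ge0 ?sqr_ge0.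
rewrite [leRHS]ger0_norm ?mulr_ge0 // ler_pM //.
  by apply: le_trans (phiM x Dx) _; exact: ler_norm.
have := F2 (v x); rewrite -real_normK ?num_real // => h.
have := sqr_ge0 (`|F (v x)| - 1); nra.
Qed.

Lemma test_fun_C1 (phi : R -> R) a b : test_fun phi -> C1itv a b phi (derive1 phi).
Proof.
move=> [dphi cphi _].
have cont : continuous phi.
  by move=> x; apply/differentiable_continuous/derivable1_diffP.
split; first exact: continuous_subspaceT.
exists (derive1 phi); split; first exact: continuous_subspaceT.
by move=> x _; split=> //; apply: DeriveDef => //; rewrite derive1E.
Qed.

Lemma C1itv_bmr (v g : R -> R) : C1itv 0 1 v g -> bmr v /\ bmr g.
Proof.
have part : is_partition 1 1 (fun n => n%:R : R).
  by split=> // -[|j] //=; rewrite ltr01.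
move=> c1; have [] := piecewise_C1_01 part (_ : piecewise_C1 1 (fun n => n%:R) v g) => //.
by move=> [|j].
Qed.

Lemma test_fun_bmr (phi : R -> R) : test_fun phi -> bmr phi /\ bmr (derive1 phi).
Proof. by move=> t; apply: C1itv_bmr; exact: test_fun_C1. Qed.

Lemma ReC_mulR (z : R[i]) (a : R) : ReC (z * a%:C%C) = ReC z * a.
Proof. by rewrite !ReImE mulr0 subr0. Qed.
Lemma ImC_mulR (z : R[i]) (a : R) : ImC (z * a%:C%C) = ImC z * a.
Proof. by rewrite !ReImE mulr0 add0r. Qed.

Lemma weak_deriv_unique v w1 w2 : weak_deriv v w1 -> weak_deriv v w2 -> aeqD w1 w2.
Proof.
move=> [Lv L1 e1] [_ L2' e2].
have key (F : R[i] -> R) : F = @complex.Re R \/ F = @complex.Im R ->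
    {ae mu, forall x, D x -> F (w1 x) - F (w2 x) = 0}.
  move=> HF; apply: fundamental_lemma.
    have i1 := L2_integrable_test HF L1 (bmr_cst 1).
    have i2 := L2_integrable_test HF L2' (bmr_cst 1).
    have mulK u : (fun x : R => F (u x) * 1) = (fun x => F (u x)).
      by apply/funext => x; rewrite mulr1.
    move: i1 i2; rewrite !mulK => i1 i2.
    rewrite (_ : EFin \o _ =
      (EFin \o (fun x => F (w1 x))) \- (EFin \o (fun x => F (w2 x))))%E //.
    exact: integrableB.
  move=> phi tphi; have [bphi _] := test_fun_bmr tphi.
  under eq_Rintegral do rewrite mulrBl.
  rewrite RintegralB //; try exact: L2_integrable_test.
  have := e1 _ tphi; rewrite (e2 _ tphi) => /oppr_inj; rewrite /cint => e.
  apply/eqP; rewrite subr_eq0 eq_sym; apply/eqP; case: HF => HF; subst F.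
    move: (congr1 (@complex.Re R) e) => /=.
    by under eq_Rintegral do rewrite ReC_mulR;
       under [in RHS]eq_Rintegral do rewrite ReC_mulR.
  move: (congr1 (@complex.Im R) e) => /=.
  by under eq_Rintegral do rewrite ImC_mulR;
     under [in RHS]eq_Rintegral do rewrite ImC_mulR.
have := key _ (or_introl erefl); have := key _ (or_intror erefl).
apply: filterS2; first exact: (ae_filter_ringOfSetsType mu).
move=> x h1 h2 Dx; apply: complexP; apply/eqP; rewrite -subr_eq0; apply/eqP;
  [exact: h2|exact: h1].
Qed.

Lemma aeqD_sym u v : aeqD u v -> aeqD v u.
Proof.
apply: filterS; first exact: (ae_filter_ringOfSetsType mu).
by move=> x uv Dx; rewrite uv.
Qed.

Lemma eqD_aeqD u v : (forall x, D x -> u x = v x) -> aeqD u v.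
Proof. by move=> uv; apply: aeW. Qed.

Lemma Rintegral_ae (f h : R -> R) : measurable_fun D f -> measurable_fun D h ->
  {ae mu, forall x, D x -> f x = h x} ->
  \int[mu]_(x in D) f x = \int[mu]_(x in D) h x.
Proof.
move=> mf mh fh; congr fine; apply: ae_eq_integral => //.
- exact/measurable_EFinP.
- exact/measurable_EFinP.
- move: fh; apply: filterS; first exact: (ae_filter_ringOfSetsType mu).
  by move=> x /= fh Dx; rewrite fh.
Qed.

Lemma cmeasM u v : cmeas u -> cmeas v -> cmeas (fun x => u x * v x).
Proof.
move=> [ru iu] [rv iv]; split.
  apply: (eq_measurable_fun (fun x => ReC (u x) * ReC (v x) - ImC (u x) * ImC (v x))).
    by move=> x _; rewrite !ReImE.
  by apply: measurable_funB; apply: measurable_funM.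
apply: (eq_measurable_fun (fun x => ReC (u x) * ImC (v x) + ImC (u x) * ReC (v x))).
  by move=> x _; rewrite !ReImE.
by apply: measurable_funD; apply: measurable_funM.
Qed.

Lemma cmeas_conj u : cmeas u -> cmeas (fun x => (u x)^*%C).
Proof.
move=> [ru iu]; split.
  by apply: (eq_measurable_fun (fun x => ReC (u x))) => // x _; rewrite !ReImE.
apply: (eq_measurable_fun (fun x => - ImC (u x))); first by move=> x _; rewrite !ReImE.
exact: measurableT_comp.
Qed.

Lemma cint_ae u v : cmeas u -> cmeas v -> aeqD u v -> cint u = cint v.
Proof.
move=> [ru iu] [rv iv] uv; rewrite /cint; congr Complex; apply: Rintegral_ae => //;
  move: uv; (apply: filterS; first exact: (ae_filter_ringOfSetsType mu));
  by move=> x /= uv Dx; rewrite uv.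
Qed.

Lemma ip_ae u u' v v' : cmeas u -> cmeas u' -> cmeas v -> cmeas v' ->
  aeqD u u' -> aeqD v v' -> ip u v = ip u' v'.
Proof.
move=> mu1 mu2 mv1 mv2 uu vv; apply: cint_ae.
- by apply: cmeasM => //; exact: cmeas_conj.
- by apply: cmeasM => //; exact: cmeas_conj.
- move: uu vv; apply: filterS2; first exact: (ae_filter_ringOfSetsType mu).
  by move=> x uu vv Dx; rewrite uu // vv.
Qed.

Lemma L2norm_ae u u' : cmeas u -> cmeas u' -> aeqD u u' -> L2norm u = L2norm u'.
Proof. by move=> mu1 mu2 uu; rewrite /L2norm (ip_ae mu1 mu2 mu1 mu2 uu uu). Qed.

Lemma cmeas_real (f : R -> R) : measurable_fun D f -> cmeas (fun x => (f x)%:C%C).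
Proof. by move=> mf; split=> //=; exact: measurable_cst. Qed.

Lemma weak_deriv_ae v v' w : L2 v' -> aeqD v v' -> weak_deriv v w -> weak_deriv v' w.
Proof.
move=> Lv' vv' [Lv Lw e]; split=> // phi tphi; rewrite -e //.
have [_ [mphi _]] := test_fun_bmr tphi.
apply: cint_ae; try by apply: cmeasM; [exact: L2_cmeas|exact: cmeas_real].
move: vv'; apply: filterS; first exact: (ae_filter_ringOfSetsType mu).
by move=> x vv' Dx; rewrite vv'.
Qed.

Lemma wD_weak_deriv v g : weak_deriv v g -> weak_deriv v (wD v).
Proof.
by move=> vg; have := @xgetPex _ (fun=> 0) [set w | weak_deriv v w] (ex_intro _ g vg).
Qed.

Lemma wD_aeqD v g : weak_deriv v g -> aeqD (wD v) g.
Proof. by move=> vg; apply: weak_deriv_unique (wD_weak_deriv vg) vg. Qed.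

Lemma weak_deriv_cmeas v g : weak_deriv v g -> cmeas g.
Proof. by case=> _ Lg _; exact: L2_cmeas. Qed.

Lemma Bform_weak_deriv v g w k : weak_deriv v g -> weak_deriv w k ->
  Bform v w = ip g k.
Proof.
move=> vg wk; apply: ip_ae; try exact: wD_aeqD.
- exact: weak_deriv_cmeas (wD_weak_deriv vg).
- exact: weak_deriv_cmeas vg.
- exact: weak_deriv_cmeas (wD_weak_deriv wk).
- exact: weak_deriv_cmeas wk.
Qed.

Lemma H1semi_weak_deriv v g : weak_deriv v g -> H1semi v = L2norm g.
Proof.
move=> vg; apply: L2norm_ae; last exact: wD_aeqD.
- exact: weak_deriv_cmeas (wD_weak_deriv vg).
- exact: weak_deriv_cmeas vg.
Qed.

(** The derivative chosen by [wD] depends on the class of v only, since the set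
    of its weak derivatives does. *)
Lemma wD_ae v v' : L2 v -> L2 v' -> aeqD v v' -> wD v = wD v'.
Proof.
move=> Lv Lv' vv'; rewrite /wD; congr (xget _ _); apply/seteqP; split=> w /=.
  exact: weak_deriv_ae.
by apply: weak_deriv_ae => //; exact: aeqD_sym.
Qed.

(** A function with its successive weak derivatives; with it [Hnorm] can be
    evaluated, in spite of the arbitrary choices in [wD]. *)
Definition weak_chain (s : nat) (d : nat -> R -> R[i]) :=
  L2 (d 0%N) /\ forall l, (l < s)%N -> weak_deriv (d l) (d l.+1).

Lemma weak_chain_sobolev s d : weak_chain s d -> sobolev s (d 0%N).
Proof.
elim: s d => [|s IH] d [L0 wd]; first exact: L0.
exists (d 1%N); first exact: wd.
apply: (IH (fun l => d l.+1)); split; last by move=> l ls; exact: wd.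
by case: (wd 0%N isT).
Qed.

Lemma weak_chain_iter s d l : weak_chain s d -> (l <= s)%N ->
  L2 (iter l wD (d 0%N)) /\ aeqD (iter l wD (d 0%N)) (d l).
Proof.
move=> [L0 wd]; elim: l => [_|l IH ls]; first by split=> //; apply: aeW.
have [Li ai] := IH (ltnW ls); have wl := wd l ls.
have -> : iter l.+1 wD (d 0%N) = wD (d l).
  by rewrite iterS; apply: wD_ae => //; case: wl.
by split; [case: (wD_weak_deriv wl)|exact: wD_aeqD].
Qed.

Lemma Hnorm_weak_chain s d : weak_chain s d ->
  Hnorm s (d 0%N) = Num.sqrt (\sum_(l < s.+1) L2norm (d l) ^+ 2).
Proof.
move=> wc; congr Num.sqrt; apply: eq_bigr => l _; congr (_ ^+ 2).
have [Li ai] := weak_chain_iter wc (ltn_ord l : (l <= s)%N).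
apply: L2norm_ae ai; first exact: L2_cmeas.
case: wc => L0 wd; case: (nat_of_ord l) (ltn_ord l) => [|l'] h; first exact: L2_cmeas.
exact: weak_deriv_cmeas (wd l' h).
Qed.

Definition cpiecewise_C1 (M : nat) (p : nat -> R) v g :=
  piecewise_C1 M p (fun x => ReC (v x)) (fun x => ReC (g x)) /\
  piecewise_C1 M p (fun x => ImC (v x)) (fun x => ImC (g x)).

Section Piecewise.
Variables (M : nat) (p : nat -> R).
Hypothesis Hp : is_partition 1 M p.
Notation pC1 := (cpiecewise_C1 M p).

Lemma pC1_bm v g : pC1 v g -> bm v /\ bm g.
Proof.
by move=> [/(piecewise_C1_01 Hp)[? ? _] /(piecewise_C1_01 Hp)[? ? _]].
Qed.

Lemma pC1_ext v g v' g' : (forall x, v x = v' x) -> (forall x, g x = g' x) ->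
  pC1 v g -> pC1 v' g'.
Proof. by move=> /funext -> /funext ->. Qed.

Lemma pC1D v g w k : pC1 v g -> pC1 w k ->
  pC1 (fun x => v x + w x) (fun x => g x + k x).
Proof.
move=> [rv iv] [rw iw]; split=> j jM.
  have := C1itvD (rv j jM) (rw j jM).
  by congr C1itv; apply/funext => x; rewrite !ReImE.
have := C1itvD (iv j jM) (iw j jM).
by congr C1itv; apply/funext => x; rewrite !ReImE.
Qed.

Lemma C1itvN a b (v g : R -> R) : C1itv a b v g -> C1itv a b (fun x => - v x) (fun x => - g x).
Proof.
move=> vg; have := C1itvM (C1itv_cst a b (-1)) vg.
by congr C1itv; apply/funext => x; rewrite ?mul0r ?add0r mulN1r.
Qed.

Lemma pC1M v g w k : pC1 v g -> pC1 w k ->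
  pC1 (fun x => v x * w x) (fun x => g x * w x + v x * k x).
Proof.
move=> [rv iv] [rw iw]; split=> j jM.
  have := C1itvD (C1itvM (rv j jM) (rw j jM)) (C1itvN (C1itvM (iv j jM) (iw j jM))).
  by congr C1itv; apply/funext => x; rewrite !ReImE //; ring.
have := C1itvD (C1itvM (rv j jM) (iw j jM)) (C1itvM (iv j jM) (rw j jM)).
by congr C1itv; apply/funext => x; rewrite !ReImE //; ring.
Qed.

Lemma pC1_cst (c : R[i]) : pC1 (fun=> c) (fun=> 0).
Proof. by split=> j jM; exact: C1itv_cst. Qed.

Lemma pC1Z (c : R[i]) v g : pC1 v g -> pC1 (fun x => c * v x) (fun x => c * g x).
Proof.
move=> vg; apply: pC1_ext (pC1M (pC1_cst c) vg) => // x.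
by rewrite mul0r add0r.
Qed.

(** The product of two continuous, piecewise smooth functions is again such a
    function, so no jump terms appear at the nodes. *)
Lemma pC1_parts v g w k : pC1 v g -> pC1 w k ->
  rip g w + rip v k = rdot v w 1 - rdot v w 0.
Proof.
move=> vg wk; have [[rv iv] [rw iw]] := (vg, wk).
have [bv bg] := pC1_bm vg; have [bw bk] := pC1_bm wk.
have := piecewise_C1_01 Hp (fun j jM => C1itvD (C1itvM (rv j jM) (rw j jM))
  (C1itvM (iv j jM) (iw j jM))) => -[_ _ e].
rewrite -[RHS]e /rip -IintD; [|exact: bmr_rdot|exact: bmr_rdot].
by apply: eq_Iint => x _; rewrite /rdot; ring.
Qed.

Lemma pC1_test (phi : R -> R) : test_fun phi -> pC1 (fun x => (phi x)%:C%C) (fun x => (derive1 phi x)%:C%C).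
Proof.
move=> t; split=> j jM; first exact: test_fun_C1.
exact: C1itv_cst.
Qed.

Lemma pC1_weak_deriv v g : pC1 v g -> weak_deriv v g.
Proof.
move=> vg; have [bv bg] := pC1_bm vg.
split; [exact: bm_L2|exact: bm_L2|move=> phi tphi].
have tp := pC1_test tphi.
have part (v' g' : R -> R[i]) : pC1 v' g' ->
    rip v' (fun x => (derive1 phi x)%:C%C) = - rip g' (fun x => (phi x)%:C%C).
  move=> vg'; have := pC1_parts vg' tp; case: tphi => _ _ [a [b [a0 b1 phi0]]].
  have p0 : phi 0 = 0 by apply: phi0; rewrite in_itv /= leNgt a0.
  have p1 : phi 1 = 0 by apply: phi0; rewrite in_itv /= [1 <= b]leNgt b1 andbF.
  by rewrite /rdot /= p0 p1 !mulr0 => e; lra.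
apply: complexP; rewrite !ReImE /cint /=.
  have := part _ _ vg; rewrite /rip => e.
  rewrite -[LHS]/(Iint _) -[in RHS]/(Iint _).
  rewrite (eq_Iint (g := rdot v (fun x => (derive1 phi x)%:C%C))) => [|x _]; last first.
    by rewrite ReC_mulR /rdot /= mulr0 addr0.
  rewrite e; congr (- _); apply: eq_Iint => x _.
  by rewrite ReC_mulR /rdot /= mulr0 addr0.
have [c c0 c1] : exists2 c : R[i], ReC c = 0 & ImC c = -1 by exists (Complex 0 (-1)).
have := part _ _ (pC1Z c vg); rewrite /rip => e.
rewrite -[LHS]/(Iint _) -[in RHS]/(Iint _).
rewrite (eq_Iint (g := rdot (fun x => c * v x) (fun x => (derive1 phi x)%:C%C))) => [|x _]; last first.
  by rewrite ImC_mulR /rdot !ReImE c0 c1; ring.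
rewrite e; congr (- _); apply: eq_Iint => x _.
by rewrite ImC_mulR /rdot !ReImE c0 c1; ring.
Qed.

End Piecewise.
End WeakDerivative.

(** * Function-derivative pairs and their quadratic forms *)

Section Multiplication.
Context {R : realType}.
Implicit Types (f u v : bmfun R).

Lemma l2_mul_le f v (B : R) : 0 <= B ->
  (forall x, x \in `]0, 1[ -> cabs (f x) <= B) ->
  nrm l2 (bmfun_mul f v) <= B * nrm l2 v.
Proof.
move=> B0 fB.
rewrite -(ler_pXn2r (n := 2)) ?nnegrE ?mulr_ge0 ?nrm_ge0 //.
rewrite exprMn !(sqr_nrm (@l2_semi_inner R)).
rewrite /l2 /rip -IintZ; last exact: bmr_rdot (bmfun_bm _) (bmfun_bm _).
apply: le_Iint.
- exact: bmr_rdot (bmfun_bm _) (bmfun_bm _).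
- by apply: bmrM; [exact: bmr_cst|exact: bmr_rdot (bmfun_bm _) (bmfun_bm _)].
move=> x Dx; have h := fB x Dx.
have -> : rdot (bmfun_mul f v) (bmfun_mul f v) x = cabs (f x) ^+ 2 * rdot v v x.
  by rewrite cabsE /rdot /= !ReImE; ring.
rewrite ler_wpM2r //; first by rewrite /rdot -!expr2 addr_ge0 ?sqr_ge0.
by rewrite lerXn2r ?nnegrE ?cabs_ge0.
Qed.

Lemma l2_bmfun_cst (z : R[i]) : nrm l2 (bmfun_cst z) = cabs z.
Proof.
rewrite /nrm /l2 /rip (eq_Iint (g := fun=> cabs z ^+ 2)) => [|x _].
  by rewrite Iint_cst sqrtr_sqr ger0_norm ?cabs_ge0.
by rewrite cabsE /rdot /= !expr2.
Qed.

Lemma l2_mulC_adj f u v : l2 (bmfun_mul f u) v =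
  l2 u (bmfun_mul (BMFun (bm_conj (bmfun_bm f))) v).
Proof. by apply: eq_Iint => x _; rewrite /rdot /= !ReImE; ring. Qed.

Lemma cabsM (z w : R[i]) : cabs (z * w) = cabs z * cabs w.
Proof.
apply/eqP; rewrite -(eqrXn2 (n := 2)) ?mulr_ge0 ?cabs_ge0 //.
by rewrite exprMn !cabsE !ReImE; apply/eqP; ring.
Qed.

End Multiplication.

Section Pairs.
Context {R : realType}.
Notation V := (bmfun R * bmfun R)%type.
Implicit Types (p q : V).

Definition fm p q : R := l2 p.1 q.1.
Definition fb p q : R := l2 p.2 q.2.
Definition fe p q : R := rdot p.1 q.1 1.

Lemma fm_semi_inner : semi_inner fm.
Proof.
have [h1 h2 h3] := @l2_semi_inner R.
by split=> [u v|a u v w|u]; [exact: h1|exact: h2|exact: h3].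
Qed.

Lemma fb_semi_inner : semi_inner fb.
Proof.
have [h1 h2 h3] := @l2_semi_inner R.
by split=> [u v|a u v w|u]; [exact: h1|exact: h2|exact: h3].
Qed.

Lemma fe_semi_inner : semi_inner fe.
Proof.
split=> [u v|a u v w|u]; rewrite /fe /rdot /=; first by ring.
  by rewrite !ReImE; ring.
by rewrite -!expr2 addr_ge0 ?sqr_ge0.
Qed.

Lemma nrm_fe p : nrm fe p = cabs (p.1 1).
Proof.
apply/eqP; rewrite -(eqrXn2 (n := 2)) ?nrm_ge0 ?cabs_ge0 //.
by rewrite (sqr_nrm fe_semi_inner) cabsE /fe /rdot !expr2.
Qed.

Lemma nrm_fm p : nrm fm p = nrm l2 p.1. Proof. by []. Qed.
Lemma nrm_fb p : nrm fb p = nrm l2 p.2. Proof. by []. Qed.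

(** The second component is the Leibniz rule. *)
Definition pmul (f f' : bmfun R) p : V :=
  (bmfun_mul f p.1, bmfun_mul f' p.1 + bmfun_mul f p.2).

Definition cmul (z : R[i]) p : V :=
  (bmfun_mul (bmfun_cst z) p.1, bmfun_mul (bmfun_cst z) p.2).

Definition rot := cmul 'i%C.

Lemma pmulD f f' p q : pmul f f' (p + q) = pmul f f' p + pmul f f' q.
Proof.
by congr pair; apply: bmfun_ext => x /=; ring.
Qed.

Lemma cmulD z p q : cmul z (p + q) = cmul z p + cmul z q.
Proof. by congr pair; apply: bmfun_ext => x /=; ring. Qed.

Lemma cmulZ z a p : cmul z (a *: p) = a *: cmul z p.
Proof. by congr pair; apply: bmfun_ext => x /=; ring. Qed.

Lemma rotation_fm : rotation rot fm.
Proof.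
by split=> [u v|u]; [apply: eq_Iint => x _|rewrite -[RHS]Iint_cst; apply: eq_Iint => x _];
  rewrite /rdot /= !ReImE; ring.
Qed.

Lemma rotation_fb : rotation rot fb.
Proof.
by split=> [u v|u]; [apply: eq_Iint => x _|rewrite -[RHS]Iint_cst; apply: eq_Iint => x _];
  rewrite /rdot /= !ReImE; ring.
Qed.

Lemma rotation_fe : rotation rot fe.
Proof. by split=> [u v|u]; rewrite /fe /rdot /= !ReImE; ring. Qed.

Lemma fe_cmul_le z p : nrm fe (cmul z p) <= cabs z * nrm fe p.
Proof. by rewrite !nrm_fe /= cabsM. Qed.

Lemma fm_pmul_le (f f' : bmfun R) p (B : R) : 0 <= B ->
  (forall x, x \in `]0, 1[ -> cabs (f x) <= B) ->
  nrm fm (pmul f f' p) <= B * nrm fm p.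
Proof. by move=> B0 fB; exact: l2_mul_le. Qed.

Lemma fm_pmulB_le (f f' g g' : bmfun R) p (B : R) : 0 <= B ->
  (forall x, x \in `]0, 1[ -> cabs (f x - g x) <= B) ->
  nrm fm (pmul f f' p - pmul g g' p) <= B * nrm fm p.
Proof.
move=> B0 fB; rewrite nrm_fm.
have -> : (pmul f f' p - pmul g g' p).1 = bmfun_mul (f - g) p.1.
  by apply: bmfun_ext => x /=; ring.
exact: l2_mul_le.
Qed.

Lemma fb_pmul_le (f f' : bmfun R) p (B B' : R) : 0 <= B -> 0 <= B' ->
  (forall x, x \in `]0, 1[ -> cabs (f x) <= B) ->
  (forall x, x \in `]0, 1[ -> cabs (f' x) <= B') ->
  nrm fb (pmul f f' p) <= B' * nrm fm p + B * nrm fb p.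
Proof.
move=> B0 B'0 fB fB'; rewrite nrm_fb /=.
apply: le_trans (nrmD (@l2_semi_inner R) _ _) _.
by apply: lerD; exact: l2_mul_le.
Qed.

Section Admissible.
Variables (M : nat) (pt : nat -> R).
Hypothesis Hp : is_partition 1 M pt.
Notation pC1 := (cpiecewise_C1 M pt).

(** The pairs for which the Poincare inequalities hold. *)
Definition admissible p := pC1 p.1 p.2 /\ p.1 0 = 0.

Lemma admissible_lin a p q : admissible p -> admissible q -> admissible (a *: p + q).
Proof.
move=> [pp p0] [pq q0]; split; last by rewrite /= p0 q0 mulr0 addr0.
exact: (pC1D (pC1Z a%:C%C pp) pq).
Qed.

Lemma admissible_pmul (f f' : bmfun R) p : pC1 f f' -> admissible p ->
  admissible (pmul f f' p).
Proof.
by move=> ff [pp p0]; split; [exact: (pC1M ff pp)|rewrite /= p0 mulr0].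
Qed.

(** p(1) is the integral of p' over D. *)
Lemma fe_le_fb p : admissible p -> nrm fe p <= nrm fb p.
Proof.
move=> [pp p0]; have := pC1_parts Hp pp (pC1_cst M pt (p.1 1)).
have r0 : rdot p.1 (fun=> p.1 1) 0 = 0 by rewrite /rdot p0 !ReImE !mul0r addr0.
have i0 : rip p.1 (fun=> 0) = 0.
  by rewrite /rip -[RHS]Iint_cst; apply: eq_Iint => x _; rewrite /rdot !ReImE; ring.
rewrite r0 subr0 i0 addr0 => e.
have e2 : nrm fe p ^+ 2 = l2 p.2 (bmfun_cst (p.1 1)).
  by rewrite (sqr_nrm fe_semi_inner) [RHS]e.
have := sip_le (@l2_semi_inner R) p.2 (bmfun_cst (p.1 1)).
rewrite l2_bmfun_cst -nrm_fe -e2 expr2.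
have := nrm_ge0 fe p; rewrite le_eqVlt => /predU1P[<- _|e0]; last by rewrite ler_pM2r.
exact: nrm_ge0.
Qed.

Lemma pC1_weight (c : R) : pC1 (fun x => (c - x)%:C%C) (fun=> -1).
Proof.
split=> j jM; last first.
  rewrite (_ : (fun=> ImC (-1 : R[i])) = (fun=> 0)); first exact: C1itv_cst.
  by apply/funext => x; rewrite !ReImE oppr0.
split.
  by apply: continuous_subspaceT => x; apply: cvgB => //; exact: cvg_cst.
exists (fun=> -1); split; first by move=> x; exact: cvg_cst.
move=> x _; rewrite !ReImE; split=> //.
have : is_derive x 1 (fun x : R => c - x) (0 - 1) by exact: is_deriveB.
by rewrite sub0r.
Qed.

(** Integration by parts against the weight 1 - x, which vanishes at 1, while p
    vanishes at 0: the integral of |p|^2 is twice the real part of the integral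
    of (1 - x) p conj(p'). *)
Lemma fm_le_fb p : admissible p -> nrm fm p <= 2 * nrm fb p.
Proof.
move=> [pp p0]; have pw := pC1_weight 1.
have [bw bw'] := pC1_bm Hp pw; pose w := BMFun bw.
have := pC1_parts Hp pp (pC1M pw pp).
set k := (X in rip p.1 X); set q := (X in rip p.2 X).
have r0 : rdot p.1 q 0 = 0 by rewrite /rdot p0 !ReImE !mul0r addr0.
have r1 : rdot p.1 q 1 = 0 by rewrite /rdot /q subrr !ReImE; ring.
rewrite r0 r1 subrr => e.
have e2 : nrm fm p ^+ 2 = 2 * l2 p.2 (bmfun_mul w p.1).
  have e3 : rip p.1 k
      = l2 p.2 (bmfun_mul w p.1) - fm p p.
    rewrite -IintB; [|exact: bmr_rdot (bmfun_bm _) (bmfun_bm _)..].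
    by apply: eq_Iint => x _; rewrite /rdot /k /= mulN1r !ReImE; ring.
  move: e; rewrite e3 (sqr_nrm fm_semi_inner) /fm /l2 /=; lra.
have wle : nrm l2 (bmfun_mul w p.1) <= 1 * nrm l2 p.1.
  apply: l2_mul_le => // x; rewrite in_itv /= => /andP[x0 x1].
  rewrite -(ler_pXn2r (n := 2)) ?nnegrE ?cabs_ge0 // cabsE !ReImE expr0n addr0.
  by rewrite lerXn2r ?nnegrE //; lra.
rewrite mul1r in wle.
have := sip_le (@l2_semi_inner R) p.2 (bmfun_mul w p.1) => cs.
have h : nrm fm p * nrm fm p <= 2 * nrm fb p * nrm fm p.
  rewrite -expr2 e2 -mulrA ler_wpM2l //; apply: le_trans cs _.
  by rewrite ler_wpM2l ?nrm_ge0.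
move: h; have := nrm_ge0 fm p; rewrite le_eqVlt => /predU1P[<- _|e0].
  by rewrite mulr_ge0 ?nrm_ge0.
by rewrite ler_pM2r.
Qed.

End Admissible.
End Pairs.

(** * Finite elements: projections and duality *)

Section Polynomials.
Context {R : realType}.

Lemma poly_parts (q : {poly R[i]}) : exists pr pi : {poly R},
  forall x : R, ReC q.[x%:C%C] = pr.[x] /\ ImC q.[x%:C%C] = pi.[x].
Proof.
elim/poly_ind: q => [|q c [pr [pi IH]]].
  by exists 0, 0 => x; rewrite !horner0 !ReImE.
exists (pr * 'X + (ReC c)%:P), (pi * 'X + (ImC c)%:P) => x.
have [Hr Hi] := IH x.
by rewrite !hornerMXaddC !ReImE Hr Hi; split; ring.
Qed.

Lemma C1itv_poly a b (v g : R -> R) (q : {poly R}) :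
  (forall x, x \in `[a, b] -> v x = q.[x]) ->
  (forall x, x \in `]a, b[ -> g x = q^`().[x]) -> C1itv a b v g.
Proof.
move=> vq gq; split.
  apply: (@subspace_eq_continuous _ _ _ (horner q)).
    by move=> x /set_mem xab; apply/esym/vq.
  by apply: continuous_subspaceT => x; exact: continuous_horner.
exists (horner q^`()); split.
  by apply: continuous_subspaceT => x; exact: continuous_horner.
move=> x xab; rewrite gq //; split=> //.
apply: near_eq_is_derive (is_derive_poly q x).
have : \near x, x \in `]a, b[ by exact: near_in_itvoo.
apply: filterS => y yab; rewrite vq //.
exact: (subset_itv_oo_cc yab).
Qed.

Definition derive_parts (v : R -> R[i]) (x : R) : R[i] :=
  Complex (derive1 (fun y => ReC (v y)) x) (derive1 (fun y => ImC (v y)) x).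

Lemma piecewise_poly_C1 r M p (v : R -> R[i]) : piecewise_poly r M p v ->
  cpiecewise_C1 M p v (derive_parts v).
Proof.
move=> pp.
have key j : (j < M)%N -> exists pr pi : {poly R}, forall x, x \in `[p j, p j.+1] ->
    ReC (v x) = pr.[x] /\ ImC (v x) = pi.[x].
  move=> /pp[q [_ vq]]; have [pr [pi H]] := poly_parts q.
  by exists pr, pi => x /vq ->.
have der a b (f : R -> R) (q : {poly R}) : (forall x, x \in `[a, b] -> f x = q.[x]) ->
    forall x, x \in `]a, b[ -> derive1 f x = q^`().[x].
  move=> fq x xab.
  have : is_derive x 1 f q^`().[x].
    apply: near_eq_is_derive (is_derive_poly q x).
    have : \near x, x \in `]a, b[ by exact: near_in_itvoo.
    by apply: filterS => y yab; rewrite fq //; exact: (subset_itv_oo_cc yab).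
  by move=> [_ <-]; rewrite derive1E.
split=> j jM; have [pr [pi H]] := key j jM.
  have hr x : x \in `[p j, p j.+1] -> ReC (v x) = pr.[x] by move=> /H[].
  by apply: (C1itv_poly hr) => x /(der _ _ _ _ hr).
have hi x : x \in `[p j, p j.+1] -> ImC (v x) = pi.[x] by move=> /H[].
by apply: (C1itv_poly hi) => x /(der _ _ _ _ hi).
Qed.

(** Needed to solve the dual problem of the elliptic projection explicitly. *)
Lemma primitive_exists (f : R -> R) : {within `[0, 1], continuous f} ->
  exists2 F : R -> R, C1itv 0 1 F f & F 0 = 0.
Proof.
move=> cf; have intf := bmi_integrable (bmi_continuous cf).
pose F x := \int[@lebesgue_measure R]_(t in [set` `[0, x]]) f t.
exists F; last by rewrite /F set_itv1 Rintegral_set1.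
split; first exact: (parameterized_integral_continuous ler01 intf).
exists f; split=> // x x01; split=> //.
have [/(_ x x01) cx _ _] := (continuous_within_itvP f (@ltr01 R)).1 cf.
move: (x01); rewrite in_itv /= => /andP[x0 x1].
have [dF F'] := continuous_FTC1_closed x1 intf x0 cx.
by apply: DeriveDef; [exact: dF|rewrite -derive1E; exact: F'].
Qed.

End Polynomials.

Section FiniteElementSpace.
Context {R : realType}.
Notation V := (bmfun R * bmfun R)%type.
Notation D := (`]0%R, 1%R[%classic : set R).
Variables (r : nat) (h : R) (Sh : set (R -> R[i])) (M : nat) (pt : nat -> R).
Hypotheses (Sh_sub : Defs.subspace Sh) (Sh_fin : finite_dim Sh).
Hypothesis Sh_H1 : Sh `<=` sobolev0 1.
Hypothesis Hp : is_partition 1 M pt.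
Hypothesis Sh_poly : Sh `<=` piecewise_poly r M pt.
Hypothesis Sh_id : exists2 v, Sh v & forall x, x \in `[0, 1] -> v x = x%:C%C.
Notation pC1 := (cpiecewise_C1 M pt).
Notation adm := (admissible M pt).

Implicit Types (p q chi : V).

Let Sh_zero : Sh (fun=> 0). Proof. by case: Sh_sub. Qed.
Let Sh_lin (c : R[i]) v w : Sh v -> Sh w -> Sh (fun x => c * v x + w x).
Proof. by have [_ Sl] := Sh_sub; apply: Sl. Qed.

(** The second component is determined by the first up to a null set, by
    [pair_eq0]. Carrying it makes the H^1 seminorm a quadratic form on V. *)
Definition fe_pair p := Sh p.1 /\ pC1 p.1 p.2.

Lemma fe_pair_adm p : fe_pair p -> adm p.
Proof. by move=> [Sp pp]; split=> //; have [] := Sh_H1 Sp. Qed.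

Lemma fe_pair_exists v : Sh v -> exists2 p, fe_pair p & (p.1 : R -> R[i]) = v.
Proof.
move=> Sv; have pv := piecewise_poly_C1 (Sh_poly Sv).
have [bv bg] := pC1_bm Hp pv.
by exists (BMFun bv, BMFun bg) => //; split.
Qed.

Lemma fe_pair_lin a p q : fe_pair p -> fe_pair q -> fe_pair (a *: p + q).
Proof.
move=> [Sp pp] [Sq pq]; split; last exact: (pC1D (pC1Z a%:C%C pp) pq).
exact: (Sh_lin a%:C%C Sp Sq).
Qed.

Lemma fe_pair0 : fe_pair 0.
Proof. by split; [exact: Sh_zero|exact: pC1_cst]. Qed.

Lemma fe_pairB p q : fe_pair p -> fe_pair q -> fe_pair (p - q).
Proof. by move=> Sp Sq; rewrite addrC -scaleN1r; exact: fe_pair_lin. Qed.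

Lemma fe_pair_cmul z p : fe_pair p -> fe_pair (cmul z p).
Proof.
move=> [Sp pp]; split; last exact: (pC1Z z pp).
have := Sh_lin z Sp Sh_zero.
by congr Sh; apply/funext => x; rewrite addr0.
Qed.

Lemma L2norm_bmfun (f : bmfun R) : L2norm f = nrm l2 f.
Proof. by rewrite L2normE. Qed.

Lemma pC1_eq0 (v g : R -> R[i]) : pC1 v g -> (forall x, D x -> v x = 0) -> rip g g = 0.
Proof.
move=> vg v0; have wd := pC1_weak_deriv Hp vg.
have [bv bg] := pC1_bm Hp vg.
have w0 : weak_deriv (fun=> 0 : R[i]) g.
  apply: weak_deriv_ae wd; first exact: bm_L2 (bm_cst 0).
  exact: eqD_aeqD.
have z0 := weak_deriv_unique w0 (pC1_weak_deriv Hp (pC1_cst M pt 0)).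
have c0 : cmeas (fun=> 0 : R[i]) := bm_cmeas (bm_cst 0).
have cg := bm_cmeas bg.
rewrite -Re_ip (ip_ae cg c0 cg c0 z0 z0) Re_ip.
by rewrite /rip -[RHS]Iint_cst; apply: eq_Iint => x _; rewrite /rdot !ReImE; ring.
Qed.

Lemma pair_eq0 p : pC1 p.1 p.2 -> (forall x, D x -> p.1 x = 0) ->
  nrm fm p = 0 /\ nrm fb p = 0.
Proof.
move=> pp p0; rewrite /nrm /fb /l2 (pC1_eq0 pp p0) sqrtr0; split=> //.
rewrite /fm /l2 (_ : rip _ _ = 0) ?sqrtr0 //.
by rewrite /rip -[RHS]Iint_cst; apply: eq_Iint => x Dx; rewrite /rdot p0 // !ReImE; ring.
Qed.

(** A basis over the complex numbers has to be completed by its multiples with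
    the imaginary unit to span over the reals. *)
Lemma fe_pair_spanned : exists2 e : seq V, (forall x, x \in e -> fe_pair x) &
  forall p, fe_pair p -> exists2 q, lspan e q & nrm fm (p - q) = 0 /\ nrm fb (p - q) = 0.
Proof.
have [m [e [Se span]]] := Sh_fin.
have /choice[E HE] : forall i, exists p, fe_pair p /\ (p.1 : R -> R[i]) = e i.
  by move=> i; have [p Sp pe] := fe_pair_exists (Se i); exists p.
pose L := [seq E i | i <- enum 'I_m] ++ [seq rot (E i) | i <- enum 'I_m].
exists L.
  move=> x; rewrite mem_cat => /orP[|] /mapP[i _ ->]; first by case: (HE i).
  by apply: fe_pair_cmul; case: (HE i).
move=> p [Sp pp]; have [c pc] := span _ Sp.
pose q := \sum_i (ReC (c i) *: E i + ImC (c i) *: rot (E i)).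
have spanq (S : V -> Prop) : S 0 -> (forall a u v, S u -> S v -> S (a *: u + v)) ->
    (forall x, x \in L -> S x) -> S q.
  move=> S0 Sl SL; apply: big_ind => // [u v Su Sv|i _].
    by rewrite -[u]scale1r; apply: (Sl).
  apply: (Sl); first by apply: SL; rewrite mem_cat; apply/orP; left; apply/mapP; exists i; rewrite ?mem_enum.
  rewrite -[X in S X]addr0; apply: (Sl) => //.
  by apply: SL; rewrite mem_cat; apply/orP; right; apply/mapP; exists i; rewrite ?mem_enum.
exists q; first exact: spanq.
have Sq : fe_pair q.
  apply: spanq => //; first exact: fe_pair0.
    by move=> a u v; exact: fe_pair_lin.
  move=> x; rewrite mem_cat => /orP[|] /mapP[i _ ->]; first by case: (HE i).
  by apply: fe_pair_cmul; case: (HE i).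
apply: pair_eq0; first by case: (fe_pairB (conj Sp pp) Sq).
move=> x Dx; rewrite /= pc; last exact: (subset_itv_oo_cc Dx).
suff -> : q.1 x = \sum_i c i * e i x by rewrite subrr.
have -> : q.1 x = \sum_i ((ReC (c i) *: E i + ImC (c i) *: rot (E i)).1 x).
  by apply: (big_morph (fun p : V => p.1 x)).
apply: eq_bigr => i _; rewrite /= (proj2 (HE i)); apply: complexP; rewrite !ReImE; ring.
Qed.

Lemma fe_projection (f : V -> V -> R) u : (f = fm \/ f = fb) ->
  exists2 q, fe_pair q & forall chi, fe_pair chi -> f (u - q) chi = 0.
Proof.
move=> Hf; have [e Se span] := fe_pair_spanned.
have sf : semi_inner f by case: Hf => ->; [exact: fm_semi_inner|exact: fb_semi_inner].
apply: (@orthogonal_projection_exists R V f sf fe_pair e u) => //.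
- exact: fe_pair0.
- by move=> a v w; exact: fe_pair_lin.
- by move=> p /span[q eq [q1 q2]]; exists q => //; case: Hf => ->.
Qed.

(** The complex multiples of x |-> x are test functions, and the form fb of p
    with z x is the real scalar product of p(1) and z, because p(0) = 0. *)
Lemma elliptic_error_at_1 p : adm p -> (forall chi, fe_pair chi -> fb p chi = 0) ->
  p.1 1 = 0.
Proof.
move=> [pp p0] orth; have [v Sv vid] := Sh_id.
have [X SX Xv] := fe_pair_exists Sv.
have pid : pC1 (fun x => - (0 - x)%:C%C) (fun=> - -1).
  have := pC1Z (-1) (pC1_weight M pt 0).
  by apply: pC1_ext => x; rewrite mulN1r.
have X2 : nrm l2 (X.2 - bmfun_cst 1) = 0.
  have pX : pC1 (fun x => X.1 x + -1 * - (0 - x)%:C%C) (fun x => X.2 x + -1 * - -1).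
    by have [_ pX1] := SX; exact: (pC1D pX1 (pC1Z (-1) pid)).
  have -> : nrm l2 (X.2 - bmfun_cst 1) =
      Num.sqrt (rip (fun x => X.2 x + -1 * - -1) (fun x => X.2 x + -1 * - -1)).
    congr Num.sqrt; apply: eq_Iint => x _.
    by rewrite /rdot /= opprK mulr1.
  rewrite (pC1_eq0 pX) ?sqrtr0 // => x Dx.
  rewrite Xv vid; last exact: (subset_itv_oo_cc Dx).
  by rewrite sub0r rmorphN opprK mulN1r subrr.
have key z : fb p (cmul z X) = rdot p.1 (fun=> z) 1.
  have := pC1_parts Hp pp (pC1_cst M pt z).
  have r0 : rdot p.1 (fun=> z) 0 = 0 by rewrite /rdot p0 !ReImE !mul0r addr0.
  have i0 : rip p.1 (fun=> 0) = 0.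
    by rewrite /rip -[RHS]Iint_cst; apply: eq_Iint => x _; rewrite /rdot !ReImE; ring.
  rewrite r0 i0 subr0 addr0 => <-.
  have zE : bmfun_mul (bmfun_cst z) X.2 = bmfun_cst z
       + bmfun_mul (bmfun_cst z) (X.2 - bmfun_cst 1).
    by apply: bmfun_ext => x /=; ring.
  rewrite [fb _ _](_ : _ = l2 p.2 (bmfun_cst z)
       + l2 p.2 (bmfun_mul (bmfun_cst z) (X.2 - bmfun_cst 1))); last first.
    by rewrite -(sipDr (@l2_semi_inner R)) -zE.
  rewrite [X in _ + X](_ : _ = 0) ?addr0 //.
  rewrite (sipC (@l2_semi_inner R)) l2_mulC_adj.
  exact: (nrm_eq0_sip (@l2_semi_inner R)).
have h1 := key 1; have h2 := key 'i%C.
move: h1 h2; rewrite !orth; try exact: fe_pair_cmul.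
rewrite /rdot !ReImE => h1 h2; apply: complexP; rewrite !ReImE; lra.
Qed.


Variables (c ci : R).
Hypotheses (c_ge0 : 0 <= c) (ci_ge0 : 0 <= ci) (h_gt0 : 0 < h).
Hypothesis Happ : forall s : nat, (s <= r)%N -> forall v, sobolev0 s.+1 v ->
  inf [set L2norm (v \- chi) + h * Hnorm 1 (v \- chi) | chi in Sh]
    <= c * h ^+ s.+1 * Hnorm s.+1 v.
Hypothesis Hinv : forall phi, Sh phi -> H1semi phi <= ci * h^-1 * L2norm phi.

Definition chain_norm (s : nat) (d : nat -> R -> R[i]) : R :=
  Num.sqrt (\sum_(l < s.+1) L2norm (d l) ^+ 2).

Lemma fe_inverse p : fe_pair p -> nrm fb p <= ci * h^-1 * nrm fm p.
Proof.
move=> [Sp pp]; have := Hinv Sp.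
by rewrite (H1semi_weak_deriv (pC1_weak_deriv Hp pp)) !L2norm_bmfun.
Qed.

(** The infimum is only approached, hence the arbitrary eta. *)
Lemma approximation_pair s d p eta : (s <= r)%N -> weak_chain s.+1 d ->
  d 0%N = p.1 -> adm p -> ccontinuous_on (`[0, 1] : set R) p.1 -> 0 < eta ->
  exists2 chi, fe_pair chi &
    nrm fm (p - chi) + h * nrm fb (p - chi) <= c * h ^+ s.+1 * chain_norm s.+1 d + eta.
Proof.
move=> sr wc d0 [pp p0] cp eta0.
have sob : sobolev0 s.+1 p.1 by split=> //; rewrite -d0; exact: weak_chain_sobolev.
pose E := [set L2norm (p.1 \- chi) + h * Hnorm 1 (p.1 \- chi) | chi in Sh].
have hE : has_inf E.
  split; first by exists (L2norm (p.1 \- (fun=> 0)) + h * Hnorm 1 (p.1 \- (fun=> 0)));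
    exists (fun=> 0).
  exists 0 => _ [chi _ <-]; rewrite addr_ge0 ?sqrtr_ge0 // mulr_ge0 ?sqrtr_ge0 //.
  exact: ltW.
have [_ [v Sv <-] lt] := inf_adherent eta0 hE.
have [X SX Xv] := fe_pair_exists Sv; exists X => //; rewrite -Xv in lt.
have pX : pC1 (p - X).1 (p - X).2.
  have [_ pX1] := SX; have := pC1D pp (pC1Z (-1) pX1).
  by apply: pC1_ext => x; rewrite mulN1r.
pose d' (l : nat) : R -> R[i] := if l is 0%N then (p - X).1 else (p - X).2.
have wc' : weak_chain 1 d'.
  have wd := pC1_weak_deriv Hp pX.
  by split; [case: wd|case].
have HN : Hnorm 1 (p.1 \- X.1) = Num.sqrt (nrm fm (p - X) ^+ 2 + nrm fb (p - X) ^+ 2).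
  rewrite -[_ \- _]/(d' 0%N) (Hnorm_weak_chain wc') !big_ord_recr big_ord0 /= add0r.
  by rewrite !L2normE.
have nb : nrm fb (p - X) <= Hnorm 1 (p.1 \- X.1).
  rewrite HN -[leLHS]ger0_norm ?nrm_ge0 // -sqrtr_sqr; apply: ler_wsqrtr.
  by rewrite lerDr sqr_ge0.
have := Happ sr sob; rewrite -/E -d0 (Hnorm_weak_chain wc) -/(chain_norm s.+1 d) => le.
apply: le_trans (_ : L2norm (p.1 \- X.1) + h * Hnorm 1 (p.1 \- X.1) <= _).
  rewrite lerD //; last by rewrite ler_pM2l.
  by rewrite -[_ \- _]/((p - X).1 : R -> R[i]) L2norm_bmfun.
by apply: ltW; apply: lt_le_trans lt _; rewrite lerD2r.
Qed.

Lemma fb_best_approximation (v w : V) chi : fe_pair w -> fe_pair chi ->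
  (forall chi, fe_pair chi -> fb (v - w) chi = 0) -> nrm fb (v - w) <= nrm fb (v - chi).
Proof.
move=> Sw Sc orth.
have h0 : nrm fb (v - w) * nrm fb (v - w) <= nrm fb (v - w) * nrm fb (v - chi).
  rewrite -expr2 (sqr_nrm fb_semi_inner).
  have -> : fb (v - w) (v - w) = fb (v - w) (v - chi).
    have -> : v - chi = (v - w) + (w - chi) by rewrite addrA subrK.
    by rewrite [RHS](sipDr fb_semi_inner) (orth (w - chi)) ?addr0 //; exact: fe_pairB.
  exact: sip_le fb_semi_inner _ _.
have := nrm_ge0 fb (v - w); rewrite le_eqVlt => /predU1P[<-|e0]; first exact: nrm_ge0.
by move: h0; rewrite ler_pM2l.
Qed.

Lemma elliptic_projection_H1 s d (v w : V) : (s <= r)%N -> weak_chain s.+1 d ->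
  d 0%N = v.1 -> adm v -> ccontinuous_on (`[0, 1] : set R) v.1 -> fe_pair w ->
  (forall chi, fe_pair chi -> fb (v - w) chi = 0) ->
  nrm fb (v - w) <= c * h ^+ s * chain_norm s.+1 d.
Proof.
move=> sr wc d0 av cv Sw orth; rewrite -(ler_pM2l h_gt0).
apply/ler_addgt0Pr => eta eta0.
have [chi Sc le] := approximation_pair sr wc d0 av cv eta0.
have := fb_best_approximation Sw Sc orth; rewrite -(ler_pM2l h_gt0) => /le_trans; apply.
have -> : h * (c * h ^+ s * chain_norm s.+1 d) = c * h ^+ s.+1 * chain_norm s.+1 d.
  by rewrite exprS; ring.
by apply: le_trans le; rewrite lerDr nrm_ge0.
Qed.

(** The dual problem - psi'' = rho, psi(0) = 0, psi'(1) = 0 is solved by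
    integrating twice, for real and imaginary parts separately. *)
Lemma dual_problem (rho : bmfun R) : ccontinuous_on (`[0, 1] : set R) rho ->
  exists psi : V, [/\ pC1 psi.1 psi.2, psi.1 0 = 0, psi.2 1 = 0,
    ccontinuous_on (`[0, 1] : set R) psi.1 & pC1 psi.2 (fun x => - rho x)].
Proof.
move=> [cr cim].
have sub f g : C1itv 0 1 f g -> piecewise_C1 M pt f g by exact: C1itv_piecewise.
have prim (f : R -> R) : {within `[0, 1], continuous f} ->
    exists F2 F1 : R -> R, [/\ C1itv 0 1 F2 F1, C1itv 0 1 F1 (fun x => - f x),
      F2 0 = 0 & F1 1 = 0].
  move=> cf; have [Q Qf Q0] := primitive_exists cf.
  have F1c : C1itv 0 1 (fun x => Q 1 + - Q x) (fun x => 0 + - f x).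
    by apply: C1itvD (C1itvN Qf); exact: C1itv_cst.
  have [F2 F2f F20] := primitive_exists (proj1 F1c).
  exists F2, (fun x => Q 1 - Q x); split=> //; last by rewrite subrr.
  by move: F1c; congr C1itv; apply/funext => x; rewrite add0r.
have [A2 [A1 [a21 a10 A20 A11]]] := prim _ cr.
have [B2 [B1 [b21 b10 B20 B11]]] := prim _ cim.
have p21 : pC1 (fun x => Complex (A2 x) (B2 x)) (fun x => Complex (A1 x) (B1 x)).
  by split; apply: sub.
have p10 : pC1 (fun x => Complex (A1 x) (B1 x)) (fun x => - rho x).
  split; apply: sub => /=.
    by move: a10; congr C1itv; apply/funext => x; rewrite ReImE.
  by move: b10; congr C1itv; apply/funext => x; rewrite ReImE.
have [b2 b1] := pC1_bm Hp p21.
exists (BMFun b2, BMFun b1); split=> //=; first by rewrite A20 B20.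
  by rewrite A11 B11.
by split=> /=; [case: a21|case: b21].
Qed.

(** Aubin-Nitsche: (rho, rho) is the energy product of rho with the dual
    solution psi, from which any finite element function can be subtracted.
    The H^2 norm of psi is at most 5 times the L^2 norm of rho. The order s = 1
    of approximation is available because 0 < r. *)
Lemma elliptic_projection_L2 (rho : V) : adm rho -> ccontinuous_on (`[0, 1] : set R) rho.1 ->
  (0 < r)%N -> (forall chi, fe_pair chi -> fb rho chi = 0) ->
  nrm fm rho <= 5 * c * h * nrm fb rho.
Proof.
move=> [prho rho0] crho r0 orth.
have [psi [pp psi0 psi1 cpsi pp']] := dual_problem crho.
have apsi : adm psi by split.
have l2s := @l2_semi_inner R.
pose nrho : bmfun R := - rho.1.
have e1 : l2 psi.2 psi.2 = l2 psi.1 rho.1.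
  have := pC1_parts Hp pp pp'.
  rewrite [rdot _ _ 1](_ : _ = 0); last by rewrite /rdot psi1 !ReImE !mulr0 addr0.
  rewrite [rdot _ _ 0](_ : _ = 0); last by rewrite /rdot psi0 !ReImE !mul0r addr0.
  rewrite subrr -[rip psi.1 _]/(l2 psi.1 nrho) -[rip psi.2 _]/(l2 psi.2 psi.2).
  by rewrite (sipNr l2s) => /subr0_eq.
have e2 : fb rho psi = l2 rho.1 rho.1.
  have := pC1_parts Hp prho pp'.
  rewrite [rdot _ _ 1](_ : _ = 0); last by rewrite /rdot psi1 !ReImE !mulr0 addr0.
  rewrite [rdot _ _ 0](_ : _ = 0); last by rewrite /rdot rho0 !ReImE !mul0r addr0.
  rewrite subrr -[rip rho.1 _]/(l2 rho.1 nrho) -[rip rho.2 _]/(fb rho psi).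
  by rewrite (sipNr l2s) => /subr0_eq.
have P0 := nrm_ge0 fb psi; have R0 := nrm_ge0 fm rho.
have poin := fm_le_fb Hp apsi.
have n1 : nrm fb psi <= 2 * nrm fm rho.
  have : nrm fb psi * nrm fb psi <= 2 * nrm fm rho * nrm fb psi.
    rewrite -expr2 (sqr_nrm fb_semi_inner) [fb _ _]e1.
    apply: le_trans (sip_le l2s _ _) _.
    by rewrite -[nrm l2 psi.1]/(nrm fm psi) -[nrm l2 rho.1]/(nrm fm rho); nra.
  move: P0; rewrite le_eqVlt => /predU1P[<- _|P1]; first by rewrite mulr_ge0.
  by rewrite ler_pM2r.
pose d (l : nat) : R -> R[i] :=
  if l is l'.+1 then (if l' is 0%N then psi.2 : R -> R[i] else nrho) else psi.1.
have wc : weak_chain 2 d.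
  have w1 := pC1_weak_deriv Hp pp; have w2 := pC1_weak_deriv Hp pp'.
  by split; [case: w1|case=> [|[|]]].
have N2 : chain_norm 2 d <= 5 * nrm fm rho.
  have -> : chain_norm 2 d =
      Num.sqrt (nrm fm psi ^+ 2 + nrm fb psi ^+ 2 + nrm fm rho ^+ 2).
    have -> : nrm fm rho = nrm l2 nrho by rewrite (nrmN l2s).
    by rewrite /chain_norm !big_ord_recr big_ord0 /= add0r !L2normE.
  rewrite -[leRHS]ger0_norm ?mulr_ge0 // -sqrtr_sqr; apply: ler_wsqrtr.
  have n2 : nrm fm psi <= 4 * nrm fm rho by lra.
  have q1 : nrm fm psi ^+ 2 <= (4 * nrm fm rho) ^+ 2.
    by rewrite lerXn2r ?nnegrE ?nrm_ge0 ?mulr_ge0.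
  have q2 : nrm fb psi ^+ 2 <= (2 * nrm fm rho) ^+ 2.
    by rewrite lerXn2r ?nnegrE ?nrm_ge0 ?mulr_ge0.
  have := sqr_ge0 (nrm fm rho); lra.
have key : nrm fm rho * nrm fm rho <= 5 * c * h * nrm fb rho * nrm fm rho.
  rewrite -(ler_pM2l h_gt0); apply/ler_addgt0Pr => eta eta0.
  have eta1 : 0 < eta / (nrm fb rho + 1) by rewrite divr_gt0 // ltr_wpDl ?nrm_ge0.
  have [chi Sc le] := approximation_pair r0 wc erefl apsi cpsi eta1.
  rewrite -expr2 (sqr_nrm fm_semi_inner) -[fm _ _]e2.
  have -> : fb rho psi = fb rho (psi - chi) by rewrite (sipBr fb_semi_inner) (orth _ Sc) subr0.
  have B0 := nrm_ge0 fb rho.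
  have s1 : h * fb rho (psi - chi) <= nrm fb rho * (h * nrm fb (psi - chi)).
    by rewrite mulrCA ler_pM2l // sip_le //; exact: fb_semi_inner.
  apply: le_trans s1 _.
  have s2 : h * nrm fb (psi - chi) <=
      c * h ^+ 2 * (5 * nrm fm rho) + eta / (nrm fb rho + 1).
    have := nrm_ge0 fm (psi - chi).
    have : c * h ^+ 2 * chain_norm 2 d <= c * h ^+ 2 * (5 * nrm fm rho).
      by rewrite ler_wpM2l // mulr_ge0 // exprn_ge0 // ltW.
    lra.
  apply: le_trans (ler_wpM2l B0 s2) _.
  have s3 : nrm fb rho * (eta / (nrm fb rho + 1)) <= eta.
    by rewrite mulrCA ler_piMr ?(ltW eta0) // ler_pdivrMr ?mul1r ?lerDl ?ltr_wpDl.
  lra.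
move: R0; rewrite le_eqVlt => /predU1P[<-|R1]; first by rewrite !mulr_ge0 ?nrm_ge0 // ltW.
by move: key; rewrite ler_pM2r.
Qed.

(** The projection q is compared with an approximant chi of p: the difference
    q - chi is a finite element function, of size O(h) in L^2 as q is the best
    approximation, and the inverse inequality turns this into a bound for its
    derivative. *)
Lemma l2_projection_stable p : adm p -> ccontinuous_on (`[0, 1] : set R) p.1 ->
  exists q, [/\ fe_pair q, forall chi, fe_pair chi -> fm (p - q) chi = 0 &
    nrm fb q <= (3 * c * (ci + 1) + 1) * nrm fb p].
Proof.
move=> [pp p0] cp; have [q Sq qE] := fe_projection p (or_introl erefl).
exists q; split=> //.
have B0 := nrm_ge0 fb p.
pose d (l : nat) : R -> R[i] := if l is 0%N then p.1 else p.2.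
have wc : weak_chain 1 d.
  by have w1 := pC1_weak_deriv Hp pp; split; [case: w1|case].
have N1 : chain_norm 1 d <= 3 * nrm fb p.
  rewrite /chain_norm !big_ord_recr big_ord0 /= add0r !L2norm_bmfun.
  rewrite -[leRHS]ger0_norm ?mulr_ge0 // -sqrtr_sqr; apply: ler_wsqrtr.
  rewrite -[nrm l2 p.1]/(nrm fm p) -[nrm l2 p.2]/(nrm fb p).
  have ap : adm p by split.
  have n2 := fm_le_fb Hp ap.
  have q1 : nrm fm p ^+ 2 <= (2 * nrm fb p) ^+ 2.
    by rewrite lerXn2r ?nnegrE ?nrm_ge0 ?mulr_ge0.
  have := sqr_ge0 (nrm fb p); lra.
rewrite -(ler_pM2l h_gt0); apply/ler_addgt0Pr => eta eta0.
have eta1 : 0 < eta / (ci + 1) by rewrite divr_gt0 // ltr_wpDl.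
have [chi Sc le] := approximation_pair (leq0n r) wc erefl (conj pp p0) cp eta1.
have hq : nrm fm (q - chi) <= nrm fm (p - chi).
  have : nrm fm (q - chi) * nrm fm (q - chi) <= nrm fm (p - chi) * nrm fm (q - chi).
    rewrite -expr2 (sqr_nrm fm_semi_inner).
    have -> : fm (q - chi) (q - chi) = fm (p - chi) (q - chi).
      have -> : p - chi = (p - q) + (q - chi) by rewrite addrA subrK.
      by rewrite [RHS](sipDl fm_semi_inner) qE ?add0r //; exact: fe_pairB.
    exact: sip_le fm_semi_inner _ _.
  have := nrm_ge0 fm (q - chi); rewrite le_eqVlt => /predU1P[<- _|e0].
    exact: nrm_ge0.
  by rewrite ler_pM2r.
have inv := fe_inverse (fe_pairB Sq Sc).
have t1 : nrm fb q <= nrm fb (q - chi) + nrm fb (p - chi) + nrm fb p.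
  have -> : nrm fb q = nrm fb (((q - chi) - (p - chi)) + p).
    by rewrite opprB addrA subrK subrK.
  apply: le_trans (nrmD fb_semi_inner _ _) _; rewrite lerD2r.
  exact: nrmB fb_semi_inner _ _.
have h1 : h * nrm fb (q - chi) <= ci * nrm fm (p - chi).
  apply: le_trans (ler_wpM2l (ltW h_gt0) inv) _.
  rewrite mulrA mulrCA mulfV ?gt_eqF // mulr1.
  by rewrite ler_wpM2l.
have cN : c * h ^+ 1 * chain_norm 1 d <= c * h * (3 * nrm fb p).
  by rewrite expr1 ler_wpM2l // mulr_ge0 // ltW.
have m0 := nrm_ge0 fm (p - chi); have b0 : 0 <= h * nrm fb (p - chi).
  by rewrite mulr_ge0 ?nrm_ge0 // ltW.
have le1 : nrm fm (p - chi) <= c * h * (3 * nrm fb p) + eta / (ci + 1) by lra.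
have le2 : nrm fm (p - chi) + h * nrm fb (p - chi) <= c * h * (3 * nrm fb p) + eta / (ci + 1) by lra.
have le3 : ci * nrm fm (p - chi) <= ci * (c * h * (3 * nrm fb p) + eta / (ci + 1)).
  by rewrite ler_wpM2l.
apply: le_trans (ler_wpM2l (ltW h_gt0) t1) _.
have eE : ci * (eta / (ci + 1)) + eta / (ci + 1) = eta.
  by field; rewrite gt_eqF // ltr_wpDl.
lra.
Qed.

End FiniteElementSpace.

(** * Differentiation under the integral sign *)

Section OneSidedDerivatives.
Context {R : realType}.

Lemma within_deriv_interior (a b : R) (f : R -> R) (x l : R) : x \in `]a, b[ ->
  (y - x)^-1 * (f y - f x) @[y --> within `[a, b] x^'] --> l -> is_derive x 1 f l.
Proof.
move=> xab /cvgrPdist_le fl; apply: is_derive_cvg; apply/cvgrPdist_le => e e0.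
have [d /= d0 Hd] := fl e e0.
have [d' /= d'0 Hd'] := near_in_itvoo xab.
exists (Num.min d d'); first by rewrite /= lt_min d0 d'0.
move=> h /=; rewrite sub0r normrN lt_min => /andP[hd hd'] h0.
have := Hd (h + x); rewrite /= addrK; apply.
- by rewrite opprD addrCA subrr addr0 normrN.
- by rewrite -subr_eq0 addrK.
- apply: subset_itv_oo_cc; apply: Hd'.
  by rewrite /= opprD addrCA subrr addr0 normrN.
Qed.

Lemma is_deriv_in_interior (a b : R) (f : R -> R[i]) (x : R) (l : R[i]) :
  x \in `]a, b[ -> is_deriv_in `[a, b] f x l ->
  is_derive x 1 (fun y => ReC (f y)) (ReC l) /\
  is_derive x 1 (fun y => ImC (f y)) (ImC l).
Proof. by move=> xab [h1 h2]; split; exact: within_deriv_interior xab _. Qed.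

Lemma lipschitz_within_continuous (a b : R) (f : R -> R) (K : R) :
  (forall x y, x \in `[a, b] -> y \in `[a, b] -> `|f x - f y| <= K * `|x - y|) ->
  {within `[a, b], continuous f}.
Proof.
move=> fK; apply/subspace_continuousP => x xab; apply/cvgrPdist_le => e e0.
have K0 : 0 < `|K| + 1 by rewrite ltr_wpDl.
exists (e / (`|K| + 1)); first by rewrite /= divr_gt0.
move=> y /= xy yab; apply: le_trans (fK _ _ xab yab) _.
have : `|x - y| * (`|K| + 1) <= e by rewrite -ler_pdivlMr // ltW.
have := ler_norm K; have := normr_ge0 (x - y); nra.
Qed.

Section Joint.
Variables (T : R).
Hypothesis T0 : 0 < T.
Notation A := (`[0%R, T]%classic `*` `[0%R, 1%R]%classic : set (R * R)).

Lemma joint_bounded (F : R * R -> R) : {within A, continuous F} ->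
  exists K : R, 0 <= K /\ forall t x, t \in `[0, T] -> x \in `[0, 1] -> `|F (t, x)| <= K.
Proof.
move=> cF; have cA : compact A by apply: compact_setX; exact: segment_compact.
have /compact_bounded[M [_ /(_ (`|M| + 1))]] := continuous_compact cF cA.
have -> : M < `|M| + 1 by rewrite (le_lt_trans (ler_norm M)) // ltrDl.
move=> /(_ isT) FM; exists (`|M| + 1); split; first by rewrite addr_ge0.
by move=> t x tT x1; apply: FM; exists (t, x).
Qed.

Lemma joint_section_x (F : R * R -> R) t : {within A, continuous F} -> t \in `[0, T] ->
  {within `[0, 1], continuous (fun x => F (t, x))}.
Proof.
move=> /subspace_continuousP cF tT; apply/subspace_continuousP => x x1.
have := cF (t, x) (conj tT x1); apply: cvg_trans => B [[U V] /= [Ut Vx] UVB].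
apply: filterS Vx => y Vy y1; apply: (UVB (t, y)) => //; split=> //=.
exact: nbhs_singleton Ut.
Qed.

Lemma joint_section_t (F : R * R -> R) x : {within A, continuous F} -> x \in `[0, 1] ->
  {within `[0, T], continuous (fun t => F (t, x))}.
Proof.
move=> /subspace_continuousP cF x1; apply/subspace_continuousP => t tT.
have := cF (t, x) (conj tT x1); apply: cvg_trans => B [[U V] /= [Ut Vx] UVB].
apply: filterS Ut => s Us sT; apply: (UVB (s, x)) => //; split=> //=.
exact: nbhs_singleton Vx.
Qed.

Lemma MVT_lipschitz (f df : R -> R) (K : R) : {within `[0, T], continuous f} ->
  (forall t, t \in `]0, T[ -> is_derive t 1 f (df t)) ->
  (forall t, t \in `[0, T] -> `|df t| <= K) ->
  forall s t, s \in `[0, T] -> t \in `[0, T] -> `|f s - f t| <= K * `|s - t|.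
Proof.
move=> cf fd dK s t sT tT; rewrite mulrC.
pose g (i : nat) := if i is 0%N then f else df.
have gc : scalar_curve T 1 g by case=> // _; split.
by have := scalar_lipschitz tT sT gc dK.
Qed.

(** The time derivative is bounded on the compact space-time rectangle; the
    bound dominates the difference quotients, and it gives the continuity at
    the end points by the mean value theorem. *)
Lemma rip_time_derivative (F0 F1 : R -> R -> R[i]) (phi : bmfun R) :
  ccontinuous_on A (fun p => F0 p.1 p.2) -> ccontinuous_on A (fun p => F1 p.1 p.2) ->
  (forall t x, t \in `[0, T] -> x \in `[0, 1] ->
     is_deriv_in `[0, T] (fun s => F0 s x) t (F1 t x)) ->
  {within `[0, T], continuous (fun t => rip (F0 t) phi)} /\
  forall t, t \in `]0, T[ -> is_derive t 1 (fun t => rip (F0 t) phi) (rip (F1 t) phi).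
Proof.
move=> [cr0 ci0] [cr1 ci1] der.
have [Kr [Kr0 HKr]] := joint_bounded cr1.
have [Ki [Ki0 HKi]] := joint_bounded ci1.
have [[_ [Pr HPr]] [_ [Pi HPi]]] := bmfun_bm phi.
have bF t : t \in `[0, T] -> bm (F0 t).
  by move=> tT; apply: bm_continuous; split;
    [exact: (joint_section_x cr0 tT)|exact: (joint_section_x ci0 tT)].
have bF1 t : t \in `[0, T] -> bm (F1 t).
  by move=> tT; apply: bm_continuous; split;
    [exact: (joint_section_x cr1 tT)|exact: (joint_section_x ci1 tT)].
have oc (t : R) : t \in `]0, T[ -> t \in `[0, T] by exact: subset_itv_oo_cc.
have oc1 (x : R) : x \in `]0, 1[ -> x \in `[0, 1] by exact: subset_itv_oo_cc.
have dpt (t x : R) : t \in `]0, T[ -> x \in `[0, 1] ->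
    is_derive t 1 (fun t => rdot (F0 t) phi x) (rdot (F1 t) phi x).
  move=> tT x1; have [d1 d2] := is_deriv_in_interior tT (der t x (oc _ tT) x1).
  have e1 := is_deriveZ (ReC (phi x)) d1; have e2 := is_deriveZ (ImC (phi x)) d2.
  have := is_deriveD e1 e2; rewrite /rdot /GRing.scale /=.
  rewrite (mulrC _ (ReC (F1 t x))) (mulrC _ (ImC (F1 t x))).
  rewrite (_ : _ + _ = fun t => ReC (F0 t x) * ReC (phi x) + ImC (F0 t x) * ImC (phi x)) //.
  by apply/funext => s; rewrite !fctE (mulrC (ReC _)) (mulrC (ImC _)).
pose C := Kr * `|Pr| + Ki * `|Pi|.
have bnd (t x : R) : t \in `[0, T] -> x \in `]0, 1[ -> `|rdot (F1 t) phi x| <= C.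
  move=> tT x1; apply: le_trans (ler_normD _ _) _; rewrite !normrM.
  by apply: lerD; apply: ler_pM => //; [apply: HKr => //; exact: oc1|
    apply: le_trans (HPr x x1) (ler_norm _)|apply: HKi => //; exact: oc1|
    apply: le_trans (HPi x x1) (ler_norm _)].
split.
  apply: (@lipschitz_within_continuous _ _ _ C) => s t sT tT.
  rewrite -[rip (F0 s) phi - _]IintB; [|exact: bmr_rdot (bF _ _) (bmfun_bm _)..].
  have b1 : bmr (fun x => rdot (F0 s) phi x - rdot (F0 t) phi x).
    by apply: bmrB; exact: bmr_rdot (bF _ _) (bmfun_bm _).
  apply: le_trans (le_normr_Rintegral _ (bmr_integrable b1)) _ => //.
  rewrite -[leRHS]Iint_cst; apply: le_Iint.
  - split; first by apply: measurableT_comp => //; case: b1.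
    by case: b1 => _ [K HK]; exists K => x Dx; rewrite normr_id HK.
  - exact: bmr_cst.
  move=> x Dx; have x1 := oc1 _ Dx.
  have cx : {within `[0, T], continuous (fun t => rdot (F0 t) phi x)}.
    have h1 := joint_section_t cr0 x1; have h2 := joint_section_t ci0 x1.
    move=> y; exact: (continuousD (continuousM (h1 y) (cvg_cst _)) (continuousM (h2 y) (cvg_cst _))).
  have dx y : y \in `]0, T[ -> is_derive y 1 (fun t => rdot (F0 t) phi x) (rdot (F1 y) phi x).
    by move=> yT; exact: dpt.
  have bx y : y \in `[0, T] -> `|rdot (F1 y) phi x| <= C by move=> yT; exact: bnd.
  exact: (MVT_lipschitz cx dx bx sT tT).
move=> t tT.
pose f (s x : R) : R := rdot (F0 s) phi x.
have intf s : `]0, T[%classic s -> (@lebesgue_measure R).-integrable `]0, 1[ (EFin \o f s).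
  by move=> sT; apply: bmr_integrable; apply: bmr_rdot (bmfun_bm _); exact: bF (oc _ sT).
have derf s x : `]0, T[%classic s -> `]0, 1[%classic x -> derivable (f ^~ x) s 1.
  by move=> sT x1; case: (dpt s x sT (oc1 _ x1)).
have C0 (x : R) : 0 <= C by rewrite addr_ge0 ?mulr_ge0.
have intC : (@lebesgue_measure R).-integrable `]0, 1[ (EFin \o (fun=> C)).
  exact: bmr_integrable (bmr_cst C).
have ub s x : `]0, T[%classic s -> `]0, 1[%classic x -> `|partial1of2 f s x| <= C.
  move=> sT x1; rewrite /partial1of2 derive1E.
  have [_ ->] := dpt s x sT (oc1 _ x1); exact: bnd (oc _ sT) x1.
have dF := @derivable_under_integral R _ _ (@lebesgue_measure R) f _ (measurable_itv _) t 0 T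
  tT intf derf (fun=> C) C0 intC ub.
have eF := @differentiation_under_integral R _ _ (@lebesgue_measure R) f _ (measurable_itv _) t 0 T
  tT intf derf (fun=> C) C0 intC ub.
apply: DeriveDef; first exact: dF.
rewrite -derive1E; apply: etrans eF _; apply: eq_Rintegral => x /set_mem x1.
by rewrite /partial1of2 derive1E; have [_ ->] := dpt t x tT (oc1 _ x1).
Qed.

End Joint.
End OneSidedDerivatives.

(** * The exact solution as a curve *)

Section SmoothCurves.
Context {R : realType}.
Notation V := (bmfun R * bmfun R)%type.
Variables (T : R).
Hypothesis T0 : 0 < T.

Lemma curve_transfer (f g : R -> R) (df : R -> R) :
  (forall t, t \in `[0, T] -> f t = g t) ->
  {within `[0, T], continuous f} /\ (forall t, t \in `]0, T[ -> is_derive t 1 f (df t)) ->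
  {within `[0, T], continuous g} /\ (forall t, t \in `]0, T[ -> is_derive t 1 g (df t)).
Proof.
move=> fg [cf fd]; split.
  by apply: (@subspace_eq_continuous _ _ _ f) => // x /set_mem; exact: fg.
move=> t tT; apply: near_eq_is_derive (fd t tT).
have : \near t, t \in `]0, T[ by exact: near_in_itvoo.
by apply: filterS => s sT; apply: fg; exact: (subset_itv_oo_cc sT).
Qed.

Variables (I : nat -> nat -> bool) (u : R -> R -> R[i]).
Hypothesis Hu : smooth T I u.

(** The derivative of order i in time and j in space. *)
Definition ubm (i j : nat) (t : R) : bmfun R := to_bm (pd T i j u t).

Lemma pd_joint i j : I i j ->
  ccontinuous_on (`[0, T] `*` `[0, 1] : set (R * R)) (fun p => pd T i j u p.1 p.2).
Proof. by move=> /Hu[]. Qed.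

Lemma pd_continuous i j t : I i j -> t \in `[0, T] ->
  ccontinuous_on (`[0, 1] : set R) (pd T i j u t).
Proof.
move=> Iij tT; have [cr ci] := pd_joint Iij.
by split; [exact: (joint_section_x cr tT)|exact: (joint_section_x ci tT)].
Qed.

Lemma pd_bm i j t : I i j -> t \in `[0, T] -> bm (pd T i j u t).
Proof. by move=> Iij tT; apply: bm_continuous; exact: pd_continuous. Qed.

Lemma ubmE i j t : I i j -> t \in `[0, T] -> (ubm i j t : R -> R[i]) = pd T i j u t.
Proof. by move=> Iij tT; apply: to_bmE; exact: pd_bm. Qed.

Lemma pd_C1 i j t : I i j -> I i j.+1 -> t \in `[0, T] ->
  C1itv 0 1 (fun x => ReC (pd T i j u t x)) (fun x => ReC (pd T i j.+1 u t x)) /\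
  C1itv 0 1 (fun x => ImC (pd T i j u t x)) (fun x => ImC (pd T i j.+1 u t x)).
Proof.
move=> Iij Iij1 tT; have [c1 c2] := pd_continuous Iij tT.
have [c3 c4] := pd_continuous Iij1 tT; have [_ _ /(_ Iij1) der] := Hu Iij.
have d x : x \in `]0, 1[ -> _ := fun x1 =>
  is_deriv_in_interior x1 (der t x tT (subset_itv_oo_cc x1)).
split; split=> //.
  exists (fun x => ReC (pd T i j.+1 u t x)); split=> // x x1; split=> //.
  by have [] := d x x1.
exists (fun x => ImC (pd T i j.+1 u t x)); split=> // x x1; split=> //.
by have [] := d x x1.
Qed.

Lemma ubm_pC1 M pt i j t : is_partition 1 M pt -> I i j -> I i j.+1 -> t \in `[0, T] ->
  cpiecewise_C1 M pt (ubm i j t) (ubm i j.+1 t).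
Proof.
move=> Hp Iij Iij1 tT; rewrite !ubmE //; have [c1 c2] := pd_C1 Iij Iij1 tT.
by split; exact: C1itv_piecewise.
Qed.

Lemma ubm_weak_deriv i j t : I i j -> I i j.+1 -> t \in `[0, T] ->
  weak_deriv (ubm i j t) (ubm i j.+1 t).
Proof.
have part : is_partition 1 1 (fun n => n%:R : R).
  by split=> // -[|j'] //=; rewrite ltr01.
by move=> Iij Iij1 tT; apply: (pC1_weak_deriv part); exact: ubm_pC1.
Qed.

Lemma ubm_curve i j (phi : bmfun R) : I i j -> I i.+1 j ->
  {within `[0, T], continuous (fun t => l2 (ubm i j t) phi)} /\
  (forall t, t \in `]0, T[ ->
    is_derive t 1 (fun t => l2 (ubm i j t) phi) (l2 (ubm i.+1 j t) phi)).
Proof.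
move=> Iij Ii1j; have [_ /(_ Ii1j) der _] := Hu Iij.
have := @rip_time_derivative R T _ _ phi (pd_joint Iij) (pd_joint Ii1j) der.
move=> [c d]; apply: (curve_transfer (f := fun t => rip (pd T i j u t) phi)).
  by move=> t tT; rewrite /l2 ubmE.
split=> // t tT; rewrite /l2 ubmE //; first exact: d.
exact: (subset_itv_oo_cc tT).
Qed.

Lemma ubm_value_curve i (z : R[i]) x : x \in `[0, 1] -> I i 0%N -> I i.+1 0%N ->
  {within `[0, T], continuous (fun t => rdot (ubm i 0 t) (fun=> z) x)} /\
  (forall t, t \in `]0, T[ ->
    is_derive t 1 (fun t => rdot (ubm i 0 t) (fun=> z) x) (rdot (ubm i.+1 0 t) (fun=> z) x)).
Proof.
move=> x1 Ii Ii1; have [_ /(_ Ii1) der _] := Hu Ii.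
have [cr ci] := pd_joint Ii.
apply: (curve_transfer (f := fun t => rdot (pd T i 0 u t) (fun=> z) x)).
  by move=> t tT; rewrite /rdot ubmE.
split.
  have h1 := joint_section_t cr x1; have h2 := joint_section_t ci x1.
  move=> y; exact: (continuousD (continuousM (h1 y) (cvg_cst _)) (continuousM (h2 y) (cvg_cst _))).
move=> t tT; have tT' : t \in `[0, T] by exact: (subset_itv_oo_cc tT).
have [d1 d2] := is_deriv_in_interior tT (der t x tT' x1).
rewrite /rdot ubmE //.
have e1 := is_deriveZ (ReC z) d1; have e2 := is_deriveZ (ImC z) d2.
have := is_deriveD e1 e2; rewrite /GRing.scale /=.
rewrite (mulrC _ (ReC (pd T i.+1 0 u t x))) (mulrC _ (ImC (pd T i.+1 0 u t x))).
rewrite (_ : _ + _ = fun t => ReC (pd T i 0 u t x) * ReC z + ImC (pd T i 0 u t x) * ImC z) //.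
by apply/funext => s; rewrite !fctE (mulrC (ReC _)) (mulrC (ImC _)).
Qed.

Lemma ubm_bounded i j : I i j -> exists K : R, 0 <= K /\
  forall t, t \in `[0, T] -> nrm l2 (ubm i j t) <= K.
Proof.
move=> Iij; have [cr ci] := pd_joint Iij.
have [K1 [K10 H1]] := joint_bounded cr; have [K2 [K20 H2]] := joint_bounded ci.
exists (K1 + K2); split; first exact: addr_ge0.
move=> t tT; rewrite -[leRHS]ger0_norm ?addr_ge0 // -sqrtr_sqr; apply: ler_wsqrtr.
rewrite -[leRHS]Iint_cst; apply: le_Iint.
- exact: bmr_rdot (bmfun_bm _) (bmfun_bm _).
- exact: bmr_cst.
move=> x Dx; have x1 : x \in `[0, 1] by exact: (subset_itv_oo_cc Dx).
rewrite /rdot ubmE // -!expr2.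
have h1 := H1 t x tT x1; have h2 := H2 t x tT x1.
have s1 : ReC (pd T i j u t x) ^+ 2 <= K1 ^+ 2.
  by rewrite -real_normK ?num_real // lerXn2r ?nnegrE.
have s2 : ImC (pd T i j u t x) ^+ 2 <= K2 ^+ 2.
  by rewrite -real_normK ?num_real // lerXn2r ?nnegrE.
have := mulr_ge0 K10 K20; lra.
Qed.

(** [sup] is only meaningful for bounded sets: this is why the derivatives of u
    are bounded, by compactness, before they are compared with [Xi]. *)
Lemma max_time_ge (g : R -> R) (K : R) t : (forall t, t \in `[0, T] -> g t <= K) ->
  t \in `[0, T] -> g t <= max_time T g.
Proof.
move=> gK tT; apply: ub_le_sup; last by exists t.
by exists K => _ [s sT <-]; exact: gK.
Qed.

Lemma zero_in : 0 \in `[0, T]. Proof. by rewrite in_itv /= lexx ltW. Qed.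

Lemma max_time_ge0 (g : R -> R) (K : R) : (forall t, t \in `[0, T] -> g t <= K) ->
  (forall t, 0 <= g t) -> 0 <= max_time T g.
Proof. by move=> gK g0; apply: le_trans (max_time_ge gK zero_in). Qed.

Lemma ubm_weak_chain i s t : (forall j, (j <= s)%N -> I i j) -> t \in `[0, T] ->
  weak_chain s (fun j => ubm i j t : R -> R[i]).
Proof.
move=> Iij tT; split; first exact: bm_L2 (bmfun_bm _).
by move=> l ls; apply: ubm_weak_deriv => //; apply: Iij => //; exact: ltnW.
Qed.

Lemma Hnorm_pd i s t : (forall j, (j <= s)%N -> I i j) -> t \in `[0, T] ->
  Hnorm s (pd T i 0 u t) = Num.sqrt (\sum_(l < s.+1) nrm l2 (ubm i l t) ^+ 2).
Proof.
move=> Iij tT; rewrite -ubmE ?Iij // (Hnorm_weak_chain (ubm_weak_chain Iij tT)).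
by congr Num.sqrt; apply: eq_bigr => l _; rewrite L2norm_bmfun.
Qed.

Lemma nrm_le_Hnorm i s t j : (forall j, (j <= s)%N -> I i j) -> t \in `[0, T] ->
  (j <= s)%N -> nrm l2 (ubm i j t) <= Hnorm s (pd T i 0 u t).
Proof.
move=> Iij tT js; rewrite Hnorm_pd // -[leLHS]ger0_norm ?nrm_ge0 // -sqrtr_sqr.
apply: ler_wsqrtr; rewrite (bigD1 (Ordinal (js : (j < s.+1)%N))) //= lerDl.
by apply: sumr_ge0 => l _; exact: sqr_ge0.
Qed.

Lemma Hnorm_pd_bounded i s : (forall j, (j <= s)%N -> I i j) ->
  exists K : R, forall t, t \in `[0, T] -> Hnorm s (pd T i 0 u t) <= K.
Proof.
move=> Iij.
have /choice[K HK] : forall l : 'I_s.+1, exists K : R, 0 <= K /\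
    forall t, t \in `[0, T] -> nrm l2 (ubm i l t) <= K.
  by move=> l; apply: ubm_bounded; exact: Iij (ltn_ord l : (l <= s)%N).
exists (Num.sqrt (\sum_(l < s.+1) K l ^+ 2)) => t tT.
rewrite Hnorm_pd //; apply: ler_wsqrtr; apply: ler_sum => l _.
have [K0 HKl] := HK l.
by rewrite lerXn2r ?nnegrE ?nrm_ge0 // HKl.
Qed.

Lemma value_bounded i : I i 0%N -> exists K : R, forall t, t \in `[0, T] ->
  cabs (pd T i 0 u t 1) <= K.
Proof.
move=> Ii; have [cr ci] := pd_joint Ii.
have [K1 [K10 H1]] := joint_bounded cr; have [K2 [K20 H2]] := joint_bounded ci.
exists (K1 + K2) => t tT.
have o1 : (1 : R) \in `[0, 1] by rewrite in_itv /= ler01 lexx.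
rewrite -(ler_pXn2r (n := 2)) ?nnegrE ?cabs_ge0 ?addr_ge0 // cabsE.
have h1 := H1 t 1 tT o1; have h2 := H2 t 1 tT o1.
have s1 : ReC (pd T i 0 u t 1) ^+ 2 <= K1 ^+ 2.
  by rewrite -real_normK ?num_real // lerXn2r ?nnegrE.
have s2 : ImC (pd T i 0 u t 1) ^+ 2 <= K2 ^+ 2.
  by rewrite -real_normK ?num_real // lerXn2r ?nnegrE.
have := mulr_ge0 K10 K20; lra.
Qed.

End SmoothCurves.

Section SolutionBounds.
Context {R : realType}.
Variables (T : R) (r : nat) (u : R -> R -> R[i]).
Hypothesis T0 : 0 < T.
Hypothesis Hu : smooth T (solution_orders r) u.
Notation w := (ubm T u).
Notation X := (Xi T r u).
Notation I := (solution_orders r).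

Lemma orders2 i j : (i <= 2)%N -> (j <= r.+1)%N -> I i j.
Proof. by move=> h1 h2; rewrite /solution_orders h1 h2. Qed.
Lemma orders3 j : (j <= 1)%N -> I 3 j.
Proof. by case: j => [|[|]]; rewrite /solution_orders ?orbT. Qed.
Lemma orders4 : I 4 0.
Proof. by rewrite /solution_orders !orbT. Qed.

Let XA : 0 <= \sum_(l < 3) max_time T (fun t => Hnorm r.+1 (iter l (dt T) u t)).
Proof.
apply: sumr_ge0 => l _.
have [K HK] := Hnorm_pd_bounded Hu (fun j => orders2 (ltn_ord l : (l <= 2)%N)).
by apply: (max_time_ge0 T0 HK) => t; exact: sqrtr_ge0.
Qed.
Let XB : 0 <= max_time T (fun t => Hnorm 1 (iter 3 (dt T) u t)).
Proof.
have [K HK] := Hnorm_pd_bounded Hu (fun j => @orders3 j).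
by apply: (max_time_ge0 T0 HK) => t; exact: sqrtr_ge0.
Qed.
Let HKC : exists K : R, forall t, t \in `[0, T] -> L2norm (pd T 4 0 u t) <= K.
Proof.
have [K [_ HK]] := ubm_bounded Hu orders4.
by exists K => t tT; rewrite -(ubmE Hu orders4 tT) L2norm_bmfun HK.
Qed.
Let XC : 0 <= max_time T (fun t => L2norm (iter 4 (dt T) u t)).
Proof.
have [K HK] := HKC.
by apply: (max_time_ge0 T0 HK) => t; exact: sqrtr_ge0.
Qed.
Let XD : 0 <= max_time T (fun t => cabs (iter 3 (dt T) u t 1)).
Proof.
have [K HK] := value_bounded Hu (orders3 (isT : (0 <= 1)%N)).
by apply: (max_time_ge0 T0 HK) => t; exact: cabs_ge0.
Qed.

Lemma Xi_ge0 : 0 <= X.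
Proof. by rewrite /Xi !addr_ge0. Qed.

Lemma Xi_ge2 i j t : (i <= 2)%N -> (j <= r.+1)%N -> t \in `[0, T] -> nrm l2 (w i j t) <= X.
Proof.
move=> i2 jr tT; have Ii j' : (j' <= r.+1)%N -> I i j' by exact: orders2.
apply: le_trans (nrm_le_Hnorm Hu Ii tT jr) _.
have [K HK] := Hnorm_pd_bounded Hu Ii.
apply: le_trans (max_time_ge HK tT) _.
rewrite /Xi -!addrA; apply: ler_wpDr; first by rewrite !addr_ge0.
rewrite (bigD1 (Ordinal (i2 : (i < 3)%N))) //= lerDl.
apply: sumr_ge0 => l _.
have [K' HK'] := Hnorm_pd_bounded Hu (fun j => orders2 (ltn_ord l : (l <= 2)%N)).
by apply: (max_time_ge0 T0 HK') => t'; exact: sqrtr_ge0.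
Qed.

Lemma Xi_ge3 j t : (j <= 1)%N -> t \in `[0, T] -> nrm l2 (w 3 j t) <= X.
Proof.
move=> j1 tT; apply: le_trans (nrm_le_Hnorm Hu (fun j => @orders3 j) tT j1) _.
have [K HK] := Hnorm_pd_bounded Hu (fun j => @orders3 j).
apply: le_trans (max_time_ge HK tT) _.
have [h1 h2 h3 h4] := And4 XA XB XC XD; rewrite /Xi; lra.
Qed.

Lemma Xi_ge4 t : t \in `[0, T] -> nrm l2 (w 4 0 t) <= X.
Proof.
move=> tT; rewrite -L2norm_bmfun (ubmE Hu orders4 tT).
have [K HK] := HKC.
apply: le_trans (max_time_ge HK tT) _.
have [h1 h2 h3 h4] := And4 XA XB XC XD; rewrite /Xi; lra.
Qed.

Lemma Xi_ge_value t : t \in `[0, T] -> cabs (w 3 0 t 1) <= X.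
Proof.
move=> tT; rewrite (ubmE Hu (orders3 (isT : (0 <= 1)%N)) tT).
have [K HK] := value_bounded Hu (orders3 (isT : (0 <= 1)%N)).
apply: le_trans (max_time_ge HK tT) _.
have [h1 h2 h3 h4] := And4 XA XB XC XD; rewrite /Xi; lra.
Qed.

End SolutionBounds.

(** * Bounds on the coefficients *)

Section Coefficients.
Context {R : realType}.
Variable T : R.
Hypothesis T0 : 0 < T.

(** The one-sided difference quotients are bounded near each point. *)
Lemma within_deriv_continuous (f : R -> R) (df : R -> R) :
  (forall x, x \in `[0, T] ->
    (y - x)^-1 * (f y - f x) @[y --> within `[0, T] x^'] --> df x) ->
  {within `[0, T], continuous f}.
Proof.
move=> der; apply/subspace_continuousP => x xT; apply/cvgrPdist_le => e e0.
have [d /= d0 Hd] := (cvgrPdist_le _ _).1 (der x xT) 1 ltr01.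
have K0 : 0 < `|df x| + 1 by rewrite ltr_wpDl.
exists (Num.min d (e / (`|df x| + 1))); first by rewrite /= lt_min d0 divr_gt0.
move=> y /=; rewrite lt_min => /andP[yd ye] yT.
have [->|yx] := eqVneq y x; first by rewrite subrr normr0 ltW.
have /= h := Hd y yd yx yT.
have yx0 : y - x != 0 by rewrite subr_eq0.
have q : `|(y - x)^-1 * (f y - f x)| <= `|df x| + 1.
  have -> : (y - x)^-1 * (f y - f x) = df x - (df x - (y - x)^-1 * (f y - f x)) by ring.
  by apply: le_trans (ler_normB _ _) _; rewrite lerD2l.
have -> : f x - f y = - ((y - x) * ((y - x)^-1 * (f y - f x))).
  by rewrite mulrA divff // mul1r opprB.
rewrite normrN normrM distrC.
apply: le_trans (ler_wpM2l (normr_ge0 _) q) _.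
by rewrite -ler_pdivlMr // ltW.
Qed.

Lemma within_continuous_bounded (f : R -> R) : {within `[0, T], continuous f} ->
  exists K : R, 0 <= K /\ forall t, t \in `[0, T] -> `|f t| <= K.
Proof.
move=> cf; have [_ [K HK]] := bmi_continuous cf; exists `|K|; split=> // t tT.
by apply: le_trans (HK t tT) (ler_norm _).
Qed.

Lemma within_continuous_min (f : R -> R) : {within `[0, T], continuous f} ->
  (forall t, t \in `[0, T] -> 0 < f t) ->
  exists K : R, 0 < K /\ forall t, t \in `[0, T] -> K <= f t.
Proof.
move=> cf f0; have [c cT Hc] := EVT_min (ltW T0) cf.
by exists (f c); split=> //; exact: f0.
Qed.

Lemma C1_on_parts (f : R -> R[i]) : C1_on `[0, T] f ->
  [/\ {within `[0, T], continuous (fun t => ReC (f t))},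
      {within `[0, T], continuous (fun t => ImC (f t))} &
   exists L : R, 0 <= L /\ forall s t, s \in `[0, T] -> t \in `[0, T] ->
     `|ReC (f s) - ReC (f t)| <= L * `|s - t| ].
Proof.
move=> [der [cr ci]].
have c1 : {within `[0, T], continuous (fun t => ReC (f t))}.
  by apply: (@within_deriv_continuous _ (fun t => ReC (deriv_in `[0, T] f t))) => x /der[].
have c2 : {within `[0, T], continuous (fun t => ImC (f t))}.
  by apply: (@within_deriv_continuous _ (fun t => ImC (deriv_in `[0, T] f t))) => x /der[].
split=> //; have [K [K0 HK]] := within_continuous_bounded cr.
exists K; split=> //.
have d t : t \in `]0, T[ ->
    is_derive t 1 (fun t => ReC (f t)) (ReC (deriv_in `[0, T] f t)).
  move=> tT; have tT' : t \in `[0, T] by exact: (subset_itv_oo_cc tT).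
  by have [] := is_deriv_in_interior tT (der t tT').
exact: MVT_lipschitz c1 d HK.
Qed.

Lemma cabs_le_parts (z : R[i]) (x y : R) : `|ReC z| <= x -> `|ImC z| <= y -> cabs z <= x + y.
Proof.
move=> h1 h2; have x0 : 0 <= x := le_trans (normr_ge0 _) h1.
have y0 : 0 <= y := le_trans (normr_ge0 _) h2.
rewrite -(ler_pXn2r (n := 2)) ?nnegrE ?cabs_ge0 ?addr_ge0 // cabsE.
have s1 : ReC z ^+ 2 <= x ^+ 2 by rewrite -real_normK ?num_real // lerXn2r ?nnegrE.
have s2 : ImC z ^+ 2 <= y ^+ 2 by rewrite -real_normK ?num_real // lerXn2r ?nnegrE.
have := mulr_ge0 x0 y0; lra.
Qed.

Lemma joint_cabs_bounded (F : R -> R -> R[i]) :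
  ccontinuous_on (`[0, T] `*` `[0, 1] : set (R * R)) (fun p => F p.1 p.2) ->
  exists K : R, 0 <= K /\ forall t x, t \in `[0, T] -> x \in `[0, 1] -> cabs (F t x) <= K.
Proof.
move=> [cr ci].
have [K1 [K10 H1]] := joint_bounded cr; have [K2 [K20 H2]] := joint_bounded ci.
exists (K1 + K2); split; first exact: addr_ge0.
by move=> t x tT x1; apply: cabs_le_parts; [exact: H1|exact: H2].
Qed.

(** Everything about the coefficients that enters the constants of the theorem. *)
Record coef_bounds (a : R -> R) (beta : R -> R -> R[i]) (mu S : R -> R) (G : R -> R[i])
    (A A1 mu1 s0 s1 g1 B1 B2 Lb : R) : Prop := CoefBounds {
  cb_ge0 : [/\ 0 <= A, 0 <= A1, 0 <= mu1 & 0 < s0] /\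
           [/\ 0 <= s1, 0 <= g1, 0 <= B1, 0 <= B2 & 0 <= Lb];
  cb_a : forall t, t \in `[0, T] -> `|(a t)^-1| <= A;
  cb_a_lip : forall s t, s \in `[0, T] -> t \in `[0, T] ->
    `|(a s)^-1 - (a t)^-1| <= A1 * `|s - t|;
  cb_mu : forall t, t \in `[0, T] -> - mu1 <= mu t <= 0;
  cb_S : forall t, t \in `[0, T] -> s0 <= S t <= s1;
  cb_G : forall t, t \in `[0, T] -> cabs (G t) <= g1;
  cb_beta : forall t x, t \in `[0, T] -> x \in `]0, 1[ -> cabs (ubm T beta 0 0 t x) <= B1;
  cb_beta_x : forall t x, t \in `[0, T] -> x \in `]0, 1[ -> cabs (ubm T beta 0 1 t x) <= B2;
  cb_beta_lip : forall s t x, s \in `[0, T] -> t \in `[0, T] -> x \in `]0, 1[ ->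
    cabs (ubm T beta 0 0 s x - ubm T beta 0 0 t x) <= Lb * `|s - t| }.

Lemma coef_bounds_exist a beta mu S G :
  smooth_coefficients T a beta mu S G ->
  (forall t, t \in `[0, T] -> a t != 0) -> (forall t, t \in `[0, T] -> mu t <= 0) ->
  (forall t, t \in `[0, T] -> 0 < S t) ->
  exists A A1 mu1 s0 s1 g1 B1 B2 Lb, coef_bounds a beta mu S G A A1 mu1 s0 s1 g1 B1 B2 Lb.
Proof.
move=> [Ca Hb Cmu CS CG] a_neq0 mu_le0 S_gt0.
have [ca _ [La [La0 HLa]]] := C1_on_parts Ca.
have [cmu _ _] := C1_on_parts Cmu; have [cS _ _] := C1_on_parts CS.
have [cGr cGi _] := C1_on_parts CG.
have cna : {within `[0, T], continuous (fun t => `|a t|)}.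
  by move=> t; apply: continuous_comp; [exact: ca|exact: norm_continuous].
have na0 t : t \in `[0, T] -> 0 < `|a t| by move=> tT; rewrite normr_gt0 a_neq0.
have [am [am0 Ham]] := within_continuous_min cna na0.
have [mu1 [mu10 Hmu]] := within_continuous_bounded cmu.
have [s0 [s00 Hs0]] := within_continuous_min cS S_gt0.
have [s1 [s10 Hs1]] := within_continuous_bounded cS.
have [gr [gr0 Hgr]] := within_continuous_bounded cGr.
have [gi [gi0 Hgi]] := within_continuous_bounded cGi.
have I00 : (0 + 0 <= 1)%N by []. have I01 : (0 + 1 <= 1)%N by [].
have I10 : (1 + 0 <= 1)%N by [].
have [B1 [B10 HB1]] := joint_cabs_bounded (pd_joint Hb I00).
have [B2 [B20 HB2]] := joint_cabs_bounded (pd_joint Hb I01).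
have [[cr1 ci1] _ _] := Hb 1%N 0%N I10.
have [Kr [Kr0 HKr]] := joint_bounded cr1; have [Ki [Ki0 HKi]] := joint_bounded ci1.
have oc (x : R) : x \in `]0, 1[ -> x \in `[0, 1] by exact: subset_itv_oo_cc.
exists am^-1, (La * am^-1 ^+ 2), mu1, s0, s1, (gr + gi), B1, B2, (Kr + Ki).
have inva t : t \in `[0, T] -> `|(a t)^-1| <= am^-1.
  by move=> tT; rewrite normrV ?unitfE ?a_neq0 // lef_pV2 ?posrE ?na0 // Ham.
split.
- by split; split=> //; rewrite ?addr_ge0 ?mulr_ge0 ?sqr_ge0 ?invr_ge0 // ltW.
- exact: inva.
- move=> s t sT tT.
  have -> : (a s)^-1 - (a t)^-1 = (a t - a s) * ((a s)^-1 * (a t)^-1).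
    by field; rewrite !a_neq0.
  rewrite normrM mulrAC ler_pM //.
    by have := HLa t s tT sT; rewrite /= (distrC t s).
  by rewrite normrM expr2 ler_pM // inva.
- move=> t tT; rewrite mu_le0 // andbT.
  by have := Hmu t tT; rewrite ler_norml => /andP[].
- by move=> t tT; rewrite Hs0 //= (le_trans (ler_norm _)) // Hs1.
- by move=> t tT; apply: cabs_le_parts; [exact: Hgr|exact: Hgi].
- by move=> t x tT /oc x1; rewrite (ubmE Hb I00 tT); exact: HB1.
- by move=> t x tT /oc x1; rewrite (ubmE Hb I01 tT); exact: HB2.
- move=> s t x sT tT /oc x1; rewrite (ubmE Hb I00 sT) (ubmE Hb I00 tT) mulrDl.
  have [[cr0 ci0] /(_ I10) der _] := Hb 0%N 0%N I00.
  have hr := joint_section_t cr0 x1; have hi := joint_section_t ci0 x1.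
  have d y : y \in `]0, T[ ->
      is_derive y 1 (fun s => ReC (pd T 0 0 beta s x)) (ReC (pd T 1 0 beta y x)) /\
      is_derive y 1 (fun s => ImC (pd T 0 0 beta s x)) (ImC (pd T 1 0 beta y x)).
    by move=> yT; apply: is_deriv_in_interior yT (der y x (subset_itv_oo_cc yT) x1).
  apply: cabs_le_parts; rewrite !ReImE.
    apply: (MVT_lipschitz hr _ (df := fun y => ReC (pd T 1 0 beta y x))) => //.
      by move=> y /d[].
    by move=> y yT; exact: HKr.
  apply: (MVT_lipschitz hi _ (df := fun y => ImC (pd T 1 0 beta y x))) => //.
    by move=> y /d[].
  by move=> y yT; exact: HKi.
Qed.

End Coefficients.

(** * Weak forms of the problem and of the scheme *)

Section WeakForms.
Context {R : realType}.
Notation V := (bmfun R * bmfun R)%type.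
Variables (M : nat) (pt : nat -> R).
Hypothesis Hp : is_partition 1 M pt.
Notation pC1 := (cpiecewise_C1 M pt).
Variables (T : R) (T0 : 0 < T).
Variables (r : nat) (a : R -> R) (beta f : R -> R -> R[i]) (u0 : R -> R[i]).
Variables (mu S : R -> R) (G : R -> R[i]) (u : R -> R -> R[i]).
Hypothesis r_gt0 : (0 < r)%N.
Hypothesis Hbeta : smooth T (fun i j => i + j <= 1)%N beta.

(** The variational formulation without its source term; the pairs x and y take
    the places of u_t and u, or of a difference quotient and an average. *)
Definition schroedinger_form (t : R) (x y chi : V) : R :=
  a t * mu t * fe (rot (S t *: x + cmul (G t) y)) chi - a t * fb (rot y) chi
  + fm (rot (pmul (ubm T beta 0 0 t) (ubm T beta 0 1 t) y)) chi.

Lemma schroedinger_formB t x y x' y' chi :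
  schroedinger_form t (x - x') (y - y') chi =
  schroedinger_form t x y chi - schroedinger_form t x' y' chi.
Proof.
rewrite /schroedinger_form.
have JB p q : rot (p - q) = rot p - rot q.
  by rewrite /rot cmulD -scaleN1r cmulZ scaleN1r.
have gB z p q : cmul z (p - q) = cmul z p - cmul z q.
  by rewrite cmulD -scaleN1r cmulZ scaleN1r.
have bB F F' p q : pmul F F' (p - q) = pmul F F' p - pmul F F' q.
  rewrite pmulD; congr (_ + _); congr pair; apply: bmfun_ext => x0 /=; ring.
rewrite gB bB scalerBr addrACA -opprD !JB.
rewrite (sipBl fe_semi_inner) (sipBl fb_semi_inner) (sipBl fm_semi_inner); ring.
Qed.

Lemma Re_i_ip (v w : bmfun R) : ReC ('i%C * ip v w) = rip (fun x => 'i%C * v x) w.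
Proof.
rewrite !ReImE Im_ip mul0r mul1r sub0r -mulN1r.
rewrite -[rip v _]/(l2 v (bmfun_mul (bmfun_cst 'i%C) w)) /l2 /rip -IintZ; last first.
  exact: bmr_rdot (bmfun_bm _) (bmfun_bm _).
by apply: eq_Iint => x _; rewrite /rdot /= !ReImE; ring.
Qed.

Lemma Re_boundary_term (b c : R) (w z : R[i]) :
  ReC ('i%C * b%:C%C * c%:C%C * w * z^*%C) =
  b * c * (ReC ('i%C * w) * ReC z + ImC ('i%C * w) * ImC z).
Proof.
have -> : 'i%C * b%:C%C * c%:C%C * w * z^*%C = 'i%C * w * z^*%C * (b * c)%:C%C.
  by rewrite rmorphM; ring.
by rewrite ReC_mulR (ReCM ('i%C * w)) ReCconj ImCconj mulrN opprK mulrC.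
Qed.

Definition solution_pair (i : nat) (t : R) : V := (ubm T u i 0 t, ubm T u i 1 t).

(** The term with u_xx is integrated by parts: the boundary term at 1 is given
    by the dynamical boundary condition, the one at 0 vanishes with chi. *)
Lemma pde_weak_form t (chi : V) : solves T r a beta f u0 mu S G u ->
  t \in `[0, T] -> admissible M pt chi ->
  fm (solution_pair 1 t) chi =
  schroedinger_form t (solution_pair 1 t) (solution_pair 0 t) chi + rip (f t) chi.1.
Proof.
move=> [Hu pde u_0 bc _] tT [pchi chi0].
have I00 : solution_orders r 0 0 by exact: orders2.
have I01 : solution_orders r 0 1 by exact: orders2.
have I02 : solution_orders r 0 2 by exact: orders2.
have I10 : solution_orders r 1 0 by exact: orders2.
have J00 : (0 + 0 <= 1)%N by [].
pose iu (g : bmfun R) := bmfun_mul (bmfun_cst 'i%C) g.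
pose bu := iu (bmfun_mul (ubm T beta 0 0 t) (ubm T u 0 0 t)).
pose F : bmfun R := ubm T u 1 0 t - a t *: iu (ubm T u 0 2 t) - bu.
have fF : rip (f t) chi.1 = l2 F chi.1.
  apply: eq_Iint => x Dx; rewrite /rdot.
  have x1 : x \in `[0, 1] by exact: (subset_itv_oo_cc Dx).
  have -> : f t x = F x; last by [].
  have := pde t x tT x1; rewrite /F /bu /= !(ubmE Hu) // (ubmE Hbeta) //.
  rewrite /pd /= => ->; ring.
have l2s := @l2_semi_inner R.
have parts := pC1_parts Hp (pC1Z 'i%C (ubm_pC1 Hu Hp I01 I02 tT)) pchi.
rewrite [rdot _ chi.1 0](_ : _ = 0) in parts; last first.
  by rewrite /rdot chi0 !ReImE !mulr0 addr0.
rewrite subr0 -[rip _ chi.1]/(l2 (iu (ubm T u 0 2 t)) chi.1) in parts.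
rewrite -[rip _ chi.2]/(fb (rot (solution_pair 0 t)) chi) in parts.
have bdry : rdot (fun x => 'i%C * ubm T u 0 1 t x) chi.1 1 =
    mu t * fe (rot (S t *: solution_pair 1 t + cmul (G t) (solution_pair 0 t))) chi.
  have e := bc t tT; rewrite /fe /rdot /= !(ubmE Hu) //.
  rewrite -[pd T 0 1 u t 1]/(dx u t 1) e -[pd T 1 0 u t 1]/(dt T u t 1).
  by rewrite -[pd T 0 0 u t 1]/(u t 1) !ReImE; ring.
rewrite fF /F !(sipBl l2s) (sipZl l2s) /schroedinger_form.
rewrite -[fm (rot (pmul _ _ _)) chi]/(l2 bu chi.1) -[fm _ chi]/(l2 (ubm T u 1 0 t) chi.1).
have : a t * (l2 (iu (ubm T u 0 2 t)) chi.1 + fb (rot (solution_pair 0 t)) chi)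
  = a t * (mu t * fe (rot (S t *: solution_pair 1 t + cmul (G t) (solution_pair 0 t))) chi).
  by rewrite parts bdry.
lra.
Qed.

Lemma div_realC (z : R[i]) (k : R) : z / k%:C%C = (k^-1)%:C%C * z.
Proof. by rewrite mulrC fmorphV. Qed.

Lemma crank_nicolson_weak_form (t : nat -> R) (Sh : set (R -> R[i])) N (U : nat -> R -> R[i])
    n (V1 V0 chi : V) : crank_nicolson t a beta f u0 mu S G Sh N U ->
  (1 <= n <= N)%N -> midpoint t n \in `[0, T] ->
  (V1.1 : R -> R[i]) = U n -> (V0.1 : R -> R[i]) = U n.-1 ->
  pC1 V1.1 V1.2 -> pC1 V0.1 V0.2 -> Sh chi.1 -> pC1 chi.1 chi.2 ->
  let x := (step t n)^-1 *: (V1 - V0) in let y := 2^-1 *: (V1 + V0) in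
  fm x chi = schroedinger_form (midpoint t n) x y chi + rip (f (midpoint t n)) chi.1.
Proof.
move=> [_ _ cn] nN; set m := midpoint t n => mT V1E V0E p1 p0 Sc pchi x y.
have J00 : (0 + 0 <= 1)%N by [].
have qE : Defs.quotient t U n = x.1 :> (R -> R[i]).
  apply/funext => z; rewrite /Defs.quotient -V1E -V0E div_realC.
  by [].
have aE : Defs.average U n = y.1 :> (R -> R[i]).
  apply/funext => z; rewrite /Defs.average -V1E -V0E.
  have -> : (2 : R[i]) = (2 : R)%:C%C by rewrite rmorph_nat.
  by rewrite div_realC.
have py : pC1 y.1 y.2 := pC1Z _ (pC1D p1 p0).
have := cn n nN chi.1 Sc; rewrite -/m qE aE => /(congr1 (@complex.Re R)).
rewrite (Bform_weak_deriv (pC1_weak_deriv Hp py) (pC1_weak_deriv Hp pchi)).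
have -> : (fun x0 => beta m x0 * y.1 x0) =
    (bmfun_mul (ubm T beta 0 0 m) y.1 : R -> R[i]).
  by apply/funext => z /=; rewrite (ubmE Hbeta).
have aB (B : R[i]) : ReC ('i%C * (a m)%:C%C * B) = a m * ReC ('i%C * B).
  by rewrite mulrAC ReC_mulR mulrC.
rewrite Re_ip ReCD ReCD ReCD ReCN aB !Re_i_ip Re_ip.
rewrite -[rip x.1 chi.1]/(fm x chi) => ->; rewrite /schroedinger_form.
rewrite -[rip (fun=> _) chi.2]/(fb (rot y) chi).
rewrite -[rip (fun=> 'i%C * bmfun_mul _ _ _) chi.1]/(fm (rot (pmul (ubm T beta 0 0 m) (ubm T beta 0 1 m) y)) chi).
congr (_ - _ + _ + _).
exact: Re_boundary_term.
Qed.

End WeakForms.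

(** * The error estimate on a fixed mesh *)

Lemma increment_sub (R : pzRingType) (V : lmodType R) (p q p' q' : V) :
  (-1 *: p + q) - (-1 *: p' + q') = (q - q') - (p - p').
Proof. by rewrite !scaleN1r opprD opprK addrACA addrC opprB [- p + _]addrC. Qed.

Lemma sub_interchange (V : zmodType) (a b c d : V) :
  (a - b) - (c - d) = (a - c) - (b - d).
Proof. by rewrite !opprB [d - c]addrC addrACA [- b + d]addrC. Qed.

Lemma sub_shared (V : zmodType) (a b c : V) : (a + b) - (b + c) = a - c.
Proof. by rewrite opprD addrA addrK. Qed.

Lemma pmulB (R : realType) (f f' : bmfun R) (p q : bmfun R * bmfun R) :
  pmul f f' (p - q) = pmul f f' p - pmul f f' q.
Proof. by congr pair; apply: bmfun_ext => x /=; ring. Qed.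

Lemma rot_rot (R : realType) (p : bmfun R * bmfun R) : rot (rot p) = - p.
Proof.
have i2 (z : R[i]) : 'i%C * ('i%C * z) = - z by rewrite mulrA -expr2 sqr_i mulN1r.
by congr pair; apply: bmfun_ext => x; exact: i2.
Qed.

Lemma partition_in (R : realType) (b : R) M (p : nat -> R) n : is_partition b M p ->
  (n <= M)%N -> p n \in `[0, b].
Proof.
move=> [p0 pM p_lt] nM.
have p_le i k : (i <= k)%N -> (k <= M)%N -> p i <= p k.
  elim: k => [|k IH]; first by rewrite leqn0 => /eqP ->.
  rewrite leq_eqVlt => /predU1P[->//|ik kM].
  by apply: le_trans (ltW (p_lt _ kM)); apply: IH => //; exact: ltnW.
have := p_le _ _ nM (leqnn M); have := p_le _ _ (leq0n n) nM.
by rewrite in_itv /= p0 pM => -> ->.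
Qed.

Section FixedMesh.
Context {R : realType}.
Notation V := (bmfun R * bmfun R)%type.
Variables (r : nat) (h : R) (Sh : set (R -> R[i])) (M : nat) (pt : nat -> R).
Hypotheses (Sh_sub : Defs.subspace Sh) (Sh_fin : finite_dim Sh).
Hypothesis Sh_H1 : Sh `<=` sobolev0 1.
Hypothesis Hp : is_partition 1 M pt.
Hypothesis Sh_poly : Sh `<=` piecewise_poly r M pt.
Hypothesis Sh_id : exists2 v, Sh v & forall x, x \in `[0, 1] -> v x = x%:C%C.
Variables (c ci : R).
Hypotheses (c_ge0 : 0 <= c) (ci_ge0 : 0 <= ci) (h_gt0 : 0 < h).
Hypothesis Happ : forall s : nat, (s <= r)%N -> forall v, sobolev0 s.+1 v ->
  inf [set L2norm (v \- chi) + h * Hnorm 1 (v \- chi) | chi in Sh]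
    <= c * h ^+ s.+1 * Hnorm s.+1 v.
Hypothesis Hinv : forall phi, Sh phi -> H1semi phi <= ci * h^-1 * L2norm phi.
Hypothesis r_gt0 : (0 < r)%N.

Notation pC1 := (cpiecewise_C1 M pt).
Notation adm := (admissible M pt).
Notation fe_pair := (fe_pair Sh M pt).

Lemma ccontinuous_lin (k : R) (f g : bmfun R) : ccontinuous_on (`[0, 1] : set R) f ->
  ccontinuous_on (`[0, 1] : set R) g -> ccontinuous_on (`[0, 1] : set R) (k *: f + g).
Proof.
move=> [fr fi] [gr gi]; split.
  rewrite (_ : (fun x => _) = (fun x => k * ReC (f x) + ReC (g x))); last first.
    by apply/funext => x; rewrite /= !ReImE mul0r subr0.
  by move=> x; exact: (continuousD (continuousM (cvg_cst k) (fr x)) (gr x)).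
rewrite (_ : (fun x => _) = (fun x => k * ImC (f x) + ImC (g x))); last first.
  by apply/funext => x; rewrite /= !ReImE mul0r addr0.
by move=> x; exact: (continuousD (continuousM (cvg_cst k) (fi x)) (gi x)).
Qed.

(** The regularity required for the optimal order of the elliptic projection.
    It is stable under linear combinations, so that difference quotients and
    increments in time of u are covered as well. *)
Definition smooth_chain (d : nat -> bmfun R) :=
  [/\ forall l, (l <= r)%N -> pC1 (d l) (d l.+1), d 0%N 0 = 0 &
      ccontinuous_on (`[0, 1] : set R) (d 0%N)].

Lemma smooth_chain_lin (k : R) d d' : smooth_chain d -> smooth_chain d' ->
  smooth_chain (fun l => k *: d l + d' l).
Proof.
move=> [dp d0 dc] [dp' d0' dc']; split.
- by move=> l lr; exact: (pC1D (pC1Z k%:C%C (dp l lr)) (dp' l lr)).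
- by rewrite /= d0 d0' mulr0 addr0.
- exact: ccontinuous_lin.
Qed.

Lemma smooth_chain0 : smooth_chain (fun=> 0).
Proof.
split=> // [l _|]; first exact: pC1_cst.
by split=> x; exact: cvg_cst.
Qed.

(** The factor r + 2 bounds the H^(r+1) norm, a sum over r + 2 derivatives, by
    their maximum. *)
Definition ritz_H1 : R := c * r.+2%:R.
Definition ritz_L2 : R := 5 * c * ritz_H1.

Lemma ritz_H1_ge0 : 0 <= ritz_H1. Proof. exact: mulr_ge0. Qed.
Lemma ritz_L2_ge0 : 0 <= ritz_L2.
Proof. by rewrite mulr_ge0 ?ritz_H1_ge0 // mulr_ge0. Qed.

Lemma elliptic_projection_bounds (d : nat -> bmfun R) (w : V) (Q : R) :
  smooth_chain d -> fe_pair w ->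
  (forall chi, fe_pair chi -> fb ((d 0%N, d 1%N) - w) chi = 0) ->
  (forall l, (l <= r.+1)%N -> nrm l2 (d l) <= Q) ->
  [/\ nrm fb ((d 0%N, d 1%N) - w) <= ritz_H1 * h ^+ r * Q,
      nrm fm ((d 0%N, d 1%N) - w) <= ritz_L2 * h ^+ r.+1 * Q &
      nrm fe ((d 0%N, d 1%N) - w) = 0].
Proof.
move=> [dp d0 dc] Sw orth dQ; set v := (d 0%N, d 1%N).
have Q0 : 0 <= Q by apply: le_trans (nrm_ge0 l2 (d 0%N)) (dQ _ _).
have av : adm v by split=> //; exact: dp.
have wc : weak_chain r.+1 (fun l => d l : R -> R[i]).
  split; first exact: bm_L2 (bmfun_bm _).
  by move=> l lr; exact: (pC1_weak_deriv Hp (dp l lr)).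
have cn : chain_norm r.+1 (fun l => d l : R -> R[i]) <= r.+2%:R * Q.
  rewrite -[leRHS]ger0_norm ?mulr_ge0 // -sqrtr_sqr; apply: ler_wsqrtr.
  apply: le_trans (_ : \sum_(l < r.+2) Q ^+ 2 <= _).
    apply: ler_sum => l _; rewrite L2norm_bmfun lerXn2r ?nnegrE ?nrm_ge0 //.
    by apply: dQ; rewrite -ltnS.
  rewrite sumr_const card_ord -[leLHS]mulr_natl exprMn ler_wpM2r ?sqr_ge0 // expr2.
  by rewrite ler_pMr ?ltr0n // ler1n.
have Hb : nrm fb (v - w) <= ritz_H1 * h ^+ r * Q.
  apply: le_trans (elliptic_projection_H1 Sh_sub Hp Sh_poly h_gt0 Happ (leqnn r) wc
    (erefl : (fun l => d l : R -> R[i]) 0%N = v.1) av dc Sw orth) _.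
  rewrite /ritz_H1; have ch : 0 <= c * h ^+ r by rewrite mulr_ge0 // exprn_ge0 // ltW.
  by have := ler_wpM2l ch cn; lra.
have aw := fe_pair_adm Sh_H1 Sw.
have arho : adm (v - w).
  by have := admissible_lin (-1) aw av; rewrite scaleN1r addrC.
have cw : ccontinuous_on (`[0, 1] : set R) w.1 by case: Sw => /Sh_H1[].
have crho : ccontinuous_on (`[0, 1] : set R) (v - w).1.
  by have := ccontinuous_lin (-1) cw dc; rewrite scaleN1r addrC.
split=> //.
  have := elliptic_projection_L2 Sh_sub Hp Sh_poly c_ge0 h_gt0 Happ arho crho r_gt0 orth.
  move=> /le_trans; apply.
  have ch : 0 <= 5 * c * h by rewrite !mulr_ge0 // ltW.
  by have := ler_wpM2l ch Hb; rewrite /ritz_L2 exprS; lra.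
rewrite nrm_fe (elliptic_error_at_1 Sh_sub Hp Sh_poly Sh_id arho orth).
by apply/eqP; rewrite -(eqrXn2 (n := 2)) ?cabs_ge0 // cabsE !ReImE expr0n addr0.
Qed.

Variables (T : R) (a : R -> R) (beta : R -> R -> R[i]) (mu S : R -> R) (G : R -> R[i]).
Hypothesis T0 : 0 < T.
Hypothesis a_neq0 : forall t, t \in `[0, T] -> a t != 0.
Hypothesis Hbeta : smooth T (fun i j => i + j <= 1)%N beta.
Variables (A A1 mu1 s0 s1 g1 B1 B2 Lb : R).
Hypothesis CB : coef_bounds T a beta mu S G A A1 mu1 s0 s1 g1 B1 B2 Lb.

Definition projection_constant : R := (3 * c * (ci + 1) + 1) * (2 * B2 + B1).

(** The function q of the energy step. Multiplication by beta is bounded in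
    H^1, and so is the L^2 projection. *)
Lemma beta_projection t (p : V) : t \in `[0, T] -> fe_pair p ->
  exists q, [/\ fe_pair q,
    forall chi, fe_pair chi -> fm (pmul (ubm T beta 0 0 t) (ubm T beta 0 1 t) p - q) chi = 0 &
    nrm fb q <= projection_constant * nrm fb p].
Proof.
move=> tT Sp; have ap := fe_pair_adm Sh_H1 Sp.
have I00 : (0 + 0 <= 1)%N by []. have I01 : (0 + 1 <= 1)%N by [].
have bp : pC1 (ubm T beta 0 0 t) (ubm T beta 0 1 t) by exact: (ubm_pC1 Hbeta Hp I00 I01 tT).
have abp := admissible_pmul bp ap.
have [[A0 A10 mu10 s00] [s10 g10 B10 B20 Lb0]] := cb_ge0 CB.
have [cr cim] : ccontinuous_on (`[0, 1] : set R) (ubm T beta 0 0 t).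
  by rewrite (ubmE Hbeta I00 tT); exact: (pd_continuous Hbeta I00 tT).
have [pr pim] : ccontinuous_on (`[0, 1] : set R) p.1 by case: Sp => /Sh_H1[].
have cbp : ccontinuous_on (`[0, 1] : set R) (pmul (ubm T beta 0 0 t) (ubm T beta 0 1 t) p).1.
  split.
    rewrite (_ : (fun x => _) = (fun x => ReC (ubm T beta 0 0 t x) * ReC (p.1 x)
        + - (ImC (ubm T beta 0 0 t x) * ImC (p.1 x)))); last first.
      by apply/funext => x; rewrite /= !ReImE.
    by move=> x; exact: (continuousD (continuousM (cr x) (pr x))
      (continuousN (continuousM (cim x) (pim x)))).
  rewrite (_ : (fun x => _) = (fun x => ReC (ubm T beta 0 0 t x) * ImC (p.1 x)
      + ImC (ubm T beta 0 0 t x) * ReC (p.1 x))); last first.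
    by apply/funext => x; rewrite /= !ReImE.
  by move=> x; exact: (continuousD (continuousM (cr x) (pim x)) (continuousM (cim x) (pr x))).
have [q [Sq qE qb]] := l2_projection_stable Sh_sub Sh_fin Hp Sh_poly c_ge0 ci_ge0 h_gt0
  Happ Hinv abp cbp.
exists q; split=> //; apply: le_trans qb _.
have := fb_pmul_le p B10 B20 (fun x => cb_beta CB tT) (fun x => cb_beta_x CB tT).
have := ler_wpM2l B20 (fm_le_fb Hp ap) => h1 h2.
have h3 : nrm fb (pmul (ubm T beta 0 0 t) (ubm T beta 0 1 t) p) <= (2 * B2 + B1) * nrm fb p.
  lra.
rewrite /projection_constant -[leRHS]mulrA ler_wpM2l //.
by rewrite addr_ge0 // !mulr_ge0 // addr_ge0.
Qed.

Variables (f : R -> R -> R[i]) (u0 : R -> R[i]) (u : R -> R -> R[i]).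
Hypothesis sol : solves T r a beta f u0 mu S G u.
Notation X := (Xi T r u).
Notation cu := (solution_pair T u).

Let Hu : smooth T (solution_orders r) u. Proof. by case: sol. Qed.

Let du (s : R) (l : nat) : bmfun R := ubm T u 0 l s.

Let du_chain s : s \in `[0, T] -> smooth_chain (du s).
Proof.
move=> sT; have I00 : solution_orders r 0 0 by exact: orders2.
split.
- by move=> l lr; apply: (ubm_pC1 Hu Hp) => //; apply: orders2 => //; exact: ltnW.
- by rewrite /du (ubmE Hu I00 sT); case: sol => _ _ /(_ s sT).
- by rewrite /du (ubmE Hu I00 sT); exact: (pd_continuous Hu I00 sT).
Qed.

Let chain_curve l : (l <= r.+1)%N -> weak_curve T 2 l2 (fun i s => ubm T u i l s).
Proof.
move=> lr i phi i2; apply: (ubm_curve Hu); apply: orders2 => //; exact: ltnW.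
Qed.

Let fm_curve : weak_curve T 4 fm cu.
Proof.
move=> i phi i4; apply: (ubm_curve Hu).
  by move: i i4 => [|[|[|[|]]]] //= _; rewrite /solution_orders ?orbT.
by move: i i4 => [|[|[|[|]]]] //= _; rewrite /solution_orders ?orbT.
Qed.

Let fb_curve : weak_curve T 3 fb cu.
Proof.
move=> i phi i3; apply: (ubm_curve Hu).
  by move: i i3 => [|[|[|]]] //= _; rewrite /solution_orders ?orbT.
by move: i i3 => [|[|[|]]] //= _; rewrite /solution_orders ?orbT.
Qed.

Let fe_curve : weak_curve T 3 fe cu.
Proof.
move=> i phi i3; apply: (ubm_value_curve Hu (phi.1 1)).
- by rewrite in_itv /= ler01 lexx.
- by move: i i3 => [|[|[|]]] //= _; rewrite /solution_orders ?orbT.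
- by move: i i3 => [|[|[|]]] //= _; rewrite /solution_orders ?orbT.
Qed.

Let fm2 s : s \in `[0, T] -> nrm fm (cu 2 s) <= X.
Proof. by move=> sT; exact: (Xi_ge2 T0 Hu). Qed.
Let fm3 s : s \in `[0, T] -> nrm fm (cu 3 s) <= X.
Proof. by move=> sT; exact: (Xi_ge3 T0 Hu). Qed.
Let fm4 s : s \in `[0, T] -> nrm fm (cu 4 s) <= X.
Proof. by move=> sT; exact: (Xi_ge4 T0 Hu). Qed.
Let fb2 s : s \in `[0, T] -> nrm fb (cu 2 s) <= X.
Proof. by move=> sT; exact: (Xi_ge2 T0 Hu). Qed.
Let fb3 s : s \in `[0, T] -> nrm fb (cu 3 s) <= X.
Proof. by move=> sT; exact: (Xi_ge3 T0 Hu). Qed.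
Let fe3 s : s \in `[0, T] -> nrm fe (cu 3 s) <= X.
Proof. by move=> sT; rewrite nrm_fe; exact: (Xi_ge_value T0 Hu). Qed.
Let X0 : 0 <= X. Proof. exact: Xi_ge0 T0 Hu. Qed.

Variables (N : nat) (t : nat -> R) (Cs : R).
Hypothesis Ht : is_partition T N t.
Hypothesis Cs0 : 0 <= Cs.
Hypothesis Hstep : forall n, (1 <= n <= N.-1)%N ->
  `|step t n.+1 - step t n| <= Cs * Num.max (step t n ^+ 2) (step t n.+1 ^+ 2).
Notation K := (max_step t N).

Let t_lt n : (n < N)%N -> t n < t n.+1. Proof. by case: Ht => _ _; exact. Qed.

Let t_in n : (n <= N)%N -> t n \in `[0, T]. Proof. exact: partition_in. Qed.

Let mid n := midpoint t n.+1.

Let mid_T n : (n < N)%N -> mid n \in `[0, T].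
Proof. by move=> nN; apply: mid_in; apply: t_in => //; exact: ltnW. Qed.

Let step_le n : (n < N)%N -> t n.+1 - t n <= K.
Proof.
move=> nN; rewrite /max_step; apply: (le_bigmax_seq 0 n.+1 xpredT (step t)) => //.
by rewrite mem_index_iota /= ltnS.
Qed.

Let K0 : 0 <= K.
Proof. by rewrite /max_step; elim/big_rec: _ => // n x _ x0; rewrite le_max x0 orbT. Qed.

Let kk n : (n.+1 < N)%N ->
  `|(t n.+2 - t n.+1) - (t n.+1 - t n)| <= Cs * K * (t n.+2 - t n).
Proof.
move=> nN; have nN' : (n < N)%N by exact: ltnW.
have nN1 : (0 < n.+1 <= N.-1)%N.
  by rewrite andTb -ltnS prednK //; exact: leq_trans nN'.
have := Hstep nN1.
rewrite /step /= => /le_trans; apply; rewrite -mulrA ler_wpM2l //.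
have h0 := t_lt nN'; have h1 := t_lt nN; have l0 := step_le nN'; have l1 := step_le nN.
rewrite ge_max !expr2; apply/andP; split; apply: ler_pM; lra.
Qed.

Variables (Uv W : nat -> V).
Hypothesis SUv : forall n, (n <= N)%N -> fe_pair (Uv n).
Hypothesis SW : forall n, (n <= N)%N -> fe_pair (W n).
Hypothesis WE : forall n, (n <= N)%N -> forall chi, fe_pair chi ->
  fb (cu 0 (t n) - W n) chi = 0.

(* For the step from t n to t n.+1, xr and yr are the errors that the
   difference quotient and the average of W make in place of u_t and u at the
   midpoint; ta and dl are the parts of them that come from the time
   discretization alone. *)
Let th n := Uv n - W n.
Let kn n := (t n.+1 - t n)^-1.
Let xr n := kn n *: (W n.+1 - W n) - cu 1 (mid n).
Let yr n := 2^-1 *: (W n.+1 + W n) - cu 0 (mid n).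
Let dl n := time_average (cu 0) (t n) (t n.+1) - cu 0 (mid n).
Let ta n := diff_quotient (cu 0) (t n) (t n.+1) - cu 1 (mid n).
Let bop n := pmul (ubm T beta 0 0 (mid n)) (ubm T beta 0 1 (mid n)).
Let gop n := cmul (G (mid n)).

Hypothesis th0 : th 0 = 0.
Hypothesis Hcn : forall n, (n < N)%N -> forall chi, fe_pair chi ->
  fm (kn n *: (Uv n.+1 - Uv n)) chi =
  schroedinger_form T a beta mu S G (mid n) (kn n *: (Uv n.+1 - Uv n))
     (2^-1 *: (Uv n.+1 + Uv n)) chi + rip (f (mid n)) chi.1.

Let H := h ^+ r.+1.
Let H0 : 0 <= H. Proof. by rewrite exprn_ge0 // ltW. Qed.

Let rho_bounds n : (n <= N)%N ->
  [/\ nrm fb (cu 0 (t n) - W n) <= ritz_H1 * h ^+ r * X,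
      nrm fm (cu 0 (t n) - W n) <= ritz_L2 * H * X &
      nrm fe (cu 0 (t n) - W n) = 0].
Proof.
move=> nN; apply: (elliptic_projection_bounds (d := du (t n))).
- exact: du_chain (t_in nN).
- exact: SW.
- exact: WE.
- by move=> l lr; apply: (Xi_ge2 T0 Hu) => //; exact: t_in.
Qed.

Let dW n := kn n *: (W n.+1 - W n).
Let du_quot n := diff_quotient (cu 0) (t n) (t n.+1).

Let fe_dW n : (n < N)%N -> fe_pair (dW n).
Proof.
move=> nN; have := fe_pair_lin Sh_sub (kn n) (fe_pairB Sh_sub (SW nN) (SW (ltnW nN)))
  (fe_pair0 M pt Sh_sub).
by rewrite addr0.
Qed.

Let dW_orth n : (n < N)%N -> forall chi, fe_pair chi -> fb (du_quot n - dW n) chi = 0.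
Proof.
move=> nN chi Sc; have e1 := WE nN Sc; have e0 := WE (ltnW nN) Sc.
move: e1 e0; rewrite /du_quot /dW /diff_quotient -/(kn n) -scalerBr.
rewrite (sipZl fb_semi_inner) !(sipBl fb_semi_inner) => e1 e0.
by rewrite (subr0_eq e1) (subr0_eq e0) subrr mulr0.
Qed.

Let du_quot_chain n : (n < N)%N ->
  smooth_chain (fun l => diff_quotient (fun s => du s l) (t n) (t n.+1)).
Proof.
move=> nN; have c1 := du_chain (t_in nN); have c0 := du_chain (t_in (ltnW nN)).
have := smooth_chain_lin (kn n) c1 (smooth_chain_lin (- kn n) c0 smooth_chain0).
congr smooth_chain; apply/funext => l.
by rewrite /diff_quotient -/(kn n) addr0 scaleNr -scalerBr.
Qed.

Let t_neq n : (n < N)%N -> t n != t n.+1.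
Proof. by move=> nN; rewrite lt_eqF // t_lt. Qed.

Let rhoq_bounds n : (n < N)%N ->
  nrm fm (du_quot n - dW n) <= ritz_L2 * H * X /\ nrm fe (du_quot n - dW n) = 0.
Proof.
move=> nN; have [] // := elliptic_projection_bounds (Q := X) (du_quot_chain nN) (fe_dW nN) (dW_orth nN).
move=> l lr; apply: (curve_quotient_le (@l2_semi_inner R) (weak_curveW _ (chain_curve lr))) => //.
- exact: t_neq.
- by move=> s sT; exact: (Xi_ge2 T0 Hu).
- exact: t_in (ltnW nN).
- exact: t_in.
Qed.

(** Two successive difference quotients of u differ by at most X times the two
    steps together, and so do their spatial derivatives; the projection error
    of the difference is proportional to that. *)
Let rhoq_diff n : (n.+1 < N)%N ->
  nrm fm ((du_quot n.+1 - dW n.+1) - (du_quot n - dW n))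
    <= ritz_L2 * H * ((t n.+2 - t n) * X).
Proof.
move=> nN; have nN' : (n < N)%N by exact: ltnW.
have ch := smooth_chain_lin (-1) (du_quot_chain nN') (du_quot_chain nN).
have Sd : fe_pair (-1 *: dW n + dW n.+1) by apply: fe_pair_lin => //; exact: fe_dW.
have vE : (-1 *: du_quot n + du_quot n.+1) - (-1 *: dW n + dW n.+1) =
    (du_quot n.+1 - dW n.+1) - (du_quot n - dW n).
  exact: increment_sub.
have orth chi : fe_pair chi ->
    fb ((-1 *: du_quot n + du_quot n.+1) - (-1 *: dW n + dW n.+1)) chi = 0.
  move=> Sc; rewrite vE (sipBl fb_semi_inner) (dW_orth nN Sc) (dW_orth nN' Sc).
  by rewrite subrr.
rewrite -vE; have [] // := elliptic_projection_bounds (Q := (t n.+2 - t n) * X) ch Sd orth.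
move=> l lr; rewrite scaleN1r addrC.
apply: (curve_quotient_diff_le (@l2_semi_inner R) _ _ _ _ _ (chain_curve lr)).
- exact: t_in (ltnW nN').
- exact: t_in nN'.
- exact: t_in nN.
- exact: t_lt nN'.
- exact: t_lt nN.
- by move=> s sT; exact: (Xi_ge2 T0 Hu).
Qed.

Let rho_jump n : (n.+1 < N)%N ->
  nrm fm ((cu 0 (t n.+2) - W n.+2) - (cu 0 (t n) - W n))
    <= ritz_L2 * H * ((t n.+2 - t n) * X).
Proof.
move=> nN; have nN' : (n < N)%N by exact: ltnW.
have ch := smooth_chain_lin (-1) (du_chain (t_in (ltnW nN'))) (du_chain (t_in nN)).
have Sd : fe_pair (-1 *: W n + W n.+2).
  by apply: fe_pair_lin => //; apply: SW => //; exact: ltnW.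
have vE : (-1 *: cu 0 (t n) + cu 0 (t n.+2)) - (-1 *: W n + W n.+2) =
    (cu 0 (t n.+2) - W n.+2) - (cu 0 (t n) - W n).
  exact: increment_sub.
have orth chi : fe_pair chi ->
    fb ((-1 *: cu 0 (t n) + cu 0 (t n.+2)) - (-1 *: W n + W n.+2)) chi = 0.
  move=> Sc; rewrite vE (sipBl fb_semi_inner) (WE nN Sc) (WE (ltnW nN') Sc).
  by rewrite subrr.
rewrite -vE; have [] // := elliptic_projection_bounds (Q := (t n.+2 - t n) * X) ch Sd orth.
move=> l lr; rewrite scaleN1r addrC.
have tt : t n < t n.+2 := lt_trans (t_lt nN') (t_lt nN).
have := curve_lipschitz (@l2_semi_inner R) (weak_curveW (isT : (1 <= 2)%N) (chain_curve lr))
  (M := X) (q := t n) (x := t n.+2).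
rewrite gtr0_norm ?subr_gt0 //; apply.
- by move=> s sT; exact: (Xi_ge2 T0 Hu).
- exact: t_in (ltnW nN').
- exact: t_in nN.
Qed.

Let E := (K ^+ 2 + H) * X.
Let Cr := ritz_L2.
Let Cr0 : 0 <= Cr. Proof. exact: ritz_L2_ge0. Qed.

Let E0 : 0 <= E.
Proof. by rewrite mulr_ge0 // addr_ge0 // sqr_ge0. Qed.

Let K2X : K ^+ 2 * X <= E.
Proof. by rewrite ler_wpM2r // lerDl. Qed.

Let HX : Cr * H * X <= Cr * E.
Proof. by rewrite -mulrA ler_wpM2l // ler_wpM2r // lerDr sqr_ge0. Qed.

Let step_sq n : (n < N)%N -> (t n.+1 - t n) ^+ 2 * X <= E.
Proof.
move=> nN; apply: le_trans K2X; rewrite ler_wpM2r //.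
by rewrite lerXn2r ?nnegrE ?subr_ge0 ?(ltW (t_lt nN)) ?step_le.
Qed.

Let kap n := t n.+2 - t n.
Let kap_ge0 n : (n.+1 < N)%N -> 0 <= kap n.
Proof. by move=> nN; rewrite subr_ge0 ltW // (lt_trans (t_lt (ltnW nN))) ?t_lt. Qed.

(** The approximate time derivative and average of W minus the exact ones split
    into a consistency error and an elliptic projection error. *)
Let xrE n : xr n = ta n - (du_quot n - dW n).
Proof. by rewrite /xr /ta -/(du_quot n) -/(dW n) opprB [RHS]addrC subrKA. Qed.

Let yrE n : yr n = dl n
  - 2^-1 *: ((cu 0 (t n.+1) - W n.+1) + (cu 0 (t n) - W n)).
Proof.
by rewrite /yr /dl /time_average addrACA -opprD scalerBr opprB [RHS]addrC subrKA.
Qed.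

Let ta_le (p : V -> V -> R) n : semi_inner p -> weak_curve T 3 p cu ->
  (forall s, s \in `[0, T] -> nrm p (cu 3 s) <= X) -> (n < N)%N ->
  nrm p (ta n) <= 2 * E.
Proof.
move=> Hp' wc pX nN.
apply: le_trans (curve_midpoint_le Hp' wc (t_neq nN) pX (t_in (ltnW nN)) (t_in nN)) _.
by rewrite -mulrA ler_wpM2l // step_sq.
Qed.

Let dl_le (p : V -> V -> R) n : semi_inner p -> weak_curve T 2 p cu ->
  (forall s, s \in `[0, T] -> nrm p (cu 2 s) <= X) -> (n < N)%N ->
  nrm p (dl n) <= E.
Proof.
move=> Hp' wc pX nN.
apply: le_trans (curve_average_le Hp' wc pX (t_in (ltnW nN)) (t_in nN)) _.
exact: step_sq.
Qed.

Let ta_fm n : (n < N)%N -> nrm fm (ta n) <= 2 * E.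
Proof. exact: (ta_le fm_semi_inner (weak_curveW (isT : (3 <= 4)%N) fm_curve) fm3). Qed.
Let ta_fe n : (n < N)%N -> nrm fe (ta n) <= 2 * E.
Proof. exact: (ta_le fe_semi_inner fe_curve fe3). Qed.
Let dl_fm n : (n < N)%N -> nrm fm (dl n) <= E.
Proof. exact: (dl_le fm_semi_inner (weak_curveW (isT : (2 <= 4)%N) fm_curve) fm2). Qed.
Let dl_fb n : (n < N)%N -> nrm fb (dl n) <= E.
Proof. exact: (dl_le fb_semi_inner (weak_curveW (isT : (2 <= 3)%N) fb_curve) fb2). Qed.

(** dl vanishes at x = 0, so its value at 1 is bounded by its H^1 seminorm. *)
Let dl_fe n : (n < N)%N -> nrm fe (dl n) <= E.
Proof.
move=> nN; apply: le_trans (dl_fb nN); apply: (fe_le_fb Hp).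
have acu s : s \in `[0, T] -> adm (cu 0 s).
  by move=> sT; have [d0 d00 _] := du_chain sT; split=> //; exact: d0.
have a0 : adm 0 by split=> //; exact: pC1_cst.
have := admissible_lin 2^-1 (acu _ (t_in nN)) (admissible_lin 2^-1 (acu _ (t_in (ltnW nN))) a0).
move=> /(admissible_lin (-1) (acu _ (mid_T nN))).
by rewrite addr0 -scalerDr scaleN1r addrC.
Qed.

Let half_le (p : V -> V -> R) v w Q : semi_inner p -> nrm p v <= Q -> nrm p w <= Q ->
  nrm p (2^-1 *: (v + w)) <= Q.
Proof.
move=> Hp' vQ wQ; rewrite (nrmZ Hp') ger0_norm ?invr_ge0 // ler_pdivrMl //.
by apply: le_trans (nrmD Hp' _ _) _; rewrite mulr_natl mulr2n lerD.
Qed.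

Let xr_fm n : (n < N)%N -> nrm fm (xr n) <= (2 + Cr) * E.
Proof.
move=> nN; have [h1 _] := rhoq_bounds nN; rewrite xrE mulrDl.
apply: le_trans (nrmB fm_semi_inner _ _) (lerD (ta_fm nN) _).
exact: le_trans h1 HX.
Qed.

Let yr_fm n : (n < N)%N -> nrm fm (yr n) <= (1 + Cr) * E.
Proof.
move=> nN; have [_ h1 _] := rho_bounds nN; have [_ h0 _] := rho_bounds (ltnW nN).
rewrite yrE mulrDl mul1r.
apply: le_trans (nrmB fm_semi_inner _ _) (lerD (dl_fm nN) _).
by apply: le_trans HX; exact: (half_le fm_semi_inner).
Qed.

Let xr_fe n : (n < N)%N -> nrm fe (xr n) <= 2 * E.
Proof.
move=> nN; have [_ h1] := rhoq_bounds nN; rewrite xrE.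
by apply: le_trans (nrmB fe_semi_inner _ _) _; rewrite h1 addr0 ta_fe.
Qed.

Let yr_fe n : (n < N)%N -> nrm fe (yr n) <= E.
Proof.
move=> nN; have [_ _ h1] := rho_bounds nN; have [_ _ h0] := rho_bounds (ltnW nN).
rewrite yrE; apply: le_trans (nrmB fe_semi_inner _ _) _.
rewrite -[leRHS]addr0; apply: lerD (dl_fe nN) _.
by apply: (half_le fe_semi_inner); rewrite ?h1 ?h0.
Qed.

Let bop_le n v : (n < N)%N -> nrm fm (bop n v) <= B1 * nrm fm v.
Proof.
move=> nN; have [_ [_ _ B10 _ _]] := cb_ge0 CB.
by apply: fm_pmul_le => // x; apply: (cb_beta CB); exact: mid_T.
Qed.

Let gop_le n v : (n < N)%N -> nrm fe (gop n v) <= g1 * nrm fe v.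
Proof.
move=> nN; apply: le_trans (fe_cmul_le _ _) _; rewrite ler_wpM2r ?nrm_ge0 //.
by apply: (cb_G CB); exact: mid_T.
Qed.

Let boundary_le n : (n < N)%N -> nrm fe (S (mid n) *: xr n + gop n (yr n)) <= (2 * s1 + g1) * E.
Proof.
move=> nN; have [[_ _ _ s00] [s10 g10 _ _ _]] := cb_ge0 CB.
have /andP[sS Ss] := cb_S CB (mid_T nN).
apply: le_trans (nrmD fe_semi_inner _ _) _; rewrite (nrmZ fe_semi_inner) mulrDl.
apply: lerD; last by apply: le_trans (gop_le _ nN) _; rewrite ler_wpM2l ?yr_fe.
rewrite -mulrA mulrCA ger0_norm ?(le_trans (ltW s00)) //.
apply: ler_pM; rewrite ?nrm_ge0 ?xr_fe //; exact: le_trans (ltW s00) sS.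
Qed.

Let residual_le n : (n < N)%N ->
  nrm fm (residual rot (bop n) (xr n) (yr n)) <= ((B1 + 1) * (Cr + 1) + 1) * E.
Proof.
move=> nN; have [_ [_ _ B10 _ _]] := cb_ge0 CB.
apply: le_trans (nrmB fm_semi_inner _ _) _; rewrite (nrm_rotation _ rotation_fm).
apply: le_trans (lerD (bop_le _ nN) (xr_fm nN)) _.
apply: le_trans (lerD (ler_wpM2l B10 (yr_fm nN)) (lexx _)) _.
rewrite mulrA -mulrDl ler_wpM2r //.
by rewrite le_eqVlt; apply/orP; left; apply/eqP; ring.
Qed.

Let scale_le b k : 0 <= b -> 0 <= k -> K ^+ 2 * k * (Cs * X + b * X) <= (Cs + b) * E * k.
Proof.
move=> b0 k0; have -> : K ^+ 2 * k * (Cs * X + b * X) = (Cs + b) * (K ^+ 2 * X) * k by ring.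
by rewrite ler_wpM2r // ler_wpM2l // addr_ge0.
Qed.

Let HXk k : 0 <= k -> Cr * H * (k * X) <= Cr * E * k.
Proof. by move=> k0; rewrite [k * X]mulrC mulrA ler_wpM2r. Qed.

Let ta_diff n : (n.+1 < N)%N -> nrm fm (ta n.+1 - ta n) <= (Cs + 2) * E * kap n.
Proof.
move=> nN; have nN' : (n < N)%N by exact: ltnW.
apply: le_trans (curve_midpoint_diff_le fm_semi_inner (t_in (ltnW nN')) (t_in nN') (t_in nN)
  (t_lt nN') (t_lt nN) (step_le nN') (step_le nN) K0 Cs0 (kk nN) fm_curve fm3 fm4) _.
exact: scale_le (kap_ge0 nN).
Qed.

Let dl_diff (p : V -> V -> R) n : semi_inner p -> weak_curve T 3 p cu ->
  (forall s, s \in `[0, T] -> nrm p (cu 2 s) <= X) ->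
  (forall s, s \in `[0, T] -> nrm p (cu 3 s) <= X) -> (n.+1 < N)%N ->
  nrm p (dl n.+1 - dl n) <= (Cs + 1) * E * kap n.
Proof.
move=> Hp' wc p2 p3 nN; have nN' : (n < N)%N by exact: ltnW.
apply: le_trans (curve_average_diff_le Hp' (t_in (ltnW nN')) (t_in nN') (t_in nN)
  (t_lt nN') (t_lt nN) (step_le nN') (step_le nN) K0 Cs0 (kk nN) wc p2 p3) _.
by have := scale_le ler01 (kap_ge0 nN); rewrite mul1r.
Qed.

Let xr_diff n : (n.+1 < N)%N -> nrm fm (xr n.+1 - xr n) <= (Cs + 2 + Cr) * E * kap n.
Proof.
move=> nN; rewrite !xrE sub_interchange mulrDl [leRHS]mulrDl.
apply: le_trans (nrmB fm_semi_inner _ _) (lerD (ta_diff nN) _).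
exact: le_trans (rhoq_diff nN) (HXk (kap_ge0 nN)).
Qed.

Let yr_diff n : (n.+1 < N)%N -> nrm fm (yr n.+1 - yr n) <= (Cs + 1 + Cr) * E * kap n.
Proof.
move=> nN; rewrite !yrE sub_interchange mulrDl [leRHS]mulrDl -scalerBr.
rewrite (sub_shared (cu 0 (t n.+2) - W n.+2)).
have wc := weak_curveW (isT : (3 <= 4)%N) fm_curve.
apply: le_trans (nrmB fm_semi_inner _ _) (lerD (dl_diff fm_semi_inner wc fm2 fm3 nN) _).
apply: le_trans (le_trans (rho_jump nN) (HXk (kap_ge0 nN))).
rewrite (nrmZ fm_semi_inner) ler_piMl ?nrm_ge0 // ger0_norm ?invr_ge0 //.
by rewrite invf_le1 // ler1n.
Qed.

Let mid_diff n : (n.+1 < N)%N -> `|mid n.+1 - mid n| <= kap n.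
Proof.
move=> nN; have h0 := t_lt (ltnW nN); have h1 := t_lt nN; rewrite /mid /midpoint /kap /=.
by rewrite ger0_norm; lra.
Qed.

Let bop_diff n v : (n.+1 < N)%N ->
  nrm fm (bop n.+1 v - bop n v) <= Lb * kap n * nrm fm v.
Proof.
move=> nN; have [_ [_ _ _ _ Lb0]] := cb_ge0 CB; have nN' := ltnW nN.
apply: fm_pmulB_le => [|x Dx]; first by rewrite mulr_ge0 ?kap_ge0.
apply: le_trans (cb_beta_lip CB (mid_T nN) (mid_T nN') Dx) _.
by rewrite ler_wpM2l ?mid_diff.
Qed.

(** The bound for the change of the consistency error from one step to the
    next: by the change of beta, of yr and of xr. *)
Definition residual_lipschitz : R :=
  Lb * (1 + Cr) + B1 * (Cs + 1 + Cr) + (Cs + 2 + Cr).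

Let residual_diff n : (n.+1 < N)%N ->
  nrm fm (residual rot (bop n.+1) (xr n.+1) (yr n.+1) - residual rot (bop n) (xr n) (yr n))
    <= residual_lipschitz * E * kap n.
Proof.
move=> nN; have [_ [_ _ B10 _ Lb0]] := cb_ge0 CB; have nN' := ltnW nN.
rewrite /residual sub_interchange /residual_lipschitz mulrDl [leRHS]mulrDl.
apply: le_trans (nrmB fm_semi_inner _ _) (lerD _ (xr_diff nN)).
rewrite -scaleN1r -cmulZ -cmulD scaleN1r (nrm_rotation _ rotation_fm).
rewrite -(subrKA (bop n.+1 (yr n))) addrC mulrDl [leRHS]mulrDl.
apply: le_trans (nrmD fm_semi_inner _ _) _.
apply: lerD.
  apply: le_trans (bop_diff _ nN) _.
  rewrite -mulrA [kap n * _]mulrC mulrA ler_wpM2r ?kap_ge0 //.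
  by rewrite -mulrA ler_wpM2l // yr_fm.
rewrite -pmulB.
apply: le_trans (bop_le _ nN) _.
apply: le_trans (ler_wpM2l B10 (yr_diff nN)) _.
by rewrite le_eqVlt; apply/orP; left; apply/eqP; ring.
Qed.

(** Subtracting the weak form satisfied by u at the midpoint from the scheme. *)
Let error_equation n : (n < N)%N -> forall chi, fe_pair chi ->
  fm (kn n *: (th n.+1 - th n) + xr n) chi =
  schroedinger_form T a beta mu S G (mid n) (kn n *: (th n.+1 - th n) + xr n)
     (2^-1 *: (th n.+1 + th n) + yr n) chi.
Proof.
move=> nN chi Sc; have := Hcn nN Sc.
have := pde_weak_form Hp r_gt0 Hbeta sol (mid_T nN) (fe_pair_adm Sh_H1 Sc).
have -> : kn n *: (th n.+1 - th n) + xr n = kn n *: (Uv n.+1 - Uv n) - cu 1 (mid n).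
  by rewrite /xr addrA -scalerDr /th sub_interchange subrK.
have -> : 2^-1 *: (th n.+1 + th n) + yr n = 2^-1 *: (Uv n.+1 + Uv n) - cu 0 (mid n).
  by rewrite /yr addrA -scalerDr /th (addrACA (Uv n.+1)) -opprD subrK.
rewrite schroedinger_formB (sipBl fm_semi_inner) => -> ->.
by rewrite opprD addrACA subrr addr0.
Qed.

(** rho is orthogonal to the finite element space in the energy form, and so is
    its product with the imaginary unit. *)
Let rot_average n : (n < N)%N -> forall chi, fe_pair chi ->
  fb (rot (yr n)) chi = fb (rot (dl n)) chi.
Proof.
move=> nN chi Sc.
have Sj : fe_pair (rot (- chi)).
  apply: (fe_pair_cmul Sh_sub); rewrite -scaleN1r -[_ *: _]addr0.
  by apply: fe_pair_lin => //; exact: fe_pair0.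
have e : chi = rot (rot (- chi)) by rewrite rot_rot opprK.
rewrite e !(proj1 rotation_fb) yrE (sipBl fb_semi_inner) (sipZl fb_semi_inner).
rewrite (sipDl fb_semi_inner (cu 0 (t n.+1) - W n.+1)) (WE nN Sj) (WE (ltnW nN) Sj).
by rewrite addr0 mulr0 subr0.
Qed.

Definition consistency_constant : R :=
  ((B1 + 1) * (Cr + 1) + 1) + (2 * s1 + g1) + (Cs + 1).

Definition defect_constant : R :=
  (2 * A + 1) + (2 * A1 + 2 * A * residual_lipschitz + 1).

Definition energy_rate : R :=
  2 * energy_constant A mu1 s0 s1 g1 B1 projection_constant.

(** Also the constant in the restriction on the step sizes. *)
Definition gronwall_rate : R := 4 * energy_rate + defect_constant ^+ 2 + 2.

Let projection_constant_ge0 : 0 <= projection_constant.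
Proof.
have [_ [_ _ B10 B20 _]] := cb_ge0 CB.
by rewrite mulr_ge0 ?addr_ge0 ?mulr_ge0 ?addr_ge0 // mulr_ge0.
Qed.

Let energy_rate_ge0 : 0 <= energy_rate.
Proof.
have [[A0 A10 mu10 s00] [s10 g10 B10 B20 Lb0]] := cb_ge0 CB.
rewrite /energy_rate; move: projection_constant projection_constant_ge0 => CP P0.
rewrite mulr_ge0 // /energy_constant !addr_ge0 ?divr_ge0 ?mulr_ge0 ?sqr_ge0 ?addr_ge0 ?mulr_ge0 //.
exact: ltW.
Qed.

Let residual_lipschitz_ge0 : 0 <= residual_lipschitz.
Proof.
have [_ [_ _ B10 _ Lb0]] := cb_ge0 CB.
by rewrite /residual_lipschitz !addr_ge0 // ?mulr_ge0 // !addr_ge0.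
Qed.

Let defect_constant_ge0 : 0 <= defect_constant.
Proof.
have [[A0 A10 _ _] _] := cb_ge0 CB.
by rewrite /defect_constant !addr_ge0 // ?mulr_ge0 // mulr_ge0.
Qed.

Lemma gronwall_rate_ge0 : 0 <= gronwall_rate.
Proof.
by apply: addr_ge0 => //; apply: addr_ge0; [exact: mulr_ge0|exact: sqr_ge0].
Qed.

Let consistency_summands : [/\ 0 <= (B1 + 1) * (Cr + 1) + 1, 0 <= 2 * s1 + g1 & 0 <= Cs + 1].
Proof.
have [_ [s10 g10 B10 _ _]] := cb_ge0 CB.
split.
- by rewrite addr_ge0 // mulr_ge0 // addr_ge0.
- by rewrite addr_ge0 // mulr_ge0.
- by rewrite addr_ge0.
Qed.

Lemma consistency_constant_ge0 : 0 <= consistency_constant.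
Proof.
have [p1 p2 p3] := consistency_summands; apply: addr_ge0 => //; exact: addr_ge0.
Qed.

Let eps := consistency_constant * E.
Let eps0 : 0 <= eps. Proof. by rewrite mulr_ge0 // consistency_constant_ge0. Qed.

Let le_eps b : b <= consistency_constant -> b * E <= eps.
Proof. by move=> bC; rewrite ler_wpM2r. Qed.

Let residual_eps n : (n < N)%N ->
  nrm fm (residual rot (bop n) (xr n) (yr n)) <= eps.
Proof.
move=> nN; apply: le_trans (residual_le nN) (le_eps _).
by have [p1 p2 p3] := consistency_summands; rewrite /consistency_constant -addrA lerDl addr_ge0.
Qed.

Let boundary_eps n : (n < N)%N -> nrm fe (S (mid n) *: xr n + gop n (yr n)) <= eps.
Proof.
move=> nN; apply: le_trans (boundary_le nN) (le_eps _).
have [p1 p2 p3] := consistency_summands.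
by rewrite /consistency_constant addrAC lerDr addr_ge0.
Qed.

Let Cs1_le : Cs + 1 <= consistency_constant.
Proof. by have [p1 p2 p3] := consistency_summands; rewrite /consistency_constant lerDr addr_ge0. Qed.

Let E_le_eps : E <= eps.
Proof.
rewrite -[leLHS]mul1r; apply: le_eps; apply: le_trans Cs1_le.
by rewrite lerDr.
Qed.

Let def n chi := defect fm fb rot (bop n) (a (mid n)) (xr n) (yr n) (dl n) chi.

Let fe_th n : (n <= N)%N -> fe_pair (th n).
Proof. by move=> nN; exact: (fe_pairB Sh_sub (SUv nN) (SW nN)). Qed.

Let m_le_b p : fe_pair p -> nrm fm p <= 2 * nrm fb p.
Proof. by move=> Sp; exact: (fm_le_fb Hp (fe_pair_adm Sh_H1 Sp)). Qed.

Let energy_increment n : (n < N)%N ->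
  nrm fb (th n.+1) ^+ 2 - nrm fb (th n) ^+ 2
   <= energy_rate * (t n.+1 - t n)
      * (nrm fb (th n.+1) ^+ 2 + nrm fb (th n) ^+ 2 + eps ^+ 2)
      + 2 * (def n (th n.+1) - def n (th n)).
Proof.
move=> nN; have [[A0 A10 mu10 s00] [s10 g10 B10 B20 Lb0]] := cb_ge0 CB.
have mT := mid_T nN.
have Sath : fe_pair (2^-1 *: (th n.+1 + th n)).
  rewrite scalerDr; apply: (fe_pair_lin Sh_sub); first exact: fe_th.
  by rewrite -[_ *: _]addr0; apply: (fe_pair_lin Sh_sub); [exact/fe_th/ltnW|exact: fe_pair0].
have [q [Sq qE qb]] := beta_projection mT Sath.
rewrite !(sqr_nrm fb_semi_inner).
apply: (energy_step fm_semi_inner fb_semi_inner fe_semi_inner rotation_fm rotation_fb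
  rotation_fe (cmulD 'i%C) (cmulZ 'i%C) (fun k p q => @fe_pair_lin _ _ _ _ Sh_sub k p q)
  (fun p => @fe_pair_cmul _ _ _ _ Sh_sub 'i%C p)
  (fun p Sp => fe_le_fb Hp (fe_pair_adm Sh_H1 Sp)) m_le_b A0 mu10 s00 g10 B10
  projection_constant_ge0 s10 (mu := mu (mid n)) (s := S (mid n)) (g := gop n)
  (bop := bop n) (q := q)).
- exact: pmulD.
- exact: cmulD.
- exact: a_neq0.
- exact: (cb_a CB).
- exact: (cb_mu CB).
- exact: (cb_S CB).
- by rewrite subr_gt0 t_lt.
- exact: eps0.
- exact/fe_th/ltnW.
- exact: fe_th.
- exact: Sq.
- by move=> v; exact: gop_le.
- by move=> v; exact: bop_le.
- exact: qE.
- exact: qb.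
- exact: boundary_eps.
- exact: residual_eps.
- exact: le_trans (dl_fb nN) E_le_eps.
- exact: rot_average.
- exact: error_equation.
Qed.

Let def_le n chi : (n < N)%N -> fe_pair chi ->
  `|def n chi| <= (2 * A + 1) * eps * nrm fb chi.
Proof.
move=> nN; apply: (defect_le fm_semi_inner fb_semi_inner rotation_fm m_le_b) => //.
- exact: (cb_a CB (mid_T nN)).
- exact: residual_eps.
- exact: le_trans (dl_fb nN) E_le_eps.
Qed.

Let def_diff_le n chi : (n.+1 < N)%N -> fe_pair chi ->
  `|def n.+1 chi - def n chi|
     <= (2 * A1 + 2 * A * residual_lipschitz + 1) * eps * kap n * nrm fb chi.
Proof.
move=> nN; have nN' := ltnW nN; have k0 := kap_ge0 nN.
have [[A0 A10 _ _] _] := cb_ge0 CB.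
apply: (defect_diff_le fm_semi_inner fb_semi_inner rotation_fm m_le_b) => //.
- exact: (cb_a CB (mid_T nN')).
- apply: le_trans (cb_a_lip CB (mid_T nN) (mid_T nN')) _.
  by rewrite ler_wpM2l ?mid_diff.
- exact: residual_eps.
- apply: le_trans (residual_diff nN) _.
  by rewrite ler_wpM2r // ler_wpM2l.
- exact: (cb_a CB (mid_T nN)).
- apply: le_trans (dl_diff fb_semi_inner fb_curve fb2 fb3 nN) _.
  by rewrite ler_wpM2r // le_eps.
Qed.

(** The square root of the factor of eps ^ 2 in [modified_energy_gronwall] at
    the latest time, where 3 t^n + t^(n-1) <= 4 T. *)
Definition stability_constant : R :=
  Num.sqrt (2 * (4 * defect_constant ^+ 2 + 1) * expR (gronwall_rate * (4 * T))).

Lemma discrete_error_le :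
  (forall n, (n < N)%N -> gronwall_rate * (t n.+1 - t n) <= 1 / 3) ->
  forall n, (n <= N)%N ->
  nrm fb (Uv n - W n) <= stability_constant * eps.
Proof.
move=> Hk n nN; rewrite -/(th n).
have [[A0 A10 _ _] _] := cb_ge0 CB.
have d1 : 2 * A + 1 <= defect_constant.
  by rewrite lerDl !addr_ge0 // ?mulr_ge0 // mulr_ge0.
have d2 : 2 * A1 + 2 * A * residual_lipschitz + 1 <= defect_constant.
  by rewrite lerDr addr_ge0 // mulr_ge0.
have def0 i : def i 0 = 0.
  have rot0 : rot 0 = 0 :> V by have := cmulZ 'i%C 0 (0 : V); rewrite !scale0r.
  by rewrite /def /defect rot0 (sip0r fm_semi_inner) (sip0r fb_semi_inner) mulr0 subr0.
have t0 : t 0%N = 0 by case: Ht.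
pose F1 n := if n is i.+1 then def i (th n) else 0.
pose F0 n := if n is i.+1 then def i (th i) else 0.
have bound : nrm fb (th n) ^+ 2 <= 2 * (4 * defect_constant ^+ 2 + 1) * eps ^+ 2
    * expR (gronwall_rate * (3 * t n + t n.-1)).
  apply: (@modified_energy_gronwall R N t (fun n => nrm fb (th n)) F0 F1
    energy_rate defect_constant eps energy_rate_ge0 defect_constant_ge0 eps0 t0) => //.
  - by rewrite th0 /nrm (sip0l fb_semi_inner) sqrtr0.
  - by rewrite /F0 th0 def0.
  - by move=> i iN; exact/ltW/t_lt.
  - case=> [|i] iN; first by rewrite normr0; apply: mulr_ge0 (nrm_ge0 _ _); exact: mulr_ge0.
    apply: le_trans (def_le iN (fe_th iN)) _.
    by rewrite ler_wpM2r ?nrm_ge0 // ler_wpM2r.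
  - case=> [|i] //= iN.
    apply: le_trans (def_diff_le iN (fe_th (ltnW iN))) _.
    by rewrite ler_wpM2r ?nrm_ge0 // ler_wpM2r ?kap_ge0 // ler_wpM2r.
have L0 : 0 <= 2 * (4 * defect_constant ^+ 2 + 1).
  by rewrite mulr_ge0 // addr_ge0 ?mulr_ge0 ?sqr_ge0.
have R0 : 0 <= stability_constant * eps by apply: mulr_ge0 => //; exact: sqrtr_ge0.
rewrite -(ler_pXn2r (n := 2)) ?nnegrE ?nrm_ge0 //.
apply: le_trans bound _; rewrite (exprMn _ stability_constant) /stability_constant sqr_sqrtr; last by rewrite mulr_ge0 ?expR_ge0.
rewrite mulrAC ler_wpM2r ?sqr_ge0 // ler_wpM2l // ler_expR; apply: (ler_wpM2l gronwall_rate_ge0).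
have := t_in nN; have := t_in (leq_trans (leq_pred n) nN); rewrite !in_itv /=.
move=> /andP[_ h1] /andP[_ h2]; lra.
Qed.

Definition error_constant : R := 2 * (stability_constant * consistency_constant) + Cr.

Lemma error_constant_ge0 : 0 <= error_constant.
Proof.
apply: addr_ge0 => //; apply: mulr_ge0 => //; apply: mulr_ge0; first exact: sqrtr_ge0.
exact: consistency_constant_ge0.
Qed.

(** In L^2, theta and rho are both of the optimal order; in the H^1 seminorm
    rho is one order worse. *)
Lemma scheme_error_le :
  (forall n, (n < N)%N -> gronwall_rate * (t n.+1 - t n) <= 1 / 3) ->
  forall n, (n <= N)%N ->
  nrm fm (Uv n - cu 0 (t n)) <= error_constant * ((K ^+ 2 + h ^+ r.+1) * X) /\
  nrm fb (Uv n - cu 0 (t n)) <=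
    error_constant * ((K ^+ 2 + h ^+ r.+1) * X) + ritz_H1 * (h ^+ r * X).
Proof.
move=> Hk n nN; have := discrete_error_le Hk nN; rewrite -/(th n) => thb.
have [rb rm _] := rho_bounds nN.
have -> : Uv n - cu 0 (t n) = th n - (cu 0 (t n) - W n).
  by rewrite /th opprB subrKA.
split.
  apply: le_trans (nrmB fm_semi_inner _ _) _.
  rewrite mulrDl; apply: lerD; last exact: le_trans rm HX.
  apply: le_trans (m_le_b (fe_th nN)) _; rewrite -mulrA ler_wpM2l //.
  by rewrite -mulrA.
apply: le_trans (nrmB fb_semi_inner _ _) _; apply: lerD; last by rewrite mulrA.
apply: le_trans thb _; rewrite /eps mulrA ler_wpM2r // /error_constant.
have sc : 0 <= stability_constant * consistency_constant.
  by apply: mulr_ge0; [exact: sqrtr_ge0|exact: consistency_constant_ge0].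
by rewrite mulr_natl mulr2n -addrA lerDl addr_ge0.
Qed.

End FixedMesh.

(** * The theorem *)

Section Conclusion.
Context {R : realType}.
Notation V := (bmfun R * bmfun R)%type.

Lemma L2_eq_on_D (v w : R -> R[i]) :
  (forall x, x \in `]0, 1[ -> v x = w x) -> L2 v -> L2 w.
Proof.
move=> vw [mr mi iv]; split.
- by apply: eq_measurable_fun mr => x; rewrite inE => Dx; rewrite vw.
- by apply: eq_measurable_fun mi => x; rewrite inE => Dx; rewrite vw.
- by apply: eq_integrable iv => // x; rewrite inE => Dx; rewrite vw.
Qed.

Lemma Hnorm_pair (M : nat) (pt : nat -> R) (p : V) : is_partition 1 M pt ->
  cpiecewise_C1 M pt p.1 p.2 ->
  Hnorm 0 p.1 = nrm fm p /\ Hnorm 1 p.1 <= nrm fm p + nrm fb p.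
Proof.
move=> Hp pp; pose d (l : nat) : R -> R[i] := if l is 0%N then p.1 else p.2.
have L0 : L2 (d 0%N) by exact: bm_L2 (bmfun_bm _).
have c0 : weak_chain 0 d by [].
have c1 : weak_chain 1 d by split=> // -[|l] // _; exact: (pC1_weak_deriv Hp).
split.
  rewrite -[LHS]/(Hnorm 0 (d 0%N)) (Hnorm_weak_chain c0) big_ord1 L2norm_bmfun.
  by rewrite sqrtr_sqr ger0_norm ?nrm_ge0.
rewrite -[leLHS]/(Hnorm 1 (d 0%N)) (Hnorm_weak_chain c1) big_ord_recl big_ord1 /= !L2norm_bmfun.
have m0 := nrm_ge0 fm p; have b0 := nrm_ge0 fb p.
rewrite -[leRHS]ger0_norm ?addr_ge0 // -sqrtr_sqr; apply: ler_wsqrtr.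
by rewrite sqrrD addrAC lerDl mulrn_wge0 // mulr_ge0.
Qed.

(** h^(r+1) <= hstar h^r absorbs the higher power of h in the H^1 estimate. *)
Lemma final_constant_le (e hs rho K2 P X h : R) : 0 <= e -> 0 <= rho -> 0 <= K2 ->
  0 <= P -> 0 <= X -> 0 <= h <= hs ->
  e * ((K2 + h * P) * X) + (e * ((K2 + h * P) * X) + rho * (P * X))
    <= (2 * e * (1 + hs) + rho + 1) * (K2 + P) * X.
Proof.
move=> e0 r0 K0 P0 X0 /andP[h0 hh].
have -> : e * ((K2 + h * P) * X) + (e * ((K2 + h * P) * X) + rho * (P * X))
    = (2 * (e * (K2 + h * P)) + rho * P) * X by ring.
rewrite ler_wpM2r //.
have hs0 : 0 <= hs := le_trans h0 hh.
have h1 : e * (h * P) <= e * (hs * P) by rewrite ler_wpM2l // ler_wpM2r.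
have h2 : 0 <= e * (hs * K2) by rewrite !mulr_ge0.
have h3 : 0 <= e * P by rewrite mulr_ge0.
have h4 : 0 <= rho * K2 by rewrite mulr_ge0.
have h5 : 0 <= e * (hs * P) by rewrite !mulr_ge0.
lra.
Qed.

Lemma bigmax_nat_le (m N : nat) (F : nat -> R) (B : R) : 0 <= B ->
  (forall n, (m <= n < N)%N -> F n <= B) -> \big[Num.max/0]_(m <= n < N) F n <= B.
Proof.
move=> B0 FB; rewrite big_nat_cond; apply: bigmax_le => // n /andP[nN _].
exact: FB.
Qed.

End Conclusion.

Theorem theorem2p10 (R : realType)
    (r : nat) (hstar : R) (Sh : R -> set (R -> R[i]))
    (r_gt0 : (0 < r)%N) (hstar_gt0 : 0 < hstar)
    (Sh_fe : fe_family r hstar Sh)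
    (T : R) (a : R -> R) (beta : R -> R -> R[i])
    (mu S : R -> R) (G : R -> R[i])
    (T_gt0 : 0 < T)
    (a_neq0 : forall t, t \in `[0, T] -> a t != 0)
    (coefs_smooth : smooth_coefficients T a beta mu S G)
    (mu_le0 : forall t, t \in `[0, T] -> mu t <= 0)
    (S_gt0 : forall t, t \in `[0, T] -> 0 < S t)
    (Cstar : R) (Cstar_ge0 : 0 <= Cstar) :
  exists C1 C : R, [/\ 0 <= C1, 0 < C &
    forall (f : R -> R -> R[i]) (u0 : R -> R[i]) (u : R -> R -> R[i]),
    is_unique_solution T r a beta f u0 mu S G u ->
    forall (N : nat) (t : nat -> R),
    is_partition T N t ->
    (forall n, (1 <= n <= N.-1)%N ->
       `|step t n.+1 - step t n|
         <= Cstar * Num.max (step t n ^+ 2) (step t n.+1 ^+ 2)) ->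
    \big[Num.max/0]_(1 <= n < N.+1) (C1 * step t n) <= 1 / 3 ->
    forall (h : R), 0 < h <= hstar ->
    forall (U : nat -> R -> R[i]),
    crank_nicolson t a beta f u0 mu S G (Sh h) N U ->
    forall l : nat, (l <= 1)%N ->
      \big[Num.max/0]_(0 <= n < N.+1) Hnorm l (U n \- u (t n))
        <= C * (max_step t N ^+ 2 + h ^+ (r.+1 - l)) * Xi T r u].
Proof.
have [Sfe [c' Happ] [ci' Hinv]] := Sh_fe.
have [A [A1 [mu1 [s0 [s1 [g1 [B1 [B2 [Lb CB]]]]]]]]] :=
  coef_bounds_exist T_gt0 coefs_smooth a_neq0 mu_le0 S_gt0.
pose c := `|c'|; pose ci := `|ci'|.
pose rate := gronwall_rate r c ci A A1 mu1 s0 s1 g1 B1 B2 Lb Cstar.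
pose e := error_constant r c ci T A A1 mu1 s0 s1 g1 B1 B2 Lb Cstar.
have c0 : 0 <= c by exact: normr_ge0.
have ci0 : 0 <= ci by exact: normr_ge0.
have e0 : 0 <= e by exact: (error_constant_ge0 r ci c0 CB Cstar_ge0).
have rho0 : 0 <= ritz_H1 r c by exact: ritz_H1_ge0.
exists rate, (2 * e * (1 + hstar) + ritz_H1 r c + 1); split.
- exact: (gronwall_rate_ge0 r c0 ci0 CB Cstar).
- rewrite ltr_wpDl // addr_ge0 // mulr_ge0 ?mulr_ge0 //; lra.
move=> f u0 u [sol _] N t Ht Hstep Hk h hh U CN l l1.
have [h0 hhs] := andP hh.
have [Sh_sub Sh_fin Sh_H1 Sh_id [M [pt [Hp _ Sh_poly]]]] := Sfe h hh.
have Hbeta : smooth T (fun i j => i + j <= 1)%N beta by case: coefs_smooth.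
have Hu : smooth T (solution_orders r) u by case: sol.
have happ s : (s <= r)%N -> forall v, sobolev0 s.+1 v ->
    inf [set L2norm (v \- chi) + h * Hnorm 1 (v \- chi) | chi in Sh h]
      <= c * h ^+ s.+1 * Hnorm s.+1 v.
  move=> sr v Hv; apply: le_trans (Happ h hh s sr v Hv) _.
  rewrite ler_wpM2r ?sqrtr_ge0 // ler_wpM2r ?exprn_ge0 ?(ltW h0) //; exact: ler_norm.
have hinv phi : Sh h phi -> H1semi phi <= ci * h^-1 * L2norm phi.
  move=> Sphi; apply: le_trans (Hinv h hh phi Sphi) _.
  by rewrite ler_wpM2r ?sqrtr_ge0 // ler_wpM2r ?invr_ge0 ?(ltW h0) // ler_norm.
have [t0 tN t_lt] := Ht.
have t_in n : (n <= N)%N -> t n \in `[0, T] by move=> nN; exact: partition_in Ht nN.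
have [[SU0 ell] SU cn] := CN.
have /choice[Uv HUv] : forall n, exists p : bmfun R * bmfun R, (n <= N)%N ->
    fe_pair (Sh h) M pt p /\ (p.1 : R -> R[i]) = U n.
  move=> n; have [nN|nN] := boolP (n <= N)%N; last by exists 0.
  by have [p Sp pE] := fe_pair_exists Hp Sh_poly (SU n nN); exists p.
have /choice[Wp HWp] : forall n, exists q : bmfun R * bmfun R,
    fe_pair (Sh h) M pt q /\ forall chi, fe_pair (Sh h) M pt chi ->
    fb (solution_pair T u 0 (t n) - q) chi = 0.
  move=> n; have [q Sq qE] := fe_projection Sh_sub Sh_fin Hp Sh_poly
    (solution_pair T u 0 (t n)) (or_intror (erefl fb)).
  by exists q.
(* U^0 is the elliptic projection of u_0, determined only up to null sets:
   W^0 is chosen equal to it, to make theta^0 vanish. *)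
pose W n := if n is 0%N then Uv 0%N else Wp n.
have X0 : 0 <= Xi T r u by exact: Xi_ge0 T_gt0 Hu.
have SUv n (nN : (n <= N)%N) : fe_pair (Sh h) M pt (Uv n) by case: (HUv n nN).
have WE0 chi : fe_pair (Sh h) M pt chi -> fb (solution_pair T u 0 (t 0%N) - Uv 0%N) chi = 0.
  move=> [Schi pchi]; have [[_ pU] UE] := HUv 0%N (leq0n N).
  have := ell _ Schi; rewrite -UE => /(congr1 (@complex.Re R)).
  have T00 := t_in 0%N (leq0n N); rewrite t0 in T00.
  have I00 : solution_orders r 0 0 by exact: orders2.
  have I01 : solution_orders r 0 1 by exact: orders2.
  have wu := ubm_weak_deriv Hu I00 I01 T00.
  have u0E x : x \in `]0, 1[ -> ubm T u 0 0 0 x = u0 x.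
    move=> /subset_itv_oo_cc x1; rewrite (ubmE Hu I00 T00).
    by case: sol => _ _ _ _ /(_ x x1).
  have wu0 : weak_deriv u0 (ubm T u 0 1 0).
    apply: weak_deriv_ae wu; first exact: L2_eq_on_D u0E (bm_L2 (bmfun_bm _)).
    exact: eqD_aeqD.
  rewrite (Bform_weak_deriv (pC1_weak_deriv Hp pU) (pC1_weak_deriv Hp pchi)).
  rewrite (Bform_weak_deriv wu0 (pC1_weak_deriv Hp pchi)) !Re_ip => eq0.
  by rewrite (sipBl fb_semi_inner) t0; apply/eqP; rewrite subr_eq0; apply/eqP.
have SW n : (n <= N)%N -> fe_pair (Sh h) M pt (W n).
  by case: n => [|n] nN; [exact: SUv|case: (HWp n.+1)].
have WE n : (n <= N)%N -> forall chi, fe_pair (Sh h) M pt chi ->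
    fb (solution_pair T u 0 (t n) - W n) chi = 0.
  by case: n => [|n] nN; [exact: WE0|case: (HWp n.+1)].
have th0 : Uv 0%N - W 0%N = 0 by rewrite subrr.
have Hcn n : (n < N)%N -> forall chi, fe_pair (Sh h) M pt chi ->
    fm ((t n.+1 - t n)^-1 *: (Uv n.+1 - Uv n)) chi =
    schroedinger_form T a beta mu S G (midpoint t n.+1) ((t n.+1 - t n)^-1 *: (Uv n.+1 - Uv n))
     (2^-1 *: (Uv n.+1 + Uv n)) chi + rip (f (midpoint t n.+1)) chi.1.
  move=> nN chi [Schi pchi].
  have [[_ p1] U1] := HUv n.+1 nN; have [[_ p0] U0] := HUv n (ltnW nN).
  apply: (crank_nicolson_weak_form Hp Hbeta (n := n.+1) CN) => //.
  by apply: mid_in; apply: t_in => //; exact: ltnW.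
have Hrate n : (n < N)%N -> rate * (t n.+1 - t n) <= 1 / 3.
  move=> nN; apply: le_trans Hk.
  apply: (le_bigmax_seq 0 n.+1 xpredT (fun n => rate * step t n)) => //.
  by rewrite mem_index_iota /= ltnS.
have main n (nN : (n <= N)%N) := scheme_error_le Sh_sub Sh_fin Sh_H1 Hp Sh_poly Sh_id c0 ci0 h0
  happ hinv r_gt0 T_gt0 a_neq0 Hbeta CB sol Ht Cstar_ge0 Hstep SUv SW WE th0 Hcn Hrate nN.
have hr0 : 0 <= h ^+ r by rewrite exprn_ge0 // ltW.
have hl0 : 0 <= h ^+ (r.+1 - l) by rewrite exprn_ge0 // ltW.
apply: bigmax_nat_le => [|n]; last rewrite ltnS => /andP[_ nN].
  rewrite mulr_ge0 // mulr_ge0 ?addr_ge0 ?sqr_ge0 // mulr_ge0 ?mulr_ge0 //; lra.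
have {main}[mm mb] := main n nN.
have [pU UE] := HUv n nN; have [_ pu] := pU.
have pE : U n \- u (t n) = (Uv n - solution_pair T u 0 (t n)).1 :> (R -> R[i]).
  have I00 : solution_orders r 0 0 by exact: orders2.
  by apply/funext => x /=; rewrite (ubmE Hu I00 (t_in n nN)) UE.
have pp : cpiecewise_C1 M pt (Uv n - solution_pair T u 0 (t n)).1
    (Uv n - solution_pair T u 0 (t n)).2.
  have I00 : solution_orders r 0 0 by exact: orders2.
  have I01 : solution_orders r 0 1 by exact: orders2.
  have := pC1D pu (pC1Z (-1) (ubm_pC1 Hu Hp I00 I01 (t_in n nN))).
  by apply: pC1_ext => x /=; rewrite mulN1r.
have [E0 E1] := Hnorm_pair Hp pp.
have h01 : 0 <= h <= hstar by rewrite ltW.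
have K2 := sqr_ge0 (max_step t N).
have := final_constant_le e0 rho0 K2 hr0 X0 h01; rewrite -exprS => fin.
rewrite pE; move: l l1 hl0 => [|[|//]] _ _.
- rewrite subn0 E0; apply: le_trans mm _.
  have hr1 : 0 <= h ^+ r.+1 by rewrite exprn_ge0 // ltW.
  rewrite mulrA; apply: (ler_wpM2r X0); apply: (ler_wpM2r (addr_ge0 K2 hr1)).
  have eh0 : 0 <= e * hstar by rewrite mulr_ge0 // ltW.
  by rewrite -/e; lra.
- rewrite subSS subn0; exact: le_trans E1 (le_trans (lerD mm mb) fin).
Qed.
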